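(* Let $a>0$, $\alpha>0$, $\beta>0$, $c_o\in\mathbf{R}$ and $b\in\mathbf{R}$ with $b\neq 0$. Let $X:\Sigma\to\mathbf{R}^3$ be an axially symmetric immersion, with axis of rotation the $z$-axis, which is critical for the Euler-Helfrich energy $E=E_{a,c_o,b,\alpha,\beta}$. Then either the surface is a part of a Delaunay surface bounded by circles of radii $\sqrt{\alpha/\beta}$, or, after a suitable vertical translation (replacing $X$ by $X+tE_3$ for a suitable $t\in\mathbf{R}$, $E_3=(0,0,1)$), the mean curvature of the immersion satisfies $$H+c_o=-\frac{\nu_3}{z}$$ on $\Sigma$ and each boundary component is one of the following: (i) a geodesic circle located in the plane $\{z=0\}$; (ii) a non geodesic circle of radius $\sqrt{\alpha/\beta}$; (iii) a non geodesic circle of radius $r\neq\sqrt{\alpha/\beta}$ along which $a\kappa_g r\pm b\kappa_n z\equiv 0$ holds (for one of the two choices of sign). Moreover, along boundary components of case (i) and (ii), $a(H+c_o)^2+bK\equiv 0$ holds.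
   Context: $\Sigma$ is a compact, connected, oriented surface with smooth boundary and $X:\Sigma\to\mathbf{R}^3$ is an immersion of class $\mathcal{C}^4$ up to the boundary, with unit normal $\nu$ (oriented so that $\nu$ points out of convex domains). $H$ is the mean curvature with sign convention $2H=-\mathrm{tr}(d\nu)$, equivalently $\Delta X=2H\nu$ (the round sphere of radius $R$ with outward normal has $H=-1/R$), and $K$ is the Gaussian curvature. $z=X\cdot E_3$, $\nu_3=\nu\cdot E_3$. Along $\partial\Sigma$ (positively oriented, arc length $s$, $(\,)'=d/ds$): $T$ is the unit tangent, $n=T\times\nu$ the outward conormal, $\kappa=\|T'\|$ the curvature, and $\kappa_g,\kappa_n,\tau_g$ (geodesic curvature, normal curvature, geodesic torsion) are defined by $T'=\kappa_g n+\kappa_n\nu$, $n'=-\kappa_g T+\tau_g\nu$, $\nu'=-\tau_g n-\kappa_n T$. (The sign of $\kappa_g$ is opposite to the usual one.) A boundary circle is geodesic if $\kappa_g\equiv0$ along it. The Euler-Helfrich energy is $$E_{a,c_o,b,\alpha,\beta}=\int_\Sigma\left(a[H+c_o]^2+bK\right)d\Sigma+\oint_{\partial\Sigma}\left(\alpha\kappa^2+\beta\right)ds.$$ $X$ is critical for $E$ if the first variation of $E$ vanishes for all $\mathcal{C}^4$ variation fields (no boundary restriction). With $J:=2\alpha T''+(3\alpha\kappa^2-\beta)T$, this is equivalent to: $\Delta H+2(H+c_o)(H[H-c_o]-K)=0$ on $\Sigma$, and on $\partial\Sigma$: $a(H+c_o)+b\kappa_n=0$, $J'\cdot\nu-a\partial_nH+b\tau_g'=0$,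 $J'\cdot n+a(H+c_o)^2+bK=0$. Axially symmetric means that the surface is a surface of revolution, obtained by rotating a planar profile curve about an axis; $\Sigma$ is then a topological disc or annulus. A Delaunay surface is a surface of revolution with constant mean curvature (planes and spheres included). The equation $H+c_o=-\nu_3/z$ is understood at points where $z=0$ by continuity, i.e. as $(H+c_o)z=-\nu_3$ on $\Sigma$. *)

(* Defs.v *)
From Stdlib Require Export Reals List.
From Coquelicot Require Export Coquelicot.
Import ListNotations.
Open Scope R_scope.

Definition R3 : Type := (R * R * R)%type.

Definition x1 (p : R3) : R := fst (fst p).
Definition x2 (p : R3) : R := snd (fst p).
Definition x3 (p : R3) : R := snd p.

Definition vadd (p q : R3) : R3 := (x1 p + x1 q, x2 p + x2 q, x3 p + x3 q).
Definition vscale (t : R) (p : R3) : R3 := (t * x1 p, t * x2 p, t * x3 p).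
Definition dot (p q : R3) : R := x1 p * x1 q + x2 p * x2 q + x3 p * x3 q.
Definition cross (p q : R3) : R3 :=
  (x2 p * x3 q - x3 p * x2 q,
   x3 p * x1 q - x1 p * x3 q,
   x1 p * x2 q - x2 p * x1 q).
Definition norm3 (p : R3) : R := sqrt (dot p p).
Definition normalize (p : R3) : R3 := vscale (/ norm3 p) p.

Definition vDerive (c : R -> R3) (t : R) : R3 :=
  (Derive (fun s => x1 (c s)) t,
   Derive (fun s => x2 (c s)) t,
   Derive (fun s => x3 (c s)) t).

(** Up to diffeomorphism, a disc is {|p| <= 1} and an annulus is
    {1/2 <= |p| <= 1} in the plane with its standard orientation. *)

Inductive model := Disc | Annulus.

Definition inner_radius (D : model) : R :=
  match D with Disc => 0 | Annulus => / 2 end.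

Definition Sigma (D : model) (u v : R) : Prop :=
  inner_radius D <= sqrt (u ^ 2 + v ^ 2) <= 1.

Inductive component := Outer | Inner.

Definition boundary (D : model) : list component :=
  match D with Disc => [Outer] | Annulus => [Outer; Inner] end.

Definition radius (c : component) : R :=
  match c with Outer => 1 | Inner => / 2 end.

(** The positive orientation of the boundary (domain on the left) is
    counterclockwise on the outer circle and clockwise on the inner one. *)
Definition orient (c : component) : R :=
  match c with Outer => 1 | Inner => - 1 end.

(** A map on Sigma is given by a total function; only its values on Sigma
    matter, and "up to the boundary" means that the function is C^4 near every
    point of the closed set Sigma.  [ex_diff_n f 4] at every point of an open
    set says that the partial derivatives of order at most 4 exist and are
    continuous there. *)
Definition C4 (D : model) (X : R -> R -> R3) : Prop :=
  forall u v, Sigma D u v ->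
    locally_2d (fun x y =>
      ex_diff_n (fun x y => x1 (X x y)) 4 x y /\
      ex_diff_n (fun x y => x2 (X x y)) 4 x y /\
      ex_diff_n (fun x y => x3 (X x y)) 4 x y) u v.

Definition d_u (X : R -> R -> R3) (u v : R) : R3 := vDerive (fun s => X s v) u.
Definition d_v (X : R -> R -> R3) (u v : R) : R3 := vDerive (fun s => X u s) v.

Definition immersion (D : model) (X : R -> R -> R3) : Prop :=
  C4 D X /\
  forall u v, Sigma D u v -> cross (d_u X u v) (d_v X u v) <> (0, 0, 0).

Definition nu (X : R -> R -> R3) (u v : R) : R3 :=
  normalize (cross (d_u X u v) (d_v X u v)).

Definition area_density (X : R -> R -> R3) (u v : R) : R :=
  norm3 (cross (d_u X u v) (d_v X u v)).

Definition I_uu X u v : R := dot (d_u X u v) (d_u X u v).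
Definition I_uv X u v : R := dot (d_u X u v) (d_v X u v).
Definition I_vv X u v : R := dot (d_v X u v) (d_v X u v).
Definition det_I X u v : R := I_uu X u v * I_vv X u v - I_uv X u v ^ 2.

(** II(x, y) = - d nu(x) . y *)
Definition II_uu X u v : R := - dot (d_u (nu X) u v) (d_u X u v).
Definition II_uv X u v : R := - dot (d_u (nu X) u v) (d_v X u v).
Definition II_vu X u v : R := - dot (d_v (nu X) u v) (d_u X u v).
Definition II_vv X u v : R := - dot (d_v (nu X) u v) (d_v X u v).

(** The matrix of - d nu is I^-1 II, so the next two definitions read
    2 H = - tr (d nu) and K = det (d nu). *)
Definition H (X : R -> R -> R3) (u v : R) : R :=
  (I_vv X u v * II_uu X u v - I_uv X u v * (II_uv X u v + II_vu X u v)
   + I_uu X u v * II_vv X u v) / (2 * det_I X u v).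

Definition K (X : R -> R -> R3) (u v : R) : R :=
  (II_uu X u v * II_vv X u v - II_uv X u v * II_vu X u v) / det_I X u v.

(** A boundary component is parametrized by the polar angle [th], which is in
    general not arc length; [d/ds] is [orient c / speed X c th] times [d/dth]. *)

Definition on_bdry {A : Type} (f : R -> R -> A) (c : component) (th : R) : A :=
  f (radius c * cos th) (radius c * sin th).

Definition speed (X : R -> R -> R3) (c : component) (th : R) : R :=
  norm3 (vDerive (on_bdry X c) th).

Definition d_s (X : R -> R -> R3) (c : component) (w : R -> R3) (th : R) : R3 :=
  vscale (orient c / speed X c th) (vDerive w th).

Definition tangent X c : R -> R3 := d_s X c (on_bdry X c).
Definition dtangent X c : R -> R3 := d_s X c (tangent X c).
Definition conormal X c th : R3 := cross (tangent X c th) (on_bdry (nu X) c th).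

Definition kappa X c th : R := norm3 (dtangent X c th).

(** T' = kappa_g n + kappa_n nu, in the orthonormal frame (T, n, nu). *)
Definition kappa_g X c th : R := dot (dtangent X c th) (conormal X c th).
Definition kappa_n X c th : R := dot (dtangent X c th) (on_bdry (nu X) c th).

Definition geodesic X c : Prop := forall th, kappa_g X c th = 0.

(** The image of the component [c] is the horizontal circle of radius [r] > 0
    with center (0, 0, h). *)
Definition bdry_circle (X : R -> R -> R3) (c : component) (r h : R) : Prop :=
  0 < r /\
  forall p : R3, (exists th, p = on_bdry X c th) <->
                 (exists ph, p = (r * cos ph, r * sin ph, h)).

(** Integral over Sigma of [f du dv], in polar coordinates. *)
Definition int_Sigma (D : model) (f : R -> R -> R) : R :=
  RInt (fun rho =>
    RInt (fun th => f (rho * cos th) (rho * sin th) * rho) 0 (2 * PI))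
    (inner_radius D) 1.

Definition int_bdry (X : R -> R -> R3) (c : component) (f : R -> R) : R :=
  RInt (fun th => f th * speed X c th) 0 (2 * PI).

Definition energy (a c_o b alpha beta : R) (D : model) (X : R -> R -> R3) : R :=
  int_Sigma D (fun u v =>
    (a * (H X u v + c_o) ^ 2 + b * K X u v) * area_density X u v)
  + fold_right Rplus 0
      (map (fun c => int_bdry X c (fun th => alpha * kappa X c th ^ 2 + beta))
           (boundary D)).

Definition critical (a c_o b alpha beta : R) (D : model) (X : R -> R -> R3) : Prop :=
  forall V : R -> R -> R3, C4 D V ->
    is_derive (fun t : R =>
      energy a c_o b alpha beta D (fun u v => vadd (X u v) (vscale t (V u v)))) 0 0.

(** The profile curve is sigma |-> (x sigma, z sigma).  The sign [eps] is the
    sense of rotation: [nu] is determined by the orientation of the parameter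
    domain, and the two signs give the two orientations of the surface. *)
Definition axially_symmetric (D : model) (X : R -> R -> R3) : Prop :=
  exists (x z : R -> R) (eps : R), (eps = 1 \/ eps = - 1) /\
    forall sigma th, inner_radius D <= sigma <= 1 ->
      X (sigma * cos th) (sigma * sin th) =
        (x sigma * cos th, eps * (x sigma * sin th), z sigma).

Definition Delaunay (D : model) (X : R -> R -> R3) : Prop :=
  axially_symmetric D X /\
  exists h0, forall u v, Sigma D u v -> H X u v = h0.

Definition translate (t : R) (X : R -> R -> R3) (u v : R) : R3 :=
  vadd (X u v) (vscale t (0, 0, 1)).

Definition type_i (X : R -> R -> R3) (c : component) : Prop :=
  geodesic X c /\ exists r, bdry_circle X c r 0.

Definition type_ii (alpha beta : R) (X : R -> R -> R3) (c : component) : Prop :=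
  ~ geodesic X c /\ exists h, bdry_circle X c (sqrt (alpha / beta)) h.

Definition type_iii (a b alpha beta : R) (X : R -> R -> R3) (c : component) : Prop :=
  ~ geodesic X c /\
  exists r h, r <> sqrt (alpha / beta) /\ bdry_circle X c r h /\
    ((forall th, a * kappa_g X c th * r
                 + b * kappa_n X c th * x3 (on_bdry X c th) = 0) \/
     (forall th, a * kappa_g X c th * r
                 - b * kappa_n X c th * x3 (on_bdry X c th) = 0)).

(* Main.v *)
From Stdlib Require Import Psatz Classical ClassicalEpsilon Ranalysis5.
Require Import Defs.
Open Scope R_scope.

(** The energy is only varied among surfaces of revolution about the same axis.
    In polar coordinates (x, th) on the parameter domain, X is, up to a
    half-turn, the rotation of a profile curve x |-> (r x, z x) with r > 0 off
    the axis.  The energy is then 2 pi times a one-dimensional functional: the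
    integral of (a h^2 + b k S / r) r w plus alpha / r + beta r at each end
    that is a boundary circle.  Here w is the speed of the profile,
    (C, S) = (r', z') / w its unit tangent, k its curvature, e the sense of
    rotation, and h = H + c_o = e (k + S / r) / 2 + c_o; the third component of
    nu is e C.

    Write psi for the normal component of a variation and D for w^-1 d/dx.
    The variation of the integrand is
    a w (D (r D h) + 2 r h (H (H - c_o) - K)) psi plus the derivative of a flux
    that is linear in the 1-jet of the variation
    ([is_derive_natural_flux_along]).  Hence the factor of psi vanishes
    ([EL_op_zero]), and at every boundary circle the flux balances the
    variation of alpha / r + beta r.  Three variations of the end point turn
    this into the conditions used here ([natural_conditions]): turning the
    tangent gives a h + b kappa_n = 0; sliding along the profile gives
    a h^2 + b K = (beta - alpha / r^2) kappa_g; a vertical translation makes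
    the Wronskian of h and h z + nu_3 vanish there.

    The interior equation is a linear second order equation for h, given its
    coefficients, and the function h z + nu_3 solves it as well
    ([height_system]).  As their Wronskian vanishes on the outer circle, either
    h and its derivative vanish there, so that h = 0 everywhere, or
    h z + nu_3 = t h everywhere for some constant t.

    In the first case H is constant, and the boundary conditions force
    kappa_n = 0, so kappa_g is not 0 and beta = alpha / r^2 ([delaunay_case]).
    In the second case the translation by - t yields h z = - nu_3
    ([reduced_case]).  On a geodesic boundary circle nu_3 = 0, and h is not 0
    because kappa_n is not, whence z = 0; on the other circles nu_3 = - h z and
    a h = - b kappa_n combine to the equation of case (iii).  Finally
    (beta - alpha / r^2) kappa_g vanishes exactly in the cases (i) and (ii). *)

(** * Computing derivatives *)

Lemma is_derive_eq (f : R -> R) (x l l' : R) : is_derive f x l -> l = l' -> is_derive f x l'.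
Proof. now intros H <-. Qed.

(** Rewriting up to eta: [auto_derive] leaves the derivative of an abstract
    function [f] as that of [fun y => f y]. *)
Ltac derive_rewrite H :=
  match type of H with
  | is_derive ?f ?x ?l =>
      let E := fresh in
      assert (E : Derive (fun y : R => f y) x = l) by exact (is_derive_unique f x l H);
      rewrite E; clear E
  end.

(** The two sides of an equality produced by the calculus lemmas have the type
    of a normed module, which [ring] does not recognize as [R]. *)
Ltac Rring := match goal with |- @eq _ ?a ?b => change (@eq R a b); ring end.

(** * Functions of class C^n near a point of the plane *)

Definition Cn (n : nat) (f : R -> R -> R) (u v : R) : Prop :=
  locally_2d (fun x y => ex_diff_n f n x y) u v.

Definition Du (f : R -> R -> R) (u v : R) : R := Derive (fun s => f s v) u.
Definition Dv (f : R -> R -> R) (u v : R) : R := Derive (fun s => f u s) v.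

Lemma locally_2d_locally_2d (P : R -> R -> Prop) u v :
  locally_2d P u v -> locally_2d (fun x y => locally_2d P x y) u v.
Proof.
  intros HP. apply (locally_2d_impl_strong P); [|exact HP].
  now apply locally_2d_forall.
Qed.

Lemma Cn_locally n f u v :
  Cn n f u v -> locally_2d (fun x y => Cn n f x y) u v.
Proof. apply locally_2d_locally_2d. Qed.

Lemma Cn_continuity n f u v : Cn n f u v -> continuity_2d_pt f u v.
Proof. intros Hf; apply locally_2d_singleton in Hf; destruct n; apply Hf. Qed.

Lemma Cn_S n f u v :
  Cn (S n) f u v <->
  locally_2d (fun x y => continuity_2d_pt f x y /\
    ex_derive (fun s => f s y) x /\ ex_derive (fun s => f x s) y) u v
  /\ Cn n (Du f) u v /\ Cn n (Dv f) u v.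
Proof.
  unfold Cn; split.
  - intros Hf; repeat split;
      (eapply locally_2d_impl; [|exact Hf]); apply locally_2d_forall;
      intros x y (H1 & H2 & H3 & H4 & H5); auto.
  - intros (H1 & H2 & H3).
    apply (locally_2d_impl (fun x y => (continuity_2d_pt f x y /\
      ex_derive (fun s => f s y) x /\ ex_derive (fun s => f x s) y) /\
      (ex_diff_n (Du f) n x y /\ ex_diff_n (Dv f) n x y))).
    + apply locally_2d_forall; intros x y [(A & B & C) [D E]].
      exact (conj A (conj B (conj C (conj D E)))).
    + apply locally_2d_and; [exact H1|now apply locally_2d_and].
Qed.

Lemma Cn_Du n f u v : Cn (S n) f u v -> Cn n (Du f) u v.
Proof. intros Hf; apply Cn_S in Hf; tauto. Qed.

Lemma Cn_Dv n f u v : Cn (S n) f u v -> Cn n (Dv f) u v.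
Proof. intros Hf; apply Cn_S in Hf; tauto. Qed.

Lemma Cn_ex_derive_u n f u v : Cn (S n) f u v -> ex_derive (fun s => f s v) u.
Proof. intros Hf; apply Cn_S, proj1, locally_2d_singleton in Hf; tauto. Qed.

Lemma Cn_ex_derive_v n f u v : Cn (S n) f u v -> ex_derive (fun s => f u s) v.
Proof. intros Hf; apply Cn_S, proj1, locally_2d_singleton in Hf; tauto. Qed.

Lemma Cn_pred n f u v : Cn (S n) f u v -> Cn n f u v.
Proof.
  intros Hf; eapply locally_2d_impl; [|exact Hf].
  apply locally_2d_forall; intros x y; apply ex_diff_n_m; auto.
Qed.

Lemma Cn_le m n f u v : (m <= n)%nat -> Cn n f u v -> Cn m f u v.
Proof.
  intros Hmn Hf; eapply locally_2d_impl; [|exact Hf].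
  apply locally_2d_forall; intros x y; now apply ex_diff_n_m.
Qed.

Lemma Cn_ext_loc n f g u v :
  locally_2d (fun x y => f x y = g x y) u v -> Cn n f u v -> Cn n g u v.
Proof.
  intros E Hf. apply locally_2d_locally_2d in E.
  apply (locally_2d_impl (fun x y => ex_diff_n f n x y)); [|exact Hf].
  eapply locally_2d_impl; [|exact E]; apply locally_2d_forall; intros x y.
  apply ex_diff_n_ext_loc.
Qed.

Lemma Cn_ext n f g u v :
  (forall x y, f x y = g x y) -> Cn n f u v -> Cn n g u v.
Proof. intros E; apply Cn_ext_loc; now apply locally_2d_forall. Qed.

(** The closure lemmas are inductions on [n] through this one, so that each
    only has to supply formulas for the two partial derivatives. *)
Lemma Cn_step n f f1 f2 u v :
  locally_2d (fun x y => continuity_2d_pt f x y /\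
    is_derive (fun s => f s y) x (f1 x y) /\
    is_derive (fun s => f x s) y (f2 x y)) u v ->
  Cn n f1 u v -> Cn n f2 u v -> Cn (S n) f u v.
Proof.
  intros Hf H1 H2. apply Cn_S. repeat split.
  - eapply locally_2d_impl; [|exact Hf]; apply locally_2d_forall.
    intros x y (A & B & C); repeat split; trivial; eexists; eassumption.
  - apply (Cn_ext_loc n f1); trivial.
    eapply locally_2d_impl; [|exact Hf]; apply locally_2d_forall.
    intros x y (A & B & C). symmetry; now apply is_derive_unique.
  - apply (Cn_ext_loc n f2); trivial.
    eapply locally_2d_impl; [|exact Hf]; apply locally_2d_forall.
    intros x y (A & B & C). symmetry; now apply is_derive_unique.
Qed.

Lemma Cn_const n c u v : Cn n (fun _ _ => c) u v.
Proof.
  revert c; induction n as [|n IH]; intros c.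
  - apply locally_2d_forall; intros x y; split; trivial.
    apply continuity_2d_pt_const.
  - apply (Cn_step n _ (fun _ _ => 0) (fun _ _ => 0)); auto.
    apply locally_2d_forall; intros x y; (split; [|split]).
    + apply continuity_2d_pt_const.
    + exact (is_derive_const _ _).
    + exact (is_derive_const _ _).
Qed.

Lemma Cn_fst n u v : Cn n (fun x _ => x) u v.
Proof.
  destruct n as [|n].
  - apply locally_2d_forall; intros x y; split; trivial.
    apply continuity_2d_pt_id1.
  - apply (Cn_step n _ (fun _ _ => 1) (fun _ _ => 0)); try apply Cn_const.
    apply locally_2d_forall; intros x y; (split; [|split]).
    + apply continuity_2d_pt_id1.
    + exact (is_derive_id _).
    + exact (is_derive_const _ _).
Qed.

Lemma Cn_snd n u v : Cn n (fun _ y => y) u v.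
Proof.
  destruct n as [|n].
  - apply locally_2d_forall; intros x y; split; trivial.
    apply continuity_2d_pt_id2.
  - apply (Cn_step n _ (fun _ _ => 0) (fun _ _ => 1)); try apply Cn_const.
    apply locally_2d_forall; intros x y; (split; [|split]).
    + apply continuity_2d_pt_id2.
    + exact (is_derive_const _ _).
    + exact (is_derive_id _).
Qed.

Lemma Cn_locally_derive n f u v : Cn (S n) f u v ->
  locally_2d (fun x y => continuity_2d_pt f x y /\
    is_derive (fun s => f s y) x (Du f x y) /\
    is_derive (fun s => f x s) y (Dv f x y)) u v.
Proof.
  intros Hf; apply Cn_S, proj1 in Hf.
  eapply locally_2d_impl; [|exact Hf]; apply locally_2d_forall.
  intros x y (A & B & C); (split; [|split]); trivial; now apply Derive_correct.
Qed.

Lemma Cn_plus n f g u v :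
  Cn n f u v -> Cn n g u v -> Cn n (fun x y => f x y + g x y) u v.
Proof.
  revert f g; induction n as [|n IH]; intros f g Hf Hg.
  - eapply locally_2d_impl; [|exact (locally_2d_and _ _ _ _ Hf Hg)].
    apply locally_2d_forall; intros x y [A B]; split; trivial.
    apply continuity_2d_pt_plus; [apply A|apply B].
  - apply (Cn_step n _ (fun x y => Du f x y + Du g x y)
                       (fun x y => Dv f x y + Dv g x y)).
    + eapply locally_2d_impl;
        [|exact (locally_2d_and _ _ _ _ (Cn_locally_derive _ _ _ _ Hf) (Cn_locally_derive _ _ _ _ Hg))].
      apply locally_2d_forall; intros x y [(A1 & A2 & A3) (B1 & B2 & B3)].
      (split; [|split]).
      * now apply continuity_2d_pt_plus.
      * now apply @is_derive_plus.
      * now apply @is_derive_plus.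
    + apply IH; now apply Cn_Du.
    + apply IH; now apply Cn_Dv.
Qed.

Lemma Cn_mult n f g u v :
  Cn n f u v -> Cn n g u v -> Cn n (fun x y => f x y * g x y) u v.
Proof.
  revert f g; induction n as [|n IH]; intros f g Hf Hg.
  - eapply locally_2d_impl; [|exact (locally_2d_and _ _ _ _ Hf Hg)].
    apply locally_2d_forall; intros x y [A B]; split; trivial.
    apply continuity_2d_pt_mult; [apply A|apply B].
  - apply (Cn_step n _ (fun x y => Du f x y * g x y + f x y * Du g x y)
                       (fun x y => Dv f x y * g x y + f x y * Dv g x y)).
    + eapply locally_2d_impl;
        [|exact (locally_2d_and _ _ _ _ (Cn_locally_derive _ _ _ _ Hf) (Cn_locally_derive _ _ _ _ Hg))].
      apply locally_2d_forall; intros x y [(A1 & A2 & A3) (B1 & B2 & B3)].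
      (split; [|split]).
      * now apply continuity_2d_pt_mult.
      * apply (is_derive_mult (fun s => f s y) (fun s => g s y)); trivial.
        intros; apply Rmult_comm.
      * apply (is_derive_mult (fun s => f x s) (fun s => g x s)); trivial.
        intros; apply Rmult_comm.
    + apply Cn_plus; apply IH; (now apply Cn_Du) || (now apply Cn_pred).
    + apply Cn_plus; apply IH; (now apply Cn_Dv) || (now apply Cn_pred).
Qed.

Lemma Cn_opp n f u v : Cn n f u v -> Cn n (fun x y => - f x y) u v.
Proof.
  intros Hf; apply (Cn_ext n (fun x y => (-1) * f x y)).
  - intros; ring.
  - apply Cn_mult; [apply Cn_const|exact Hf].
Qed.

Lemma Cn_minus n f g u v :
  Cn n f u v -> Cn n g u v -> Cn n (fun x y => f x y - g x y) u v.
Proof. intros Hf Hg; apply Cn_plus; [exact Hf|now apply Cn_opp]. Qed.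

Lemma Cn_pow n k f u v : Cn n f u v -> Cn n (fun x y => f x y ^ k) u v.
Proof.
  intros Hf; induction k as [|k IH]; simpl.
  - apply Cn_const.
  - now apply Cn_mult.
Qed.

Lemma Cn_locally_neq0 n f u v :
  Cn n f u v -> f u v <> 0 -> locally_2d (fun x y => f x y <> 0) u v.
Proof. intros Hf; apply continuity_2d_pt_neq_0; now apply (Cn_continuity n). Qed.

Lemma Cn_locally_continuity n f u v :
  Cn n f u v -> locally_2d (fun x y => continuity_2d_pt f x y) u v.
Proof.
  intros Hf; eapply locally_2d_impl; [|exact (Cn_locally _ _ _ _ Hf)].
  apply locally_2d_forall; intros x y; apply Cn_continuity.
Qed.

Lemma Cn_inv n f u v :
  Cn n f u v -> f u v <> 0 -> Cn n (fun x y => / f x y) u v.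
Proof.
  revert f; induction n as [|n IH]; intros f Hf H0.
  - eapply locally_2d_impl;
      [|exact (locally_2d_and _ _ _ _ (Cn_locally_continuity _ _ _ _ Hf) (Cn_locally_neq0 _ _ _ _ Hf H0))].
    apply locally_2d_forall; intros x y [A B]; split; trivial.
    now apply continuity_2d_pt_inv.
  - apply (Cn_step n _ (fun x y => - Du f x y * ((/ f x y) * (/ f x y)))
                       (fun x y => - Dv f x y * ((/ f x y) * (/ f x y)))).
    + eapply locally_2d_impl;
        [|exact (locally_2d_and _ _ _ _ (Cn_locally_derive _ _ _ _ Hf) (Cn_locally_neq0 _ _ _ _ Hf H0))].
      apply locally_2d_forall; intros x y [(A1 & A2 & A3) B].
      (split; [|split]).
      * now apply continuity_2d_pt_inv.
      * replace (- Du f x y * _) with (- Du f x y / f x y ^ 2) by (field; trivial).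
        now apply (is_derive_inv (fun s => f s y)).
      * replace (- Dv f x y * _) with (- Dv f x y / f x y ^ 2) by (field; trivial).
        now apply (is_derive_inv (fun s => f x s)).
    + assert (Cn n (fun x y => / f x y) u v) by (apply IH; [now apply Cn_pred|trivial]).
      apply Cn_mult; [apply Cn_opp; now apply Cn_Du|now apply Cn_mult].
    + assert (Cn n (fun x y => / f x y) u v) by (apply IH; [now apply Cn_pred|trivial]).
      apply Cn_mult; [apply Cn_opp; now apply Cn_Dv|now apply Cn_mult].
Qed.

Lemma Cn_div n f g u v :
  Cn n f u v -> Cn n g u v -> g u v <> 0 -> Cn n (fun x y => f x y / g x y) u v.
Proof. intros Hf Hg H0; apply Cn_mult; [exact Hf|now apply Cn_inv]. Qed.

Lemma Cn_locally_pos n f u v :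
  Cn n f u v -> 0 < f u v -> locally_2d (fun x y => 0 < f x y) u v.
Proof.
  intros Hf H0. destruct (Cn_continuity _ _ _ _ Hf (mkposreal _ H0)) as [d Hd].
  exists d; intros x y Hx Hy; specialize (Hd x y Hx Hy); simpl in Hd.
  apply Rabs_lt_between in Hd; lra.
Qed.

Lemma Cn_sqrt n f u v :
  Cn n f u v -> 0 < f u v -> Cn n (fun x y => sqrt (f x y)) u v.
Proof.
  revert f; induction n as [|n IH]; intros f Hf H0.
  - eapply locally_2d_impl;
      [|exact (locally_2d_and _ _ _ _ (Cn_locally_continuity _ _ _ _ Hf) (Cn_locally_pos _ _ _ _ Hf H0))].
    apply locally_2d_forall; intros x y [A B]; split; trivial.
    apply continuity_1d_2d_pt_comp; trivial.
    apply continuity_pt_sqrt; lra.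
  - assert (Hs : Cn n (fun x y => sqrt (f x y)) u v)
      by (apply IH; [now apply Cn_pred|trivial]).
    assert (Hi : Cn n (fun x y => / (2 * sqrt (f x y))) u v).
    { apply Cn_inv; [apply Cn_mult; [apply Cn_const|exact Hs]|].
      apply Rgt_not_eq; apply Rmult_lt_0_compat; [lra|now apply sqrt_lt_R0]. }
    apply (Cn_step n _ (fun x y => Du f x y * / (2 * sqrt (f x y)))
                       (fun x y => Dv f x y * / (2 * sqrt (f x y)))).
    + eapply locally_2d_impl;
        [|exact (locally_2d_and _ _ _ _ (Cn_locally_derive _ _ _ _ Hf) (Cn_locally_pos _ _ _ _ Hf H0))].
      apply locally_2d_forall; intros x y [(A1 & A2 & A3) B].
      (split; [|split]).
      * apply continuity_1d_2d_pt_comp; trivial.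
        apply continuity_pt_sqrt; lra.
      * now apply (is_derive_sqrt (fun s => f s y)).
      * now apply (is_derive_sqrt (fun s => f x s)).
    + apply Cn_mult; [now apply Cn_Du|exact Hi].
    + apply Cn_mult; [now apply Cn_Dv|exact Hi].
Qed.

Definition pospart (y : R) : R := Rmax 0 y.

Lemma pospart_nonneg y : 0 <= y -> pospart y = y.
Proof. apply Rmax_right. Qed.
Lemma pospart_nonpos y : y <= 0 -> pospart y = 0.
Proof. apply Rmax_left. Qed.

Lemma pospart_continuity y : continuity_pt pospart y.
Proof.
  apply (continuity_pt_ext (fun x => (x + Rabs x) / 2)).
  - intros x; unfold pospart, Rmax, Rabs; destruct (Rle_dec 0 x), (Rcase_abs x); lra.
  - apply continuity_pt_filterlim.
    apply (continuous_mult (fun x => x + Rabs x) (fun _ => / 2)).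
    + apply (continuous_plus (fun x => x) Rabs).
      * apply continuous_id.
      * apply continuous_Rabs.
    + apply continuous_const.
Qed.

(** At 0 the difference quotient of y^(n+2) is O(|y|), so the two branches are
    glued with derivative 0.  These powers are the building blocks of compactly
    supported variations of class C^4. *)
Lemma is_derive_pospart_pow n y :
  is_derive (fun x => pospart x ^ S (S n)) y (INR (S (S n)) * pospart y ^ S n).
Proof.
  destruct (Rtotal_order y 0) as [Hy|[Hy|Hy]].
  - apply (is_derive_ext_loc (fun _ => 0)).
    + exists (mkposreal (- y) ltac:(lra)); intros x Hx.
      apply Rabs_lt_between in Hx; simpl in Hx.
      unfold minus, plus, opp in Hx; simpl in Hx.
      rewrite pospart_nonpos by lra. simpl; ring.
    + rewrite pospart_nonpos by lra. simpl pow; rewrite Rmult_0_l, Rmult_0_r.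
      exact (is_derive_const _ _).
  - subst y. rewrite (pospart_nonneg 0) by lra. simpl (0 ^ S n).
    rewrite Rmult_0_l, Rmult_0_r.
    apply is_derive_Reals. intros eps Heps.
    assert (Hd : 0 < Rmin 1 eps) by (apply Rmin_glb_lt; lra).
    exists (mkposreal _ Hd); intros h Hh0 Hh; simpl in Hh.
    rewrite Rplus_0_l, (pospart_nonneg 0) by lra.
    assert (B : 0 <= pospart h <= Rabs h).
    { unfold pospart, Rmax, Rabs; destruct (Rle_dec 0 h), (Rcase_abs h); lra. }
    assert (A : Rabs h < 1 /\ Rabs h < eps).
    { split; eapply Rlt_le_trans; try apply Hh; [apply Rmin_l|apply Rmin_r]. }
    replace ((pospart h ^ S (S n) - 0 ^ S (S n)) / h - 0) with (pospart h ^ S (S n) / h)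
      by (simpl; field; trivial).
    unfold Rdiv; rewrite Rabs_mult, Rabs_inv, <- RPow_abs, (Rabs_pos_eq (pospart h)) by apply B.
    assert (P : 0 < Rabs h) by now apply Rabs_pos_lt.
    apply (Rmult_lt_reg_r (Rabs h)); trivial.
    rewrite Rmult_assoc, Rinv_l, Rmult_1_r by lra.
    assert (Q : pospart h ^ n <= 1).
    { rewrite <- (pow1 n); apply pow_incr; lra. }
    assert (Q0 : 0 <= pospart h ^ n) by (apply pow_le; lra).
    simpl. assert (pospart h * pospart h ^ n <= Rabs h * 1) by (apply Rmult_le_compat; lra).
    assert (0 <= pospart h * pospart h ^ n) by (apply Rmult_le_pos; lra).
    apply Rle_lt_trans with (Rabs h * (pospart h * pospart h ^ n)).
    + apply Rmult_le_compat_r; lra.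
    + rewrite (Rmult_comm eps). apply Rmult_lt_compat_l; lra.
  - apply (is_derive_ext_loc (fun x => x ^ S (S n))).
    + exists (mkposreal y Hy); intros x Hx.
      apply Rabs_lt_between in Hx; simpl in Hx.
      unfold minus, plus, opp in Hx; simpl in Hx.
      rewrite pospart_nonneg by lra. reflexivity.
    + rewrite pospart_nonneg by lra.
      apply is_derive_Reals, (derivable_pt_lim_pow y (S (S n))).
Qed.

Lemma Cn_pospart_pow n f u v : Cn n f u v -> Cn n (fun x y => pospart (f x y) ^ S n) u v.
Proof.
  revert f; induction n as [|n IH]; intros f Hf.
  - apply (Cn_ext 0 (fun x y => pospart (f x y))); [intros; ring|].
    eapply locally_2d_impl; [|exact Hf].
    apply locally_2d_forall; intros x y [A B]; split; trivial.
    apply continuity_1d_2d_pt_comp; trivial. apply pospart_continuity.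
  - assert (Hs : Cn n (fun x y => INR (S (S n)) * pospart (f x y) ^ S n) u v)
      by (apply Cn_mult; [apply Cn_const|apply IH; now apply Cn_pred]).
    apply (Cn_step n _ (fun x y => Du f x y * (INR (S (S n)) * pospart (f x y) ^ S n))
                       (fun x y => Dv f x y * (INR (S (S n)) * pospart (f x y) ^ S n))).
    + eapply locally_2d_impl; [|exact (Cn_locally_derive _ _ _ _ Hf)].
      apply locally_2d_forall; intros x y (A1 & A2 & A3).
      (split; [|split]).
      * apply (continuity_1d_2d_pt_comp (fun y => pospart y ^ S (S n))); trivial.
        apply continuity_pt_filterlim, (ex_derive_continuous (fun y => pospart y ^ S (S n))).
        eexists; apply is_derive_pospart_pow.
      * apply (is_derive_comp (fun y => pospart y ^ S (S n)) (fun s => f s y));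
          [apply is_derive_pospart_pow|trivial].
      * apply (is_derive_comp (fun y => pospart y ^ S (S n)) (fun s => f x s));
          [apply is_derive_pospart_pow|trivial].
    + apply Cn_mult; [now apply Cn_Du|exact Hs].
    + apply Cn_mult; [now apply Cn_Dv|exact Hs].
Qed.

(** A function of one variable is handled as a function on the plane that is
    constant in the first variable: the same calculus then serves the surface,
    its profile and the families of profiles depending on a parameter. *)
Definition Cn_1d (n : nat) (f : R -> R) (x : R) : Prop := Cn n (fun _ y => f y) 0 x.

Lemma Cn_axis_slice n F x y0 t :
  Cn n F x y0 -> Cn n (fun _ s => F s y0) t x.
Proof.
  revert F; induction n as [|n IH]; intros F HF.
  - pose proof (Cn_locally_continuity _ _ _ _ HF) as HC.
    apply locally_2d_1d_const_y in HC. destruct HC as [d Hd].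
    exists d; intros u v _ Hv; split; trivial.
    apply (continuity_1d_2d_pt_comp (fun s => F s y0) (fun _ s => s));
      [|apply continuity_2d_pt_id2].
    specialize (Hd v Hv). intros eps Heps.
    destruct (Hd (mkposreal eps Heps)) as [e He]. exists e; split; [apply cond_pos|].
    intros s [_ Hs]; apply He; [exact Hs|]. rewrite Rminus_diag, Rabs_R0; apply cond_pos.
  - apply (Cn_step n _ (fun _ _ => 0) (fun _ s => Du F s y0)).
    + pose proof (Cn_locally _ _ _ _ HF) as HC.
      apply locally_2d_1d_const_y in HC. destruct HC as [d Hd].
      exists d; intros u v _ Hv; specialize (Hd v Hv). split; [|split].
      * apply (continuity_1d_2d_pt_comp (fun s => F s y0) (fun _ s => s));
          [|apply continuity_2d_pt_id2].
        apply continuity_pt_filterlim, (ex_derive_continuous (fun s => F s y0) v).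
        exact (Cn_ex_derive_u n _ _ _ Hd).
      * exact (is_derive_const _ _).
      * apply Derive_correct. exact (Cn_ex_derive_u n _ _ _ Hd).
    + apply Cn_const.
    + apply IH. now apply Cn_Du.
Qed.

Lemma Cn_1d_Derive n f x : Cn_1d (S n) f x -> Cn_1d n (Derive f) x.
Proof. apply (Cn_Dv n (fun _ s => f s)). Qed.

Lemma Cn_1d_ex_derive n f x : Cn_1d (S n) f x -> ex_derive f x.
Proof. apply (Cn_ex_derive_v n (fun _ s => f s)). Qed.

Lemma Cn_1d_is_derive n f x : Cn_1d (S n) f x -> is_derive f x (Derive f x).
Proof. intros Hf; apply Derive_correct; now apply (Cn_1d_ex_derive n). Qed.

Lemma continuous_slice_u F u v : continuity_2d_pt F u v -> continuous (fun s => F s v) u.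
Proof.
  intros HF. apply continuity_pt_filterlim. intros eps Heps.
  destruct (HF (mkposreal eps Heps)) as [e He]. exists e; split; [apply cond_pos|].
  intros s [_ Hs]; apply He; [exact Hs|]. rewrite Rminus_diag, Rabs_R0; apply cond_pos.
Qed.

Lemma continuous_slice_v F u v : continuity_2d_pt F u v -> continuous (fun s => F u s) v.
Proof.
  intros HF. apply continuity_pt_filterlim. intros eps Heps.
  destruct (HF (mkposreal eps Heps)) as [e He]. exists e; split; [apply cond_pos|].
  intros s [_ Hs]; apply He; [|exact Hs]. rewrite Rminus_diag, Rabs_R0; apply cond_pos.
Qed.

Lemma Cn_1d_continuous n f x : Cn_1d n f x -> continuous f x.
Proof. intros Hf. apply (continuous_slice_v (fun _ s => f s) 0), (Cn_continuity _ _ _ _ Hf). Qed.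

Lemma Cn_1d_locally n f x : Cn_1d n f x -> locally x (fun y => Cn_1d n f y).
Proof. intros Hf. apply Cn_locally, locally_2d_1d_const_x in Hf. exact Hf. Qed.

Lemma continuous_ray n F s th :
  Cn n F (s * cos th) (s * sin th) ->
  continuous (fun x => F (x * cos th) (x * sin th)) s.
Proof.
  intros HF. apply Cn_continuity, continuity_2d_pt_filterlim in HF.
  apply (continuous_comp_2 (fun x => x * cos th) (fun x => x * sin th) F).
  - apply (continuous_mult (fun x => x) (fun _ => cos th));
      [apply continuous_id|apply continuous_const].
  - apply (continuous_mult (fun x => x) (fun _ => sin th));
      [apply continuous_id|apply continuous_const].
  - exact HF.
Qed.

(** The symmetry of the surface is assumed on [Sigma] only, and partial
    derivatives at the boundary also depend on values outside. Identities
    between them are therefore proved inside and extended to the ends by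
    continuity. *)
Lemma eq_closed_interval (f g : R -> R) lo hi :
  lo < hi ->
  (forall x, lo <= x <= hi -> continuous f x) ->
  (forall x, lo <= x <= hi -> continuous g x) ->
  (forall x, lo < x < hi -> f x = g x) ->
  forall x, lo <= x <= hi -> f x = g x.
Proof.
  intros Hlh Hf Hg E x Hx.
  destruct (Req_dec (f x) (g x)) as [|N]; trivial; exfalso.
  assert (Hc : continuous (fun y => f y - g y) x)
    by (apply @continuous_minus; auto).
  apply continuity_pt_filterlim in Hc.
  destruct (Hc (Rabs (f x - g x))) as (d & Hd & H).
  { apply Rabs_pos_lt; lra. }
  assert (exists y, lo < y < hi /\ y <> x /\ Rabs (y - x) < d) as (y & Hy & Hyx & Hyd).
  { destruct (Rle_lt_dec x ((lo + hi) / 2)).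
    - exists (x + Rmin (d / 2) ((hi - lo) / 4)).
      assert (0 < Rmin (d / 2) ((hi - lo) / 4)) by (apply Rmin_glb_lt; lra).
      pose proof (Rmin_l (d / 2) ((hi - lo) / 4)).
      pose proof (Rmin_r (d / 2) ((hi - lo) / 4)).
      split; [lra|]; split; [lra|].
      rewrite Rabs_pos_eq; lra.
    - exists (x - Rmin (d / 2) ((hi - lo) / 4)).
      assert (0 < Rmin (d / 2) ((hi - lo) / 4)) by (apply Rmin_glb_lt; lra).
      pose proof (Rmin_l (d / 2) ((hi - lo) / 4)).
      pose proof (Rmin_r (d / 2) ((hi - lo) / 4)).
      split; [lra|]; split; [lra|].
      rewrite Rabs_left; lra. }
  specialize (H y). unfold D_x, no_cond, dist in H; simpl in H; unfold Rdist in H.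
  rewrite (E y Hy), Rminus_diag in H.
  specialize (H (conj (conj I (not_eq_sym Hyx)) Hyd)).
  rewrite Rminus_0_l, Rabs_Ropp in H. lra.
Qed.

(** Compactness of the interval makes the neighborhoods of [t0] uniform in
    [s]. *)
Lemma uniform_near (P : R -> R -> Prop) t0 a b :
  (forall s, a <= s <= b -> locally_2d P t0 s) ->
  locally t0 (fun t => forall s, a <= s <= b -> P t s).
Proof.
  intros H.
  assert (H' : forall s, exists d : posreal, a <= s <= b ->
     forall t s', Rabs (t - t0) < d -> Rabs (s' - s) < d -> P t s').
  { intros s. destruct (classic (a <= s <= b)) as [Hs|Hs].
    - destruct (H s Hs) as [d Hd]; exists d; auto.
    - exists (mkposreal 1 Rlt_0_1); tauto. }
  pose (delta := fun s => proj1_sig (constructive_indefinite_description _ (H' s))).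
  destruct (compactness_value_1d a b delta) as [d Hd].
  exists d. intros t Ht s Hs.
  apply NNPP. intros N. apply (Hd s Hs). intros (s0 & Hs0 & H1 & H2). apply N.
  unfold delta in H1, H2.
  destruct (constructive_indefinite_description _ (H' s0)) as [e He]; simpl in *.
  apply (He Hs0); [|exact H1]. eapply Rlt_le_trans; [exact Ht|exact H2].
Qed.

(** * Pointwise first variation in terms of jets *)

(** The energy density of a surface of revolution, divided by 2 pi, as a
    function of the 2-jet (r; p, q; p2, q2) of its profile (r, z). *)
Definition density_jet (a b c e r p p2 q q2 : R) : R :=
  let w := sqrt (p ^ 2 + q ^ 2) in
  let k := (p * q2 - p2 * q) / w ^ 3 in
  let h := e * (k + q / w / r) / 2 + c in
  (a * h ^ 2 + b * (k * (q / w) / r)) * (r * w).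

(** A variation acts on the unit tangent (C, S) of the profile by a rotation
    of rate [mu] and stretches the profile at rate [lam]. So w, C, S and k
    have variations w lam, - S mu, C mu and dmu - k lam, where [dmu] is the
    arc length derivative of [mu]; the two curvatures k and S / r enter the
    density through these alone. *)
Lemma is_derive_density_jet a b c e r p p2 q q2 xi xi1 xi2 eta1 eta2 w C S k h lam mu dmu :
  r <> 0 -> 0 < w -> w ^ 2 = p ^ 2 + q ^ 2 ->
  C = p / w -> S = q / w -> k = (p * q2 - p2 * q) / w ^ 3 ->
  h = e * (k + S / r) / 2 + c ->
  lam = (C * xi1 + S * eta1) / w ->
  mu = (- S * xi1 + C * eta1) / w ->
  dmu = ((- q2 * xi1 - q * xi2 + p2 * eta1 + p * eta2) / w ^ 2
         - 2 * (p * p2 + q * q2) * (- q * xi1 + p * eta1) / w ^ 4) / w ->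
  is_derive (fun t => density_jet a b c e (r + t * xi) (p + t * xi1) (p2 + t * xi2)
                          (q + t * eta1) (q2 + t * eta2)) 0
   (2 * a * h * (e / 2 * (dmu - lam * k + C * mu / r - S * xi / r ^ 2)) * r * w
    + a * h ^ 2 * (xi * w + r * w * lam)
    + b * w * (S * dmu + k * C * mu)).
Proof.
  intros Hr Hw Hw2 HC HS Hk Hh Hlam Hmu Hdmu.
  assert (Hs : sqrt (p ^ 2 + q ^ 2) = w).
  { rewrite <- Hw2. apply sqrt_pow2; lra. }
  pose (wt := fun t => sqrt ((p + t * xi1) ^ 2 + (q + t * eta1) ^ 2)).
  assert (D1 : is_derive wt 0 (w * lam)).
  { unfold wt; eapply is_derive_eq.
    - auto_derive; [|reflexivity]. rewrite !Rmult_0_l, !Rplus_0_r. simpl in Hw2.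
      rewrite !Rmult_1_r in *. rewrite <- Hw2. now apply Rmult_lt_0_compat.
    - rewrite !Rmult_0_l, !Rplus_0_r. simpl in Hs. rewrite !Rmult_1_r in *. rewrite Hs.
      subst lam C S. field. lra. }
  assert (W0 : wt 0 = w).
  { unfold wt; rewrite !Rmult_0_l, !Rplus_0_r; exact Hs. }
  pose (kt := fun t => ((p + t * xi1) * (q2 + t * eta2) - (p2 + t * xi2) * (q + t * eta1)) / wt t ^ 3).
  assert (D2 : is_derive kt 0 (dmu - lam * k)).
  { unfold kt; clearbody wt; eapply is_derive_eq.
    - auto_derive; [|reflexivity].
      rewrite W0. repeat split; [eexists; exact D1|]. apply Rgt_not_eq; repeat apply Rmult_lt_0_compat; lra.
    - derive_rewrite D1; rewrite W0, !Rmult_0_l, !Rplus_0_r.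
      subst dmu lam k C S. assert (w <> 0) by lra.
      field [Hw2]. lra. }
  assert (K0 : kt 0 = k).
  { unfold kt; rewrite W0, !Rmult_0_l, !Rplus_0_r; now subst k. }
  apply (is_derive_ext (fun t => (a * (e * (kt t + (q + t * eta1) / wt t / (r + t * xi)) / 2 + c) ^ 2
     + b * (kt t * ((q + t * eta1) / wt t) / (r + t * xi))) * ((r + t * xi) * wt t))).
  { reflexivity. }
  clearbody wt kt.
  eapply is_derive_eq.
  - auto_derive; [|reflexivity].
    rewrite W0, Rmult_0_l, Rplus_0_r. repeat split; trivial; try lra; eexists; eassumption.
  - derive_rewrite D1; derive_rewrite D2; rewrite W0, K0, !Rmult_0_l, !Rplus_0_r.
    (* In terms of lam and mu the identity no longer involves the 2-jet of the profile. *)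
    assert (Hq : q = w * S) by (subst S; field; lra).
    assert (Hp : p = w * C) by (subst C; field; lra).
    assert (HCS : C ^ 2 + S ^ 2 = 1).
    { subst C S. replace ((p / w) ^ 2 + (q / w) ^ 2) with ((p ^ 2 + q ^ 2) / w ^ 2) by (field; lra).
      rewrite <- Hw2. field; lra. }
    assert (Heta : eta1 = w * (S * lam + C * mu)).
    { transitivity ((C ^ 2 + S ^ 2) * eta1); [rewrite HCS; ring|].
      rewrite Hlam, Hmu; field; lra. }
    clear Hdmu Hmu Hlam HC HS Hw2 Hs D1 D2 W0 K0 wt kt Hk.
    subst h. rewrite Heta, Hq. field. lra.
Qed.

(** The identity behind the first variation formula.  With psi and tau the
    normal and tangential components of the variation, the flux is
    a r (h D psi - psi D h + h^2 tau) + b S mu, where D is the arc length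
    derivative, D psi = e (mu - k tau), and g stands for r D h.  The first part
    comes from integrating h times the Laplacian of psi by parts twice, the
    second from Gauss-Bonnet, since K r w = - C' and C varies by - S mu.  What
    is left of the variation of the density is a multiple of psi. *)
Lemma is_derive_natural_flux (a b c e : R) (r w C S k h g xi eta mu : R -> R) (psi tau : R)
   (x k' dh g' xi' eta' mu' lam : R) :
  e ^ 2 = 1 -> r x <> 0 -> w x <> 0 -> C x ^ 2 + S x ^ 2 = 1 ->
  is_derive r x (w x * C x) ->
  is_derive C x (- w x * k x * S x) ->
  is_derive S x (w x * k x * C x) ->
  is_derive k x k' ->
  is_derive h x (w x * dh) ->
  is_derive g x g' ->
  g x = r x * dh ->
  is_derive xi x xi' -> is_derive eta x eta' -> is_derive mu x mu' ->
  h x = e * (k x + S x / r x) / 2 + c ->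
  dh = e / 2 * (k' / w x + k x * C x / r x - S x * C x / r x ^ 2) ->
  lam = (C x * xi' + S x * eta') / w x ->
  mu x = (- S x * xi' + C x * eta') / w x ->
  psi = e * (- S x * xi x + C x * eta x) ->
  tau = C x * xi x + S x * eta x ->
  is_derive (fun y => a * (r y * h y * e * (mu y - k y * (C y * xi y + S y * eta y))
      - g y * (e * (- S y * xi y + C y * eta y))
      + r y * h y ^ 2 * (C y * xi y + S y * eta y)) + b * S y * mu y) x
   (2 * a * h x * (e / 2 * (mu' / w x - lam * k x + C x * mu x / r x - S x * xi x / r x ^ 2)) * r x * w x
    + a * h x ^ 2 * (xi x * w x + r x * w x * lam)
    + b * w x * (S x * (mu' / w x) + k x * C x * mu x)
    - a * w x * (g' / w x + 2 * r x * h x * ((h x - c) * (h x - 2 * c) - k x * S x / r x)) * psi).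
Proof.
  intros He Hr Hw HCS Dr DC DS Dk Dh Dg Hg Dxi Deta Dmu Hh Hdh Hlam Hmu Hpsi Htau.
  eapply is_derive_eq.
  - auto_derive; [|reflexivity]. repeat split; eexists; eassumption.
  - derive_rewrite Dr. derive_rewrite DC. derive_rewrite DS. derive_rewrite Dk.
    derive_rewrite Dh. derive_rewrite Dg. derive_rewrite Dxi. derive_rewrite Deta.
    derive_rewrite Dmu.
    assert (Hxi1 : xi' = w x * (C x * lam - S x * mu x)).
    { transitivity ((C x ^ 2 + S x ^ 2) * xi'); [rewrite HCS; ring|].
      rewrite Hlam, Hmu; field; trivial. }
    assert (Heta : eta' = w x * (S x * lam + C x * mu x)).
    { transitivity ((C x ^ 2 + S x ^ 2) * eta'); [rewrite HCS; ring|].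
      rewrite Hlam, Hmu; field; trivial. }
    clear Hlam Hmu Dr DC DS Dk Dh Dg Dxi Deta Dmu.
    rewrite Hpsi, Hg, Hh, Hdh, Hxi1, Heta.
    clear Hpsi Htau Hh Hdh Hg.
    generalize dependent (C x). generalize dependent (S x).
    generalize dependent (w x). generalize dependent (r x). generalize dependent (k x).
    generalize (xi x) (eta x) (mu x).
    intros.
    match goal with H : ?c0 ^ 2 + ?s ^ 2 = 1 |- _ => assert (H2 : c0 ^ 2 = 1 - s ^ 2) by lra end.
    field [H2 He]. auto.
Qed.

(** * The geometry of a profile curve *)

Definition pspeed (r z : R -> R) (x : R) : R := sqrt (Derive r x ^ 2 + Derive z x ^ 2).
Definition pcos (r z : R -> R) (x : R) : R := Derive r x / pspeed r z x.
Definition psin (r z : R -> R) (x : R) : R := Derive z x / pspeed r z x.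
(** The signed curvature of the profile. The principal curvatures of the
    surface are this and [psin / r], up to the common sign [e]. *)
Definition pcurv (r z : R -> R) (x : R) : R :=
  (Derive r x * Derive (Derive z) x - Derive (Derive r) x * Derive z x) / pspeed r z x ^ 3.
(** H + c_o, for the mean curvature H of the surface of revolution. *)
Definition shiftedH (c e : R) (r z : R -> R) (x : R) : R :=
  e * (pcurv r z x + psin r z x / r x) / 2 + c.
(** r times the arc length derivative of H + c_o: per unit angle, this is the
    flux of the gradient of H through a parallel. *)
Definition shiftedH_flux (c e : R) (r z : R -> R) (x : R) : R :=
  r x * (Derive (shiftedH c e r z) x / pspeed r z x).
(** r times Delta H + 2 (H + c_o) (H (H - c_o) - K). *)
Definition EL_op (c e : R) (r z : R -> R) (x : R) : R :=
  Derive (shiftedH_flux c e r z) x / pspeed r z x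
  + 2 * r x * shiftedH c e r z x
    * ((shiftedH c e r z x - c) * (shiftedH c e r z x - 2 * c) - pcurv r z x * psin r z x / r x).
(** The rate at which the variation (xi, eta) rotates the unit tangent. *)
Definition turning (r z xi eta : R -> R) (x : R) : R :=
  (- psin r z x * Derive xi x + pcos r z x * Derive eta x) / pspeed r z x.

(** The flux of [is_derive_natural_flux], as a linear function of the values
    (xi, eta) and derivatives (xi', eta') of the variation at [x]. *)
Definition natural_flux (a b c e : R) (r z : R -> R) (x xi xi' eta eta' : R) : R :=
  a * (r x * shiftedH c e r z x * e *
         ((- psin r z x * xi' + pcos r z x * eta') / pspeed r z x
          - pcurv r z x * (pcos r z x * xi + psin r z x * eta))
      - shiftedH_flux c e r z x * (e * (- psin r z x * xi + pcos r z x * eta))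
      + r x * shiftedH c e r z x ^ 2 * (pcos r z x * xi + psin r z x * eta))
  + b * psin r z x * ((- psin r z x * xi' + pcos r z x * eta') / pspeed r z x).

Definition regular (r z : R -> R) (x : R) : Prop :=
  Cn_1d 4 r x /\ Cn_1d 4 z x /\ 0 < r x /\ 0 < Derive r x ^ 2 + Derive z x ^ 2.

Lemma pspeed_pos r z x : regular r z x -> 0 < pspeed r z x.
Proof. intros (_ & _ & _ & H). now apply sqrt_lt_R0. Qed.

Lemma pspeed_sqr r z x : regular r z x -> pspeed r z x ^ 2 = Derive r x ^ 2 + Derive z x ^ 2.
Proof. intros (_ & _ & _ & H). apply pow2_sqrt; lra. Qed.

Lemma Cn_1d_pspeed r z x : regular r z x -> Cn_1d 3 (pspeed r z) x.
Proof.
  intros (Hr & Hz & _ & H).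
  apply (Cn_sqrt 3 (fun _ x => Derive r x ^ 2 + Derive z x ^ 2)); trivial.
  apply Cn_plus; apply Cn_pow; now apply Cn_1d_Derive.
Qed.

Lemma Cn_1d_pcos r z x : regular r z x -> Cn_1d 3 (pcos r z) x.
Proof.
  intros H. apply (Cn_div 3 (fun _ => Derive r) (fun _ => pspeed r z)).
  - apply Cn_1d_Derive, H.
  - now apply Cn_1d_pspeed.
  - apply Rgt_not_eq; now apply pspeed_pos.
Qed.

Lemma Cn_1d_psin r z x : regular r z x -> Cn_1d 3 (psin r z) x.
Proof.
  intros H. apply (Cn_div 3 (fun _ => Derive z) (fun _ => pspeed r z)).
  - apply Cn_1d_Derive, H.
  - now apply Cn_1d_pspeed.
  - apply Rgt_not_eq; now apply pspeed_pos.
Qed.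

Lemma Cn_1d_pcurv r z x : regular r z x -> Cn_1d 2 (pcurv r z) x.
Proof.
  intros H. pose proof H as (Hr & Hz & _ & _).
  apply (Cn_div 2 (fun _ x => Derive r x * Derive (Derive z) x - Derive (Derive r) x * Derive z x)
    (fun _ x => pspeed r z x ^ 3)).
  - apply Cn_1d_Derive in Hr, Hz. pose proof Hr as Hr1. pose proof Hz as Hz1.
    apply Cn_1d_Derive in Hr, Hz. apply Cn_pred in Hr1, Hz1.
    apply Cn_minus; now apply Cn_mult.
  - apply (Cn_pow 2 3 (fun _ => pspeed r z)). apply Cn_pred. now apply Cn_1d_pspeed.
  - apply Rgt_not_eq, pow_lt. now apply pspeed_pos.
Qed.

Lemma Cn_1d_shiftedH c e r z x : regular r z x -> Cn_1d 2 (shiftedH c e r z) x.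
Proof.
  intros H.
  apply (Cn_plus 2 (fun _ x => e * (pcurv r z x + psin r z x / r x) / 2) (fun _ _ => c));
    [|apply Cn_const].
  apply (Cn_mult 2 (fun _ x => e * (pcurv r z x + psin r z x / r x)) (fun _ _ => / 2)); [|apply Cn_const].
  apply (Cn_mult 2 (fun _ _ => e)); [apply Cn_const|].
  apply (Cn_plus 2 (fun _ => pcurv r z)); [now apply Cn_1d_pcurv|].
  apply (Cn_div 2 (fun _ => psin r z) (fun _ => r)).
  - apply Cn_pred; now apply Cn_1d_psin.
  - apply Cn_pred, Cn_pred, H.
  - apply Rgt_not_eq, H.
Qed.

Lemma Cn_1d_shiftedH_flux c e r z x : regular r z x -> Cn_1d 1 (shiftedH_flux c e r z) x.
Proof.
  intros H. apply (Cn_mult 1 (fun _ => r)).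
  - apply Cn_pred, Cn_pred, Cn_pred, H.
  - apply (Cn_div 1 (fun _ => Derive (shiftedH c e r z)) (fun _ => pspeed r z)).
    + now apply Cn_1d_Derive, Cn_1d_shiftedH.
    + now apply Cn_pred, Cn_pred, Cn_1d_pspeed.
    + apply Rgt_not_eq; now apply pspeed_pos.
Qed.

Lemma Cn_1d_EL_op c e r z x : regular r z x -> Cn_1d 0 (EL_op c e r z) x.
Proof.
  intros H.
  assert (Hh : Cn_1d 0 (shiftedH c e r z) x) by now apply Cn_pred, Cn_pred, Cn_1d_shiftedH.
  assert (Hw : Cn_1d 0 (pspeed r z) x) by now apply Cn_pred, Cn_pred, Cn_pred, Cn_1d_pspeed.
  assert (Hr : Cn_1d 0 r x) by apply Cn_pred, Cn_pred, Cn_pred, Cn_pred, H.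
  assert (Hk : Cn_1d 0 (pcurv r z) x) by now apply Cn_pred, Cn_pred, Cn_1d_pcurv.
  assert (HS : Cn_1d 0 (psin r z) x) by now apply Cn_pred, Cn_pred, Cn_pred, Cn_1d_psin.
  assert (Hg : Cn_1d 0 (Derive (shiftedH_flux c e r z)) x) by now apply Cn_1d_Derive, Cn_1d_shiftedH_flux.
  pose proof (Rgt_not_eq _ _ (pspeed_pos _ _ _ H)).
  assert (r x <> 0) by apply Rgt_not_eq, H.
  unfold Cn_1d, EL_op in *.
  repeat first [ assumption | apply Cn_const | apply Cn_minus | apply Cn_plus
    | apply Cn_div | apply Cn_mult ].
Qed.

Lemma pcos2_psin2 r z x : regular r z x -> pcos r z x ^ 2 + psin r z x ^ 2 = 1.
Proof.
  intros H. unfold pcos, psin. pose proof (pspeed_pos _ _ _ H).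
  replace (_ + _) with ((Derive r x ^ 2 + Derive z x ^ 2) / pspeed r z x ^ 2) by (field; lra).
  rewrite <- pspeed_sqr by trivial. field; lra.
Qed.

Lemma is_derive_profile_r r z x : regular r z x -> is_derive r x (pspeed r z x * pcos r z x).
Proof.
  intros H. eapply is_derive_eq; [apply (Cn_1d_is_derive 3), H|].
  unfold pcos. field. apply Rgt_not_eq; now apply pspeed_pos.
Qed.

Lemma is_derive_profile_z r z x : regular r z x -> is_derive z x (pspeed r z x * psin r z x).
Proof.
  intros H. eapply is_derive_eq; [apply (Cn_1d_is_derive 3), H|].
  unfold psin. field. apply Rgt_not_eq; now apply pspeed_pos.
Qed.

Lemma is_derive_pspeed r z x : regular r z x ->
  is_derive (pspeed r z) x
    ((Derive r x * Derive (Derive r) x + Derive z x * Derive (Derive z) x) / pspeed r z x).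
Proof.
  intros H. pose proof H as (Hr & Hz & _ & Hw). apply Cn_1d_Derive, Cn_1d_is_derive in Hr, Hz.
  pose proof (pspeed_pos _ _ _ H) as Hp. unfold pspeed in *. eapply is_derive_eq.
  - apply is_derive_sqrt; trivial.
    apply @is_derive_plus; apply (is_derive_pow _ 2); eassumption.
  - unfold plus; simpl. simpl in Hp. field. lra.
Qed.

Lemma is_derive_pcos r z x : regular r z x ->
  is_derive (pcos r z) x (- pspeed r z x * pcurv r z x * psin r z x).
Proof.
  intros H. pose proof H as (Hr & Hz & _ & _). apply Cn_1d_Derive, Cn_1d_is_derive in Hr, Hz.
  pose proof (pspeed_pos _ _ _ H) as Hp. unfold pcos. eapply is_derive_eq.
  - apply is_derive_div; [exact Hr|now apply is_derive_pspeed|lra].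
  - pose proof (pspeed_sqr _ _ _ H) as Hs. unfold pcurv, psin. assert (pspeed r z x <> 0) by lra.
    field [Hs]. trivial.
Qed.

Lemma is_derive_psin r z x : regular r z x ->
  is_derive (psin r z) x (pspeed r z x * pcurv r z x * pcos r z x).
Proof.
  intros H. pose proof H as (Hr & Hz & _ & _). apply Cn_1d_Derive, Cn_1d_is_derive in Hr, Hz.
  pose proof (pspeed_pos _ _ _ H) as Hp. unfold psin. eapply is_derive_eq.
  - apply is_derive_div; [exact Hz|now apply is_derive_pspeed|lra].
  - pose proof (pspeed_sqr _ _ _ H) as Hs. unfold pcurv, pcos. assert (pspeed r z x <> 0) by lra.
    field [Hs]. trivial.
Qed.

Lemma is_derive_shiftedH c e r z x : regular r z x ->
  is_derive (shiftedH c e r z) x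
   (pspeed r z x * (e / 2 * (Derive (pcurv r z) x / pspeed r z x + pcurv r z x * pcos r z x / r x
                         - psin r z x * pcos r z x / r x ^ 2))).
Proof.
  intros H. pose proof (Cn_1d_is_derive _ _ _ (Cn_1d_pcurv _ _ _ H)) as Dk.
  pose proof (is_derive_psin _ _ _ H) as DS. pose proof (is_derive_profile_r _ _ _ H) as Dr.
  pose proof (pspeed_pos _ _ _ H) as Hp. assert (0 < r x) by apply H.
  unfold shiftedH. eapply is_derive_eq.
  - auto_derive; [|reflexivity]. repeat split; try (eexists; eassumption); lra.
  - derive_rewrite DS. derive_rewrite Dr.
    change (Derive (fun y => pcurv r z y) x) with (Derive (pcurv r z) x). field. lra.
Qed.

Lemma is_derive_turning r z xi eta x : regular r z x -> Cn_1d 4 xi x -> Cn_1d 4 eta x ->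
  is_derive (turning r z xi eta) x
   ((- Derive (Derive z) x * Derive xi x - Derive z x * Derive (Derive xi) x
       + Derive (Derive r) x * Derive eta x + Derive r x * Derive (Derive eta) x) / pspeed r z x ^ 2
    - 2 * (Derive r x * Derive (Derive r) x + Derive z x * Derive (Derive z) x)
        * (- Derive z x * Derive xi x + Derive r x * Derive eta x) / pspeed r z x ^ 4).
Proof.
  intros H Hxi Heta. pose proof H as (Hr & Hz & _ & _).
  apply Cn_1d_Derive, Cn_1d_is_derive in Hr, Hz, Hxi, Heta.
  pose proof (pspeed_pos _ _ _ H) as Hp.
  pose proof (is_derive_psin _ _ _ H) as DS. pose proof (is_derive_pcos _ _ _ H) as DC.
  pose proof (is_derive_pspeed _ _ _ H) as Dw.
  unfold turning. eapply is_derive_eq.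
  - auto_derive; [|reflexivity]. repeat split; try (eexists; eassumption); lra.
  - derive_rewrite DS. derive_rewrite DC. derive_rewrite Dw.
    derive_rewrite Hxi. derive_rewrite Heta.
    pose proof (pspeed_sqr _ _ _ H) as Hs. unfold pcurv, pcos, psin. assert (pspeed r z x <> 0) by lra.
    field [Hs]. trivial.
Qed.

Definition density_along (a b c e : R) (r z xi eta : R -> R) (t x : R) : R :=
  density_jet a b c e (r x + t * xi x) (Derive r x + t * Derive xi x)
    (Derive (Derive r) x + t * Derive (Derive xi) x)
    (Derive z x + t * Derive eta x) (Derive (Derive z) x + t * Derive (Derive eta) x).

Lemma is_derive_natural_flux_along a b c e r z xi eta x :
  e ^ 2 = 1 -> regular r z x -> Cn_1d 4 xi x -> Cn_1d 4 eta x ->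
  is_derive (fun y => natural_flux a b c e r z y (xi y) (Derive xi y) (eta y) (Derive eta y)) x
    (Derive (fun t => density_along a b c e r z xi eta t x) 0
     - a * pspeed r z x * EL_op c e r z x * (e * (- psin r z x * xi x + pcos r z x * eta x))).
Proof.
  intros He H Hxi Heta. pose proof (pspeed_pos _ _ _ H) as Hw. assert (0 < r x) by apply H.
  pose proof (is_derive_turning _ _ _ _ _ H Hxi Heta) as Dmu.
  eapply is_derive_eq.
  - eapply (is_derive_natural_flux a b c e r (pspeed r z) (pcos r z) (psin r z) (pcurv r z) (shiftedH c e r z)
      (shiftedH_flux c e r z) xi eta (turning r z xi eta)
      (e * (- psin r z x * xi x + pcos r z x * eta x)) (pcos r z x * xi x + psin r z x * eta x) x
      (Derive (pcurv r z) x)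
      (e / 2 * (Derive (pcurv r z) x / pspeed r z x + pcurv r z x * pcos r z x / r x
                         - psin r z x * pcos r z x / r x ^ 2))
      (Derive (shiftedH_flux c e r z) x) (Derive xi x) (Derive eta x) _
      ((pcos r z x * Derive xi x + psin r z x * Derive eta x) / pspeed r z x)); try reflexivity.
    + exact He.
    + lra.
    + lra.
    + now apply pcos2_psin2.
    + now apply is_derive_profile_r.
    + now apply is_derive_pcos.
    + now apply is_derive_psin.
    + now apply (Cn_1d_is_derive 1), Cn_1d_pcurv.
    + now apply is_derive_shiftedH.
    + now apply (Cn_1d_is_derive 0), Cn_1d_shiftedH_flux.
    + unfold shiftedH_flux. rewrite (is_derive_unique _ _ _ (is_derive_shiftedH c e _ _ _ H)). field. lra.
    + now apply (Cn_1d_is_derive 3).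
    + now apply (Cn_1d_is_derive 3).
    + exact Dmu.
  - symmetry. erewrite is_derive_unique.
    2: { unfold density_along.
      eapply (is_derive_density_jet a b c e (r x) (Derive r x) (Derive (Derive r) x) (Derive z x) (Derive (Derive z) x)
        (xi x) (Derive xi x) (Derive (Derive xi) x) (Derive eta x) (Derive (Derive eta) x)
        (pspeed r z x) (pcos r z x) (psin r z x) (pcurv r z x) (shiftedH c e r z x)
        ((pcos r z x * Derive xi x + psin r z x * Derive eta x) / pspeed r z x) (turning r z xi eta x) _); try reflexivity.
      - lra.
      - exact Hw.
      - now apply pspeed_sqr. }
    unfold EL_op. field. lra.
Qed.

(** * The first variation of the profile energy *)

Lemma Cn_density_along a b c e r z xi eta x :
  regular r z x -> Cn_1d 4 xi x -> Cn_1d 4 eta x -> Cn 1 (density_along a b c e r z xi eta) 0 x.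
Proof.
  intros (Hr & Hz & Hr0 & Hw0) Hxi Heta.
  assert (Hr0' : 0 < r x + 0 * xi x) by lra.
  assert (Hw0' : 0 < (Derive r x + 0 * Derive xi x) ^ 2 + (Derive z x + 0 * Derive eta x) ^ 2).
  { now rewrite !Rmult_0_l, !Rplus_0_r. }
  pose proof (Cn_1d_Derive _ _ _ Hr) as Hp. pose proof (Cn_1d_Derive _ _ _ Hp) as Hp2.
  pose proof (Cn_1d_Derive _ _ _ Hz) as Hq. pose proof (Cn_1d_Derive _ _ _ Hq) as Hq2.
  pose proof (Cn_1d_Derive _ _ _ Hxi) as Hxi1. pose proof (Cn_1d_Derive _ _ _ Hxi1) as Hxi2.
  pose proof (Cn_1d_Derive _ _ _ Heta) as Heta1. pose proof (Cn_1d_Derive _ _ _ Heta1) as Heta2.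
  unfold Cn_1d in *.
  apply (Cn_le 1) in Hr, Hz, Hp, Hp2, Hq, Hq2, Hxi, Hxi1, Hxi2, Heta, Heta1, Heta2;
    try (repeat constructor; fail).
  pose proof (Cn_fst 1 0 x) as Ht.
  assert (Hw : Cn 1 (fun t s =>
    sqrt ((Derive r s + t * Derive xi s) ^ 2 + (Derive z s + t * Derive eta s) ^ 2)) 0 x).
  { apply (Cn_sqrt 1 (fun t s => (Derive r s + t * Derive xi s) ^ 2 + (Derive z s + t * Derive eta s) ^ 2)); trivial.
    apply Cn_plus; apply Cn_pow; apply Cn_plus; trivial; apply Cn_mult; trivial. }
  assert (Hs : 0 < sqrt ((Derive r x + 0 * Derive xi x) ^ 2 + (Derive z x + 0 * Derive eta x) ^ 2))
    by now apply sqrt_lt_R0.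
  unfold density_along, density_jet.
  repeat first [ assumption | apply Cn_const | apply Cn_minus | apply Cn_plus
    | apply Cn_div | apply Cn_mult | apply Cn_pow
    | apply Rgt_not_eq, pow_lt; assumption | apply Rgt_not_eq; assumption | lra ].
Qed.

Definition nondegenerate_along (r z xi eta : R -> R) (t x : R) : Prop :=
  0 < r x + t * xi x /\
  0 < (Derive r x + t * Derive xi x) ^ 2 + (Derive z x + t * Derive eta x) ^ 2.

Lemma nondegenerate_near r z xi eta lo hi :
  (forall x, lo <= x <= hi -> regular r z x) ->
  (forall x, Cn_1d 4 xi x) -> (forall x, Cn_1d 4 eta x) ->
  locally 0 (fun t => forall x, lo <= x <= hi -> nondegenerate_along r z xi eta t x).
Proof.
  intros H Hxi Heta. apply uniform_near. intros x Hx.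
  destruct (H x Hx) as (Hr & Hz & Hr0 & Hw0). specialize (Hxi x). specialize (Heta x).
  pose proof (Cn_1d_Derive _ _ _ Hr) as Hp. pose proof (Cn_1d_Derive _ _ _ Hz) as Hq.
  pose proof (Cn_1d_Derive _ _ _ Hxi) as Hxi1. pose proof (Cn_1d_Derive _ _ _ Heta) as Heta1.
  unfold Cn_1d in *. apply (Cn_le 1) in Hr, Hp, Hq, Hxi, Hxi1, Heta1; try (repeat constructor; fail).
  pose proof (Cn_fst 1 0 x) as Ht.
  apply locally_2d_and.
  - apply (Cn_locally_pos 1 (fun t s => r s + t * xi s)).
    + apply Cn_plus; trivial. now apply Cn_mult.
    + lra.
  - apply (Cn_locally_pos 1 (fun t s => (Derive r s + t * Derive xi s) ^ 2 + (Derive z s + t * Derive eta s) ^ 2)).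
    + apply Cn_plus; apply Cn_pow; apply Cn_plus; trivial; apply Cn_mult; trivial.
    + now rewrite !Rmult_0_l, !Rplus_0_r.
Qed.

Lemma ex_RInt_of_continuous (f : R -> R) lo hi :
  lo <= hi -> (forall x, lo <= x <= hi -> continuous f x) -> ex_RInt f lo hi.
Proof.
  intros H Hf. apply (ex_RInt_continuous f). intros x Hx.
  rewrite Rmin_left, Rmax_right in Hx by trivial. now apply Hf.
Qed.

Lemma Cn_density_along_near a b c e r z xi eta lo hi :
  (forall x, lo <= x <= hi -> regular r z x) ->
  (forall x, Cn_1d 4 xi x) -> (forall x, Cn_1d 4 eta x) ->
  locally 0 (fun t => forall x, lo <= x <= hi -> Cn 1 (density_along a b c e r z xi eta) t x).
Proof.
  intros H Hxi Heta. apply uniform_near. intros x Hx. apply Cn_locally. apply Cn_density_along; auto.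
Qed.

Lemma ex_RInt_density_along a b c e r z xi eta lo hi :
  lo <= hi ->
  (forall x, lo <= x <= hi -> regular r z x) ->
  (forall x, Cn_1d 4 xi x) -> (forall x, Cn_1d 4 eta x) ->
  locally 0 (fun t => ex_RInt (density_along a b c e r z xi eta t) lo hi).
Proof.
  intros Hlh H Hxi Heta.
  eapply filter_imp; [|exact (Cn_density_along_near a b c e r z xi eta lo hi H Hxi Heta)].
  intros t Ht. apply ex_RInt_of_continuous; trivial. intros x Hx.
  apply continuous_slice_v, (Cn_continuity 1). now apply Ht.
Qed.

(** The Euler-Lagrange expression paired with the normal component of (xi,
    eta). *)
Definition EL_pairing (a c e : R) (r z xi eta : R -> R) (x : R) : R :=
  a * pspeed r z x * EL_op c e r z x * (e * (- psin r z x * xi x + pcos r z x * eta x)).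

Lemma continuous_EL_pairing a c e r z xi eta x :
  regular r z x -> Cn_1d 4 xi x -> Cn_1d 4 eta x ->
  continuous (EL_pairing a c e r z xi eta) x.
Proof.
  intros H Hxi Heta. apply (Cn_1d_continuous 0).
  assert (H1 : Cn_1d 0 (EL_op c e r z) x) by now apply Cn_1d_EL_op.
  assert (H2 : Cn_1d 0 (pspeed r z) x) by now apply (Cn_le 0 3 _ _ _ (Nat.le_0_l _)), Cn_1d_pspeed.
  assert (H3 : Cn_1d 0 (psin r z) x) by now apply (Cn_le 0 3 _ _ _ (Nat.le_0_l _)), Cn_1d_psin.
  assert (H4 : Cn_1d 0 (pcos r z) x) by now apply (Cn_le 0 3 _ _ _ (Nat.le_0_l _)), Cn_1d_pcos.
  assert (H5 : Cn_1d 0 xi x) by now apply (Cn_le 0 4 _ _ _ (Nat.le_0_l _)).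
  assert (H6 : Cn_1d 0 eta x) by now apply (Cn_le 0 4 _ _ _ (Nat.le_0_l _)).
  unfold Cn_1d, EL_pairing in *.
  repeat first [ assumption | apply Cn_const | apply Cn_plus | apply Cn_mult | apply Cn_opp ].
Qed.

Lemma is_derive_RInt_density_along a b c e r z xi eta lo hi :
  lo < hi -> e ^ 2 = 1 ->
  (forall x, lo <= x <= hi -> regular r z x) ->
  (forall x, Cn_1d 4 xi x) -> (forall x, Cn_1d 4 eta x) ->
  is_derive (fun t => RInt (density_along a b c e r z xi eta t) lo hi) 0
    (natural_flux a b c e r z hi (xi hi) (Derive xi hi) (eta hi) (Derive eta hi)
     - natural_flux a b c e r z lo (xi lo) (Derive xi lo) (eta lo) (Derive eta lo)
     + RInt (EL_pairing a c e r z xi eta) lo hi).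
Proof.
  intros Hlh He H Hxi Heta.
  set (F := fun y => natural_flux a b c e r z y (xi y) (Derive xi y) (eta y) (Derive eta y)).
  assert (HL : forall x, lo <= x <= hi ->
    continuous (fun y => Derive (fun t => density_along a b c e r z xi eta t y) 0) x).
  { intros x Hx. apply (continuous_slice_v (Du (density_along a b c e r z xi eta)) 0).
    apply (Cn_continuity 0), Cn_Du, Cn_density_along; auto. }
  assert (HE : forall x, lo <= x <= hi -> continuous (EL_pairing a c e r z xi eta) x).
  { intros x Hx. apply continuous_EL_pairing; auto. }
  eapply is_derive_eq.
  - apply (is_derive_RInt_param (density_along a b c e r z xi eta) lo hi 0).
    + rewrite Rmin_left, Rmax_right by lra.
      eapply filter_imp; [|exact (Cn_density_along_near a b c e r z xi eta lo hi H Hxi Heta)].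
      intros t Ht x Hx. apply (Cn_ex_derive_u 0). now apply Ht.
    + rewrite Rmin_left, Rmax_right by lra. intros x Hx.
      apply (Cn_continuity 0), (Cn_Du 0), Cn_density_along; auto.
    + apply ex_RInt_density_along; trivial; lra.
  - assert (HF : is_RInt (fun x => Derive (fun t => density_along a b c e r z xi eta t x) 0
          - EL_pairing a c e r z xi eta x) lo hi (F hi - F lo)).
    { apply (is_RInt_derive F).
      - rewrite Rmin_left, Rmax_right by lra. intros x Hx. unfold F, EL_pairing.
        apply is_derive_natural_flux_along; auto.
      - rewrite Rmin_left, Rmax_right by lra. intros x Hx.
        apply @continuous_minus; auto. }
    apply (is_RInt_unique (V := R_CompleteNormedModule)) in HF.
    set (L := fun x => Derive (fun t => density_along a b c e r z xi eta t x) 0) in *.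
    assert (HM : RInt (fun x => L x - EL_pairing a c e r z xi eta x) lo hi
      = RInt L lo hi - RInt (EL_pairing a c e r z xi eta) lo hi).
    { apply (RInt_minus (V := R_CompleteNormedModule)); apply ex_RInt_of_continuous; auto; lra. }
    fold (F hi). fold (F lo).
    match goal with |- ?A = _ => change A with (RInt L lo hi) end.
    rewrite <- HF.
    replace (RInt L lo hi) with (RInt (fun x => L x - EL_pairing a c e r z xi eta x) lo hi
      + RInt (EL_pairing a c e r z xi eta) lo hi) by (rewrite HM; ring).
    reflexivity.
Qed.

(** One family contains all the variations that are needed: bumps supported in
    an interval, and functions supported near one end with any prescribed
    1-jet there. The fifth powers make them C^4, and the argument is q = u^2 +
    v^2 because the variation must be of class C^4 in (u, v). *)
Definition bump (l1 l2 m1 m2 P Q q : R) : R :=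
  pospart (l1 + m1 * q) ^ 5 * pospart (l2 + m2 * q) ^ 5 * (P + Q * q).

Lemma Cn_bump l1 l2 m1 m2 P Q F u v :
  Cn 4 F u v -> Cn 4 (fun x y => bump l1 l2 m1 m2 P Q (F x y)) u v.
Proof.
  intros HF. unfold bump.
  assert (HA : forall s t, Cn 4 (fun x y => s + t * F x y) u v).
  { intros s t. apply (Cn_plus 4 (fun _ _ => s)); [apply Cn_const|].
    apply (Cn_mult 4 (fun _ _ => t)); [apply Cn_const|exact HF]. }
  apply (Cn_mult 4 (fun x y => pospart (l1 + m1 * F x y) ^ 5 * pospart (l2 + m2 * F x y) ^ 5)); [|apply HA].
  apply (Cn_mult 4 (fun x y => pospart (l1 + m1 * F x y) ^ 5)).
  - exact (Cn_pospart_pow 4 _ u v (HA l1 m1)).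
  - exact (Cn_pospart_pow 4 _ u v (HA l2 m2)).
Qed.

(** The factor x turns a function of q = x^2 into the radial component of a
    smooth rotational field. *)
Definition radial_test (f : R -> R) (x : R) : R := x * f (x ^ 2).
Definition vertical_test (f : R -> R) (x : R) : R := f (x ^ 2).

Lemma Cn_1d_radial_test l1 l2 m1 m2 P Q x : Cn_1d 4 (radial_test (bump l1 l2 m1 m2 P Q)) x.
Proof.
  apply (Cn_mult 4 (fun _ x => x)); [apply Cn_snd|].
  apply (Cn_bump _ _ _ _ _ _ (fun _ x => x ^ 2)), Cn_pow, Cn_snd.
Qed.

Lemma Cn_1d_vertical_test l1 l2 m1 m2 P Q x : Cn_1d 4 (vertical_test (bump l1 l2 m1 m2 P Q)) x.
Proof. apply (Cn_bump _ _ _ _ _ _ (fun _ x => x ^ 2)), Cn_pow, Cn_snd. Qed.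

Lemma is_derive_bump l1 m1 P Q q :
  is_derive (bump l1 1 m1 0 P Q) q
    (5 * m1 * pospart (l1 + m1 * q) ^ 4 * (P + Q * q) + pospart (l1 + m1 * q) ^ 5 * Q).
Proof.
  apply (is_derive_ext (fun q => pospart (l1 + m1 * q) ^ 5 * (P + Q * q))).
  { intros t; unfold bump. rewrite Rmult_0_l, Rplus_0_r, (pospart_nonneg 1) by lra. Rring. }
  assert (D : is_derive (fun q => pospart (l1 + m1 * q) ^ 5) q (m1 * (5 * pospart (l1 + m1 * q) ^ 4))).
  { apply (is_derive_comp (fun y => pospart y ^ 5) (fun q => l1 + m1 * q)).
    - eapply is_derive_eq; [apply (is_derive_pospart_pow 3)|]. simpl; ring.
    - apply (is_derive_eq _ _ (1 * m1)); [auto_derive; trivial; Rring|ring]. }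
  eapply is_derive_eq.
  - apply (is_derive_mult (fun q => pospart (l1 + m1 * q) ^ 5) (fun q => P + Q * q)).
    + exact D.
    + apply (is_derive_eq _ _ (0 + 1 * Q) Q); [auto_derive; trivial; Rring|ring].
    + intros; apply Rmult_comm.
  - unfold plus, mult; simpl. ring.
Qed.

Lemma radial_test_values x l1 m1 v0 v1 :
  0 < x -> l1 + m1 * x ^ 2 = 1 ->
  exists P Q, radial_test (bump l1 1 m1 0 P Q) x = v0 /\ Derive (radial_test (bump l1 1 m1 0 P Q)) x = v1.
Proof.
  intros Hx Hl.
  (* A and B are the value and the derivative that f must have at q = x^2. *)
  pose (A := v0 / x). pose (B := (v1 - A) / (2 * x ^ 2)).
  pose (Q := B - 5 * m1 * A). pose (P := A - Q * x ^ 2).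
  exists P, Q.
  assert (E : bump l1 1 m1 0 P Q (x ^ 2) = A).
  { unfold bump. rewrite Hl, Rmult_0_l, Rplus_0_r, (pospart_nonneg 1) by lra. unfold P; ring. }
  split.
  - unfold radial_test. rewrite E. unfold A; field; lra.
  - apply is_derive_unique. pose proof (is_derive_bump l1 m1 P Q (x ^ 2)) as D.
    unfold radial_test. eapply is_derive_eq.
    + apply (is_derive_mult (fun x => x) (fun x => bump l1 1 m1 0 P Q (x ^ 2))).
      * apply @is_derive_id.
      * apply (is_derive_comp (bump l1 1 m1 0 P Q) (fun x => x ^ 2)); [exact D|].
        apply (is_derive_eq _ _ (2 * x) (2 * x)); [auto_derive; trivial; Rring|reflexivity].
      * intros; apply Rmult_comm.
    + unfold plus, mult, scal, one; simpl. unfold mult; simpl.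
      change (x * (x * 1)) with (x ^ 2). rewrite E, Hl, (pospart_nonneg 1) by lra. unfold P, Q, B. field. lra.
Qed.

Lemma vertical_test_values x l1 m1 v0 v1 :
  0 < x -> l1 + m1 * x ^ 2 = 1 ->
  exists P Q, vertical_test (bump l1 1 m1 0 P Q) x = v0 /\ Derive (vertical_test (bump l1 1 m1 0 P Q)) x = v1.
Proof.
  intros Hx Hl.
  pose (A := v0). pose (B := v1 / (2 * x)).
  pose (Q := B - 5 * m1 * A). pose (P := A - Q * x ^ 2).
  exists P, Q.
  assert (E : bump l1 1 m1 0 P Q (x ^ 2) = A).
  { unfold bump. rewrite Hl, Rmult_0_l, Rplus_0_r, (pospart_nonneg 1) by lra. unfold P; ring. }
  split.
  - exact E.
  - apply is_derive_unique. pose proof (is_derive_bump l1 m1 P Q (x ^ 2)) as D.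
    unfold vertical_test. eapply is_derive_eq.
    + apply (is_derive_comp (bump l1 1 m1 0 P Q) (fun x => x ^ 2)); [exact D|].
      apply (is_derive_eq _ _ (2 * x) (2 * x)); [auto_derive; trivial; Rring|reflexivity].
    + unfold scal; simpl. unfold mult; simpl.
      change (x * (x * 1)) with (x ^ 2). rewrite Hl, (pospart_nonneg 1) by lra. unfold P, Q, B. field. lra.
Qed.

(** * The Euler-Lagrange equation and the natural boundary conditions *)

(** If phi were positive somewhere, it would be positive on an interval, and its
    integral against a bump with support there would be positive. *)
Lemma fundamental_lemma (phi : R -> R) lo hi :
  0 < lo < hi ->
  (forall x, lo <= x <= hi -> continuous phi x) ->
  (forall s1 s2, lo < s1 -> s1 < s2 -> s2 < hi ->
     RInt (fun x => phi x * bump (- s1 ^ 2) (s2 ^ 2) 1 (- 1) 1 0 (x ^ 2)) lo hi = 0) ->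
  forall x, lo <= x <= hi -> phi x = 0.
Proof.
  intros Hlh Hc HI.
  assert (Hpos : forall psi : R -> R, (forall x, lo <= x <= hi -> continuous psi x) ->
    (forall s1 s2, lo < s1 -> s1 < s2 -> s2 < hi ->
     RInt (fun x => psi x * bump (- s1 ^ 2) (s2 ^ 2) 1 (- 1) 1 0 (x ^ 2)) lo hi = 0) ->
    forall x, lo < x < hi -> psi x <= 0).
  { clear phi Hc HI. intros phi Hc HI x Hx. apply Rnot_lt_le. intros Hp.
    assert (Hcx : continuous phi x) by (apply Hc; lra).
    destruct (Hcx (fun y => 0 < y)) as [d Hd].
    { exists (mkposreal _ Hp). intros y Hy. apply Rabs_lt_between in Hy.
      unfold minus, plus, opp in Hy; simpl in Hy. lra. }
    set (m := Rmin d (Rmin (x - lo) (hi - x))).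
    assert (Hm : 0 < m) by (repeat apply Rmin_glb_lt; try lra; apply cond_pos).
    assert (Hm1 : m <= d) by apply Rmin_l.
    assert (Hm2 : m <= x - lo) by (eapply Rle_trans; [apply Rmin_r|apply Rmin_l]).
    assert (Hm3 : m <= hi - x) by (eapply Rle_trans; [apply Rmin_r|apply Rmin_r]).
    set (s1 := x - m / 2). set (s2 := x + m / 2).
    assert (H1 : lo < s1) by (unfold s1; lra). assert (H2 : s1 < s2) by (unfold s1, s2; lra).
    assert (H3 : s2 < hi) by (unfold s2; lra).
    specialize (HI s1 s2 H1 H2 H3).
    set (F := fun y => phi y * bump (- s1 ^ 2) (s2 ^ 2) 1 (- 1) 1 0 (y ^ 2)) in HI.
    assert (HF : forall y, lo <= y <= hi -> continuous F y).
    { intros y Hy. apply (continuous_mult phi (vertical_test (bump (- s1 ^ 2) (s2 ^ 2) 1 (- 1) 1 0))).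
      - now apply Hc.
      - apply (Cn_1d_continuous 4), Cn_1d_vertical_test. }
    assert (HF1 : forall y, s1 < y < s2 -> 0 < F y).
    { intros y Hy. unfold F, bump. rewrite !pospart_nonneg by nra.
      apply Rmult_lt_0_compat.
      - apply Hd. apply Rabs_lt_between. unfold minus, plus, opp; simpl.
        unfold s1, s2 in Hy. lra.
      - apply Rmult_lt_0_compat; [apply Rmult_lt_0_compat; apply pow_lt; nra|lra]. }
    assert (E1 : RInt F lo s1 = 0).
    { rewrite (RInt_ext F (fun _ => 0)).
      - rewrite RInt_const. unfold scal; simpl; unfold mult; simpl; ring.
      - rewrite Rmin_left, Rmax_right by lra. intros y Hy. unfold F, bump.
        rewrite (pospart_nonpos (- s1 ^ 2 + 1 * y ^ 2)) by nra. Rring. }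
    assert (E2 : RInt F s2 hi = 0).
    { rewrite (RInt_ext F (fun _ => 0)).
      - rewrite RInt_const. unfold scal; simpl; unfold mult; simpl; ring.
      - rewrite Rmin_left, Rmax_right by lra. intros y Hy. unfold F, bump.
        rewrite (pospart_nonpos (s2 ^ 2 + - 1 * y ^ 2)) by nra. Rring. }
    assert (E3 : 0 < RInt F s1 s2).
    { apply RInt_gt_0; trivial. intros y Hy. apply HF. lra. }
    assert (X1 : ex_RInt F lo s1) by (apply ex_RInt_of_continuous; [lra|intros; apply HF; lra]).
    assert (X2 : ex_RInt F s1 s2) by (apply ex_RInt_of_continuous; [lra|intros; apply HF; lra]).
    assert (X3 : ex_RInt F s2 hi) by (apply ex_RInt_of_continuous; [lra|intros; apply HF; lra]).
    assert (X4 : ex_RInt F lo s2) by (apply ex_RInt_of_continuous; [lra|intros; apply HF; lra]).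
    pose proof (RInt_Chasles F lo s1 s2 X1 X2) as C1.
    pose proof (RInt_Chasles F lo s2 hi X4 X3) as C2.
    unfold plus in C1, C2; simpl in C1, C2. fold F in HI. lra. }
  apply (eq_closed_interval phi (fun _ => 0)); [lra|trivial| |].
  - intros; apply continuous_const.
  - intros x Hx. apply Rle_antisym; [now apply Hpos|].
    assert (- phi x <= 0); [|lra].
    apply (Hpos (fun y => - phi y)); trivial.
    + intros y Hy. now apply @continuous_opp, Hc.
    + intros s1 s2 H1 H2 H3.
      transitivity (- RInt (fun x => phi x * bump (- s1 ^ 2) (s2 ^ 2) 1 (- 1) 1 0 (x ^ 2)) lo hi);
        [|rewrite (HI s1 s2 H1 H2 H3); Rring].
      symmetry; etransitivity; [symmetry; apply (RInt_opp (V := R_CompleteNormedModule))|].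
      2: { apply RInt_ext. intros y _. unfold opp; simpl. Rring. }
      * apply ex_RInt_of_continuous; [lra|]. intros y Hy.
        apply (continuous_mult phi (vertical_test (bump (- s1 ^ 2) (s2 ^ 2) 1 (- 1) 1 0))).
        -- now apply Hc.
        -- apply (Cn_1d_continuous 4), Cn_1d_vertical_test.
Qed.

Definition is_bump (f : R -> R) : Prop :=
  exists l1 l2 m1 m2 P Q, f = bump l1 l2 m1 m2 P Q.

Lemma is_bump_radial_test f x : is_bump f -> Cn_1d 4 (radial_test f) x.
Proof. intros (l1 & l2 & m1 & m2 & P & Q & ->). apply Cn_1d_radial_test. Qed.
Lemma is_bump_vertical_test f x : is_bump f -> Cn_1d 4 (vertical_test f) x.
Proof. intros (l1 & l2 & m1 & m2 & P & Q & ->). apply Cn_1d_vertical_test. Qed.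

Definition test_flux a b c e r z f g x : R :=
  natural_flux a b c e r z x (radial_test f x) (Derive (radial_test f) x)
    (vertical_test g x) (Derive (vertical_test g) x).

(** The vanishing of the first variation in the direction given by [f] and
    [g], after integration by parts; [jlo] and [jhi] are the derivatives of
    the energies of the boundary circles with respect to their radii, divided
    by 2 pi. *)
Definition variational_eq (a b c e : R) (r z : R -> R) (lo hi jlo jhi : R) (f g : R -> R) : Prop :=
  test_flux a b c e r z f g hi - test_flux a b c e r z f g lo
  + RInt (EL_pairing a c e r z (radial_test f) (vertical_test g)) lo hi
  + jhi * radial_test f hi + jlo * radial_test f lo = 0.

Definition zero_below (f : R -> R) (m : R) : Prop := forall q, q <= m -> f q = 0.
Definition zero_above (f : R -> R) (m : R) : Prop := forall q, m <= q -> f q = 0.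

Lemma sqr_near (P : R -> Prop) x : locally (x ^ 2) P -> locally x (fun y => P (y ^ 2)).
Proof.
  intros H. assert (Hc : continuous (fun y => y ^ 2) x).
  { apply @ex_derive_continuous. auto_derive; trivial. }
  exact (Hc P H).
Qed.

Lemma jets_of_zero f x : locally (x ^ 2) (fun q => f q = 0) ->
  radial_test f x = 0 /\ Derive (radial_test f) x = 0 /\
  vertical_test f x = 0 /\ Derive (vertical_test f) x = 0.
Proof.
  intros H. apply sqr_near in H.
  assert (H1 : locally x (fun y => radial_test f y = 0)).
  { eapply filter_imp; [|exact H]. intros y Hy. unfold radial_test; rewrite Hy; ring. }
  assert (H2 : locally x (fun y => vertical_test f y = 0)) by exact H.
  repeat split.
  - exact (locally_singleton _ _ H1).
  - rewrite (Derive_ext_loc _ (fun _ => 0) _ H1). apply Derive_const.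
  - exact (locally_singleton _ _ H2).
  - rewrite (Derive_ext_loc _ (fun _ => 0) _ H2). apply Derive_const.
Qed.

Lemma zero_below_jets f m x : zero_below f m -> x ^ 2 < m ->
  radial_test f x = 0 /\ Derive (radial_test f) x = 0 /\
  vertical_test f x = 0 /\ Derive (vertical_test f) x = 0.
Proof.
  intros Hf Hx. apply jets_of_zero.
  exists (mkposreal (m - x ^ 2) ltac:(lra)). intros y Hy. apply Hf.
  apply Rabs_lt_between in Hy. unfold minus, plus, opp in Hy; simpl in *. lra.
Qed.

Lemma zero_above_jets f m x : zero_above f m -> m < x ^ 2 ->
  radial_test f x = 0 /\ Derive (radial_test f) x = 0 /\
  vertical_test f x = 0 /\ Derive (vertical_test f) x = 0.
Proof.
  intros Hf Hx. apply jets_of_zero.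
  exists (mkposreal (x ^ 2 - m) ltac:(lra)). intros y Hy. apply Hf.
  apply Rabs_lt_between in Hy. unfold minus, plus, opp in Hy; simpl in *. lra.
Qed.

Lemma natural_flux_0 a b c e r z x : natural_flux a b c e r z x 0 0 0 0 = 0.
Proof. unfold natural_flux. unfold Rdiv. ring. Qed.

Lemma test_flux_below a b c e r z f g x m :
  zero_below f m -> zero_below g m -> x ^ 2 < m -> test_flux a b c e r z f g x = 0.
Proof.
  intros Hf Hg Hx. unfold test_flux.
  destruct (zero_below_jets f m x Hf Hx) as (-> & -> & _).
  destruct (zero_below_jets g m x Hg Hx) as (_ & _ & -> & ->). apply natural_flux_0.
Qed.

Lemma test_flux_above a b c e r z f g x m :
  zero_above f m -> zero_above g m -> m < x ^ 2 -> test_flux a b c e r z f g x = 0.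
Proof.
  intros Hf Hg Hx. unfold test_flux.
  destruct (zero_above_jets f m x Hf Hx) as (-> & -> & _).
  destruct (zero_above_jets g m x Hg Hx) as (_ & _ & -> & ->). apply natural_flux_0.
Qed.

Lemma bump_0 l1 l2 m1 m2 q : bump l1 l2 m1 m2 0 0 q = 0.
Proof. unfold bump; ring. Qed.

Lemma bump_below s1 s2 P Q : zero_below (bump (- s1 ^ 2) (s2 ^ 2) 1 (- 1) P Q) (s1 ^ 2).
Proof.
  intros q Hq. unfold bump. rewrite (pospart_nonpos (- s1 ^ 2 + _)) by lra. ring.
Qed.
Lemma bump_above s1 s2 P Q : zero_above (bump (- s1 ^ 2) (s2 ^ 2) 1 (- 1) P Q) (s2 ^ 2).
Proof.
  intros q Hq. unfold bump. rewrite (pospart_nonpos (s2 ^ 2 + _)) by lra. ring.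
Qed.

(** Vertical bumps show that [EL_op] times C vanishes and radial ones that
    [EL_op] times S does, while C^2 + S^2 = 1. *)
Lemma EL_op_zero a b c e r z lo hi jlo jhi :
  0 < lo < hi -> a <> 0 -> e ^ 2 = 1 ->
  (forall x, lo <= x <= hi -> regular r z x) ->
  (forall f g m, is_bump f -> is_bump g -> lo ^ 2 < m -> zero_below f m -> zero_below g m ->
     variational_eq a b c e r z lo hi jlo jhi f g) ->
  forall x, lo <= x <= hi -> EL_op c e r z x = 0.
Proof.
  intros Hlh Ha He H Hw.
  assert (He0 : e <> 0) by (intros ->; lra).
  assert (HC1 : forall x, lo <= x <= hi -> continuous (fun x => a * pspeed r z x * EL_op c e r z x * e) x).
  { intros x Hx. apply (Cn_1d_continuous 0). specialize (H x Hx).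
    apply (Cn_mult 0 (fun _ x => a * pspeed r z x * EL_op c e r z x) (fun _ _ => e)); [|apply Cn_const].
    apply (Cn_mult 0 (fun _ x => a * pspeed r z x) (fun _ => EL_op c e r z)); [|now apply Cn_1d_EL_op].
    apply (Cn_mult 0 (fun _ _ => a)); [apply Cn_const|].
    now apply (Cn_le 0 3 _ _ _ (Nat.le_0_l _)), Cn_1d_pspeed. }
  (* Inside (lo, hi) only the integral survives in the variational equation. *)
  assert (HW : forall s1 s2 P Q P' Q', lo < s1 -> s1 < s2 -> s2 < hi ->
    RInt (EL_pairing a c e r z (radial_test (bump (- s1 ^ 2) (s2 ^ 2) 1 (- 1) P Q))
       (vertical_test (bump (- s1 ^ 2) (s2 ^ 2) 1 (- 1) P' Q'))) lo hi = 0).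
  { intros s1 s2 P Q P' Q' H1 H2 H3.
    assert (B1 := bump_below s1 s2 P Q). assert (B2 := bump_below s1 s2 P' Q').
    assert (A1 := bump_above s1 s2 P Q). assert (A2 := bump_above s1 s2 P' Q').
    specialize (Hw (bump (- s1 ^ 2) (s2 ^ 2) 1 (- 1) P Q) (bump (- s1 ^ 2) (s2 ^ 2) 1 (- 1) P' Q') (s1 ^ 2)).
    unfold variational_eq in Hw.
    rewrite (test_flux_below _ _ _ _ _ _ _ _ lo _ B1 B2) in Hw by nra.
    rewrite (test_flux_above _ _ _ _ _ _ _ _ hi _ A1 A2) in Hw by nra.
    rewrite (proj1 (zero_below_jets _ _ lo B1 ltac:(nra))) in Hw.
    rewrite (proj1 (zero_above_jets _ _ hi A1 ltac:(nra))) in Hw.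
    rewrite Rminus_0_r, Rplus_0_l, !Rmult_0_r, !Rplus_0_r in Hw.
    apply Hw; trivial; try (do 6 eexists; reflexivity); nra. }
  assert (EC : forall x, lo <= x <= hi -> a * pspeed r z x * EL_op c e r z x * e * pcos r z x = 0).
  { apply fundamental_lemma; trivial.
    - intros x Hx. apply (continuous_mult (fun x => a * pspeed r z x * EL_op c e r z x * e)); [now apply HC1|].
      apply (Cn_1d_continuous 3). now apply Cn_1d_pcos, H.
    - intros s1 s2 H1 H2 H3. etransitivity; [|exact (HW s1 s2 0 0 1 0 H1 H2 H3)].
      apply RInt_ext. intros y _. unfold EL_pairing, radial_test, vertical_test. rewrite bump_0. Rring. }
  assert (ES : forall x, lo <= x <= hi -> a * pspeed r z x * EL_op c e r z x * e * (- psin r z x * x) = 0).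
  { apply fundamental_lemma; trivial.
    - intros x Hx. apply (continuous_mult (fun x => a * pspeed r z x * EL_op c e r z x * e)); [now apply HC1|].
      apply (continuous_mult (fun x => - psin r z x) (fun x => x)); [|apply continuous_id].
      apply (continuous_opp (psin r z)), (Cn_1d_continuous 3). now apply Cn_1d_psin, H.
    - intros s1 s2 H1 H2 H3. etransitivity; [|exact (HW s1 s2 1 0 0 0 H1 H2 H3)].
      apply RInt_ext. intros y _. unfold EL_pairing, radial_test, vertical_test. rewrite bump_0. Rring. }
  intros x Hx. specialize (EC x Hx). specialize (ES x Hx). specialize (H x Hx).
  pose proof (pspeed_pos _ _ _ H). pose proof (pcos2_psin2 _ _ _ H) as HCS.
  assert (Hf : a * pspeed r z x * e <> 0).
  { repeat apply Rmult_integral_contrapositive_currified; trivial. lra. }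
  apply (Rmult_eq_reg_l (a * pspeed r z x * e)); trivial. rewrite Rmult_0_r.
  set (E := a * pspeed r z x * e * EL_op c e r z x).
  replace (a * pspeed r z x * EL_op c e r z x * e * pcos r z x) with (E * pcos r z x) in EC by (unfold E; ring).
  assert (ES' : E * psin r z x = 0).
  { apply (Rmult_eq_reg_r (- x)); [|lra]. rewrite Rmult_0_l, <- ES. unfold E; ring. }
  replace E with (E * (pcos r z x ^ 2 + psin r z x ^ 2)) by (rewrite HCS; ring).
  replace (E * _) with (E * pcos r z x * pcos r z x + E * psin r z x * psin r z x) by ring.
  rewrite EC, ES'; ring.
Qed.

Lemma RInt_EL_pairing_0 a c e r z xi eta lo hi :
  lo < hi -> (forall x, lo <= x <= hi -> EL_op c e r z x = 0) ->
  RInt (EL_pairing a c e r z xi eta) lo hi = 0.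
Proof.
  intros Hlh H. rewrite (RInt_ext _ (fun _ => 0)).
  - rewrite RInt_const. unfold scal; simpl; unfold mult; simpl; ring.
  - rewrite Rmin_left, Rmax_right by lra. intros x Hx. unfold EL_pairing. rewrite H by lra. Rring.
Qed.

(** Once the Euler-Lagrange equation holds, only the terms at the two ends
    remain, and the 1-jet of the variation at [hi] is arbitrary. *)
Lemma natural_hi a b c e r z lo hi jlo jhi :
  0 < lo < hi -> a <> 0 -> e ^ 2 = 1 ->
  (forall x, lo <= x <= hi -> regular r z x) ->
  (forall f g m, is_bump f -> is_bump g -> lo ^ 2 < m -> zero_below f m -> zero_below g m ->
     variational_eq a b c e r z lo hi jlo jhi f g) ->
  forall x0 x1 e0 e1, natural_flux a b c e r z hi x0 x1 e0 e1 + jhi * x0 = 0.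
Proof.
  intros Hlh Ha He H Hw x0 x1 e0 e1.
  pose proof (EL_op_zero _ _ _ _ _ _ _ _ _ _ Hlh Ha He H Hw) as HE.
  set (mu := (lo ^ 2 + hi ^ 2) / 2).
  assert (Hmu : lo ^ 2 < mu < hi ^ 2) by (unfold mu; nra).
  (* The affine function l1 + m1 q is 1 at hi^2 and negative below mu. *)
  set (m1 := / (hi ^ 2 - mu)). set (l1 := - mu * m1).
  assert (Hl : l1 + m1 * hi ^ 2 = 1) by (unfold l1, m1; field; lra).
  assert (Hm1 : 0 < m1) by (apply Rinv_0_lt_compat; lra).
  assert (Hz : forall P Q, zero_below (bump l1 1 m1 0 P Q) mu).
  { intros P Q q Hq. unfold bump. rewrite (pospart_nonpos (l1 + m1 * q)) by (unfold l1; nra). ring. }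
  destruct (radial_test_values hi l1 m1 x0 x1 ltac:(lra) Hl) as (P & Q & E0 & E1).
  destruct (vertical_test_values hi l1 m1 e0 e1 ltac:(lra) Hl) as (P' & Q' & E2 & E3).
  specialize (Hw (bump l1 1 m1 0 P Q) (bump l1 1 m1 0 P' Q') mu
    ltac:(do 6 eexists; reflexivity) ltac:(do 6 eexists; reflexivity) ltac:(lra) (Hz P Q) (Hz P' Q')).
  unfold variational_eq in Hw.
  rewrite (test_flux_below _ _ _ _ _ _ _ _ lo _ (Hz P Q) (Hz P' Q')) in Hw by lra.
  rewrite (proj1 (zero_below_jets _ _ lo (Hz P Q) ltac:(lra))) in Hw.
  rewrite RInt_EL_pairing_0 in Hw by (trivial; lra).
  unfold test_flux in Hw. rewrite E0, E1, E2, E3 in Hw. lra.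
Qed.

Lemma natural_lo a b c e r z lo hi jlo jhi :
  0 < lo < hi -> a <> 0 -> e ^ 2 = 1 ->
  (forall x, lo <= x <= hi -> regular r z x) ->
  (forall f g, is_bump f -> is_bump g -> variational_eq a b c e r z lo hi jlo jhi f g) ->
  forall x0 x1 e0 e1, - natural_flux a b c e r z lo x0 x1 e0 e1 + jlo * x0 = 0.
Proof.
  intros Hlh Ha He H Hw x0 x1 e0 e1.
  assert (HE : forall x, lo <= x <= hi -> EL_op c e r z x = 0)
    by (apply (EL_op_zero a b c e r z lo hi jlo jhi); auto).
  set (mu := (lo ^ 2 + hi ^ 2) / 2).
  assert (Hmu : lo ^ 2 < mu < hi ^ 2) by (unfold mu; nra).
  (* The affine function l1 + m1 q is 1 at lo^2 and negative above mu. *)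
  set (m1 := / (lo ^ 2 - mu)). set (l1 := - mu * m1).
  assert (Hl : l1 + m1 * lo ^ 2 = 1) by (unfold l1, m1; field; lra).
  assert (Hm1 : m1 < 0) by (apply Rinv_lt_0_compat; lra).
  assert (Hz : forall P Q, zero_above (bump l1 1 m1 0 P Q) mu).
  { intros P Q q Hq. unfold bump. rewrite (pospart_nonpos (l1 + m1 * q)) by (unfold l1; nra). ring. }
  destruct (radial_test_values lo l1 m1 x0 x1 ltac:(lra) Hl) as (P & Q & E0 & E1).
  destruct (vertical_test_values lo l1 m1 e0 e1 ltac:(lra) Hl) as (P' & Q' & E2 & E3).
  specialize (Hw (bump l1 1 m1 0 P Q) (bump l1 1 m1 0 P' Q')
    ltac:(do 6 eexists; reflexivity) ltac:(do 6 eexists; reflexivity)).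
  unfold variational_eq in Hw.
  rewrite (test_flux_above _ _ _ _ _ _ _ _ hi _ (Hz P Q) (Hz P' Q')) in Hw by lra.
  rewrite (proj1 (zero_above_jets _ _ hi (Hz P Q) ltac:(lra))) in Hw.
  rewrite RInt_EL_pairing_0 in Hw by (trivial; lra).
  unfold test_flux in Hw. rewrite E0, E1, E2, E3 in Hw. lra.
Qed.

(** Geometrically, with kappa_n = e S / r and kappa_g = - o C / r, these are
    a h + b kappa_n = 0, a h^2 + b K = j kappa_g, and the
    vanishing of the vertical force. *)
Lemma natural_conditions a b c e r z x o j :
  e ^ 2 = 1 -> o <> 0 -> regular r z x ->
  (forall x0 x1 e0 e1, o * natural_flux a b c e r z x x0 x1 e0 e1 + j * x0 = 0) ->
  a * e * r x * shiftedH c e r z x + b * psin r z x = 0 /\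
  o * r x * (a * shiftedH c e r z x ^ 2 + b * (pcurv r z x * psin r z x / r x)) + j * pcos r z x = 0 /\
  a * r x * (shiftedH c e r z x * (shiftedH c e r z x * psin r z x - e * pcurv r z x * psin r z x)
     - Derive (shiftedH c e r z) x / pspeed r z x * (e * pcos r z x)) = 0.
Proof.
  intros He Ho H Hb. pose proof (pspeed_pos _ _ _ H) as Hw. assert (Hr : 0 < r x) by apply H.
  pose proof (pcos2_psin2 _ _ _ H) as HCS.
  assert (B1 : a * e * r x * shiftedH c e r z x + b * psin r z x = 0).
  { apply (Rmult_eq_reg_l o); trivial. rewrite Rmult_0_r.
    (* Turning the tangent at rate 1 while keeping the end point fixed. *)
    rewrite <- (Hb 0 (- pspeed r z x * psin r z x) 0 (pspeed r z x * pcos r z x)). unfold natural_flux.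
    assert (H2 : pcos r z x ^ 2 = 1 - psin r z x ^ 2) by lra. field [H2]. lra. }
  split; [exact B1|]. split.
  (* Sliding the end point along the profile. *)
  - transitivity (o * natural_flux a b c e r z x (pcos r z x) 0 (psin r z x) 0 + j * pcos r z x); [|apply Hb].
    f_equal. unfold natural_flux.
    assert (H2 : pcos r z x ^ 2 = 1 - psin r z x ^ 2) by lra.
    transitivity (o * (r x * (a * shiftedH c e r z x ^ 2) + pcurv r z x * (b * psin r z x))); [field; lra|].
    replace (b * psin r z x) with (- (a * e * r x * shiftedH c e r z x)) by lra. field [H2]. lra.
  (* Translating vertically. *)
  - apply (Rmult_eq_reg_l o); trivial. rewrite Rmult_0_r, <- (Hb 0 0 1 0). unfold natural_flux, shiftedH_flux.
    field. lra.
Qed.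

(** * The linear equation for H + c_o *)

(** Gronwall: with M a bound of |al + be|, the function (u^2 + v^2) exp (M x) is
    nondecreasing, because 2 |u v| is at most u^2 + v^2. *)
Lemma linear_system_unique (u v al be : R -> R) lo hi :
  lo <= hi ->
  (forall x, lo <= x <= hi -> continuous (fun x => al x + be x) x) ->
  (forall x, lo <= x <= hi -> is_derive u x (al x * v x)) ->
  (forall x, lo <= x <= hi -> is_derive v x (be x * u x)) ->
  u hi = 0 -> v hi = 0 ->
  forall x, lo <= x <= hi -> u x = 0.
Proof.
  intros Hlh Hc Hu Hv Hu0 Hv0 x Hx.
  destruct (continuity_ab_maj (fun x => Rabs (al x + be x)) lo hi Hlh) as (xm & Hm & _).
  { intros y Hy. apply (continuity_pt_comp (fun x => al x + be x) Rabs).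
    - apply continuity_pt_filterlim. now apply Hc.
    - apply Rcontinuity_abs. }
  set (M := Rabs (al xm + be xm)) in *. cbv beta in Hm.
  set (F := fun y => (u y ^ 2 + v y ^ 2) * exp (M * y)).
  assert (HF : F x <= F hi).
  { set (dF := fun y => (2 * u y * v y * (al y + be y) + M * (u y ^ 2 + v y ^ 2)) * exp (M * y)).
    assert (HdF : forall y, lo <= y <= hi -> is_derive F y (dF y)).
    { intros y Hy. pose proof (Hu y Hy) as Du. pose proof (Hv y Hy) as Dv.
      unfold F. eapply is_derive_eq.
      - auto_derive; [|reflexivity]. repeat split; eexists; eassumption.
      - derive_rewrite Du. derive_rewrite Dv. unfold dF; ring. }
    destruct (MVT_gen F x hi dF) as (y & Hy & E).
    - intros y Hy. rewrite Rmin_left, Rmax_right in Hy by lra. apply HdF; lra.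
    - intros y Hy. rewrite Rmin_left, Rmax_right in Hy by lra.
      apply continuity_pt_filterlim, (ex_derive_continuous F). eexists; apply HdF; lra.
    - rewrite Rmin_left, Rmax_right in Hy by lra.
      assert (0 <= dF y); [|nra].
      specialize (Hm y ltac:(lra)). fold M in Hm.
      apply Rmult_le_pos; [|left; apply exp_pos].
      apply Rabs_le_between in Hm.
      assert (Hs : 0 <= (u y + v y) ^ 2 /\ 0 <= (u y - v y) ^ 2) by (split; apply pow2_ge_0).
      nra. }
  unfold F in HF. rewrite Hu0, Hv0 in HF.
  pose proof (exp_pos (M * x)). pose proof (pow2_ge_0 (u x)). pose proof (pow2_ge_0 (v x)).
  replace ((0 ^ 2 + 0 ^ 2) * exp (M * hi)) with 0 in HF by ring.
  assert (u x ^ 2 + v x ^ 2 <= 0).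
  { apply (Rmult_le_reg_r (exp (M * x))); [trivial|lra]. }
  nra.
Qed.

(** (H + c_o) z + nu_3. *)
Definition height_combo c e r z x : R := shiftedH c e r z x * z x + e * pcos r z x.
(** r times the arc length derivative of [height_combo]. *)
Definition height_combo_flux c e r z x : R :=
  shiftedH_flux c e r z x * z x + r x * psin r z x * (shiftedH c e r z x - e * pcurv r z x).

(** Coefficients of the system y' = jacobi_a v, v' = jacobi_b y that is
    equivalent to D (r D y) + 2 r (H (H - c_o) - K) y = 0 through v = r D y. *)
Definition jacobi_a r z x : R := pspeed r z x / r x.
Definition jacobi_b c e r z x : R :=
  - (2 * r x * pspeed r z x
     * ((shiftedH c e r z x - c) * (shiftedH c e r z x - 2 * c) - pcurv r z x * psin r z x / r x)).

Lemma continuous_jacobi c e r z x : regular r z x ->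
  continuous (fun x => jacobi_a r z x + jacobi_b c e r z x) x.
Proof.
  intros H. apply (Cn_1d_continuous 0).
  assert (Hh : Cn_1d 0 (shiftedH c e r z) x) by now apply Cn_pred, Cn_pred, Cn_1d_shiftedH.
  assert (Hw : Cn_1d 0 (pspeed r z) x) by now apply Cn_pred, Cn_pred, Cn_pred, Cn_1d_pspeed.
  assert (Hr : Cn_1d 0 r x) by apply Cn_pred, Cn_pred, Cn_pred, Cn_pred, H.
  assert (Hk : Cn_1d 0 (pcurv r z) x) by now apply Cn_pred, Cn_pred, Cn_1d_pcurv.
  assert (HS : Cn_1d 0 (psin r z) x) by now apply Cn_pred, Cn_pred, Cn_pred, Cn_1d_psin.
  assert (r x <> 0) by apply Rgt_not_eq, H.
  unfold Cn_1d, jacobi_a, jacobi_b in *.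
  repeat first [ assumption | apply Cn_const | apply Cn_opp | apply Cn_minus | apply Cn_plus
    | apply Cn_div | apply Cn_mult ].
Qed.

Lemma shiftedH_system c e r z x : regular r z x -> EL_op c e r z x = 0 ->
  is_derive (shiftedH c e r z) x (jacobi_a r z x * shiftedH_flux c e r z x) /\
  is_derive (shiftedH_flux c e r z) x (jacobi_b c e r z x * shiftedH c e r z x).
Proof.
  intros H HE. pose proof (pspeed_pos _ _ _ H) as Hw. assert (0 < r x) by apply H. split.
  - eapply is_derive_eq; [apply (Cn_1d_is_derive 1), Cn_1d_shiftedH, H|].
    unfold jacobi_a, shiftedH_flux. field. lra.
  - eapply is_derive_eq; [apply (Cn_1d_is_derive 0), Cn_1d_shiftedH_flux, H|].
    replace (Derive (shiftedH_flux c e r z) x) with (pspeed r z x * (EL_op c e r z x - (2 * r x * shiftedH c e r z x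
    * ((shiftedH c e r z x - c) * (shiftedH c e r z x - 2 * c) - pcurv r z x * psin r z x / r x)))).
    + rewrite HE. unfold jacobi_b. field; lra.
    + unfold EL_op. field. lra.
Qed.

(** A vertical translation does not change the energy density. Its normal
    component nu_3 therefore satisfies, by the formula for the variation of H,
    the same equation as h up to the terms - 2 r S D h - h D (r S), which are
    the opposite of those that z h produces. *)
Lemma height_system c e r z x : e ^ 2 = 1 -> regular r z x -> EL_op c e r z x = 0 ->
  is_derive (height_combo c e r z) x (jacobi_a r z x * height_combo_flux c e r z x) /\
  is_derive (height_combo_flux c e r z) x (jacobi_b c e r z x * height_combo c e r z x).
Proof.
  intros He H HE. pose proof (pspeed_pos _ _ _ H) as Hw. assert (Hr : 0 < r x) by apply H.
  destruct (shiftedH_system c e _ _ _ H HE) as [Dh Dg].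
  pose proof (is_derive_profile_z _ _ _ H) as Dz. pose proof (is_derive_pcos _ _ _ H) as DC.
  pose proof (is_derive_psin _ _ _ H) as DS. pose proof (is_derive_profile_r _ _ _ H) as Dr.
  pose proof (Cn_1d_is_derive _ _ _ (Cn_1d_pcurv _ _ _ H)) as Dk.
  split.
  - unfold height_combo. eapply is_derive_eq.
    + auto_derive; [|reflexivity]. repeat split; eexists; eassumption.
    + derive_rewrite Dh. derive_rewrite Dz. derive_rewrite DC.
      unfold jacobi_a, height_combo_flux. field. lra.
  - pose proof (is_derive_unique _ _ _ (is_derive_shiftedH c e _ _ _ H)) as E1.
    rewrite (is_derive_unique _ _ _ Dh) in E1.
    (* The derivative of the curvature k is expressed through that of H + c_o. *)
    assert (EDk : Derive (pcurv r z) x = pspeed r z x * (2 * e * (shiftedH_flux c e r z x / r x)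
       - (pcurv r z x * pcos r z x / r x - psin r z x * pcos r z x / r x ^ 2))).
    { replace (shiftedH_flux c e r z x) with (jacobi_a r z x * shiftedH_flux c e r z x * r x / pspeed r z x)
        by (unfold jacobi_a; field; lra).
      rewrite E1. field [He]. lra. }
    unfold height_combo_flux. eapply is_derive_eq.
    + auto_derive; [|reflexivity]. repeat split; eexists; eassumption.
    + derive_rewrite Dh. derive_rewrite Dz. derive_rewrite DS. derive_rewrite Dg. derive_rewrite Dr.
      change (Derive (fun y => pcurv r z y) x) with (Derive (pcurv r z) x). rewrite EDk.
      unfold jacobi_a, jacobi_b, height_combo.
      generalize (shiftedH_flux c e r z x); intros g0. unfold shiftedH.
      assert (H2 : pcos r z x ^ 2 = 1 - psin r z x ^ 2) by (pose proof (pcos2_psin2 _ _ _ H); lra).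
      field [H2 He]. lra.
Qed.

Lemma shiftedH_vanishes c e r z lo hi :
  lo <= hi ->
  (forall x, lo <= x <= hi -> regular r z x) ->
  (forall x, lo <= x <= hi -> EL_op c e r z x = 0) ->
  shiftedH c e r z hi = 0 -> shiftedH_flux c e r z hi = 0 ->
  forall x, lo <= x <= hi -> shiftedH c e r z x = 0.
Proof.
  intros Hlh H HE H0 H1.
  apply (linear_system_unique _ (shiftedH_flux c e r z) (jacobi_a r z) (jacobi_b c e r z) lo hi); trivial.
  - intros x Hx. apply continuous_jacobi; auto.
  - intros x Hx. apply shiftedH_system; auto.
  - intros x Hx. apply shiftedH_system; auto.
Qed.

Lemma height_proportional c e r z lo hi t :
  lo <= hi -> e ^ 2 = 1 ->
  (forall x, lo <= x <= hi -> regular r z x) ->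
  (forall x, lo <= x <= hi -> EL_op c e r z x = 0) ->
  height_combo c e r z hi = t * shiftedH c e r z hi ->
  height_combo_flux c e r z hi = t * shiftedH_flux c e r z hi ->
  forall x, lo <= x <= hi -> height_combo c e r z x = t * shiftedH c e r z x.
Proof.
  intros Hlh He H HE H0 H1 x Hx. apply Rminus_diag_uniq. revert x Hx.
  apply (linear_system_unique (fun x => height_combo c e r z x - t * shiftedH c e r z x)
    (fun x => height_combo_flux c e r z x - t * shiftedH_flux c e r z x) (jacobi_a r z) (jacobi_b c e r z) lo hi); trivial.
  - intros x Hx. apply continuous_jacobi; auto.
  - intros x Hx. destruct (shiftedH_system c e r z x) as [Dh Dg]; auto.
    destruct (height_system c e r z x) as [Du Dv]; auto.
    eapply is_derive_eq.
    + apply @is_derive_minus; [exact Du|]. apply is_derive_scal, Dh.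
    + unfold minus, plus, opp; simpl. unfold scal; simpl. unfold mult; simpl. ring.
  - intros x Hx. destruct (shiftedH_system c e r z x) as [Dh Dg]; auto.
    destruct (height_system c e r z x) as [Du Dv]; auto.
    eapply is_derive_eq.
    + apply @is_derive_minus; [exact Dv|]. apply is_derive_scal, Dg.
    + unfold minus, plus, opp; simpl. unfold scal; simpl. unfold mult; simpl. ring.
  - lra.
  - lra.
Qed.

(** The hypothesis, which is the balance of vertical forces, is the vanishing of
    the Wronskian of [shiftedH] and [height_combo] at [x]. *)
Lemma shiftedH_height_combo_dependent a c e r z x :
  a <> 0 -> regular r z x ->
  a * r x * (shiftedH c e r z x * (shiftedH c e r z x * psin r z x - e * pcurv r z x * psin r z x)
     - Derive (shiftedH c e r z) x / pspeed r z x * (e * pcos r z x)) = 0 ->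
  (shiftedH c e r z x = 0 /\ shiftedH_flux c e r z x = 0) \/
  exists t, height_combo c e r z x = t * shiftedH c e r z x /\
    height_combo_flux c e r z x = t * shiftedH_flux c e r z x.
Proof.
  intros Ha H HB. pose proof (pspeed_pos _ _ _ H) as Hw. assert (Hr : 0 < r x) by apply H.
  assert (W : shiftedH c e r z x * height_combo_flux c e r z x = height_combo c e r z x * shiftedH_flux c e r z x).
  { apply Rminus_diag_uniq. apply (Rmult_eq_reg_l a); trivial. rewrite Rmult_0_r, <- HB.
    unfold height_combo, height_combo_flux, shiftedH_flux. field. lra. }
  destruct (Req_dec (shiftedH c e r z x) 0) as [Hh|Hh].
  - destruct (Req_dec (shiftedH_flux c e r z x) 0) as [Hg|Hg]; [now left|right].
    exists (height_combo_flux c e r z x / shiftedH_flux c e r z x). rewrite Hh in *. split; [|field; trivial].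
    rewrite Rmult_0_r. rewrite Rmult_0_l in W. symmetry in W.
    apply Rmult_integral in W. tauto.
  - right. exists (height_combo c e r z x / shiftedH c e r z x). split; [field; trivial|].
    apply (Rmult_eq_reg_l (shiftedH c e r z x)); trivial. rewrite W. field; trivial.
Qed.

(** * Surfaces of revolution *)

Definition rho (u v : R) : R := sqrt (u ^ 2 + v ^ 2).

(** The rotation of the profile (s y, zt), in the sense given by [e]. A
    profile may lie on either side of the axis, and the sign [s] lets y be
    positive. *)
Definition Rot (s e : R) (y zt : R -> R) (u v : R) : R3 :=
  (s * y (rho u v) * (u / rho u v), e * (s * y (rho u v) * (v / rho u v)), zt (rho u v)).

Lemma rho_polar x th : 0 <= x -> rho (x * cos th) (x * sin th) = x.
Proof.
  intros Hx. unfold rho. replace (_ + _) with (x ^ 2).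
  - now apply sqrt_pow2.
  - pose proof (sin2_cos2 th) as E. unfold Rsqr in E.
    replace ((x * cos th) ^ 2 + (x * sin th) ^ 2) with (x ^ 2 * (sin th * sin th + cos th * cos th)) by ring.
    rewrite E; ring.
Qed.

Lemma rho_continuity u v : continuity_2d_pt rho u v.
Proof.
  apply (continuity_1d_2d_pt_comp sqrt (fun u v => u ^ 2 + v ^ 2)).
  - apply continuity_pt_sqrt. pose proof (pow2_ge_0 u). pose proof (pow2_ge_0 v). lra.
  - apply (Cn_continuity 0), Cn_plus; apply Cn_pow; [apply Cn_fst|apply Cn_snd].
Qed.

Lemma open_annulus lo hi u v :
  lo < rho u v < hi -> locally_2d (fun x y => lo < rho x y < hi) u v.
Proof.
  intros H.
  assert (Hd : 0 < Rmin (rho u v - lo) (hi - rho u v)) by (apply Rmin_glb_lt; lra).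
  destruct (rho_continuity u v (mkposreal _ Hd)) as [d H']. exists d. intros x y Hx Hy.
  specialize (H' x y Hx Hy). simpl in H'. apply Rabs_lt_between in H'.
  pose proof (Rmin_l (rho u v - lo) (hi - rho u v)).
  pose proof (Rmin_r (rho u v - lo) (hi - rho u v)). lra.
Qed.

Lemma vec_eq (p q : R3) : x1 p = x1 q -> x2 p = x2 q -> x3 p = x3 q -> p = q.
Proof. destruct p as [[? ?] ?], q as [[? ?] ?]; unfold x1, x2, x3; simpl; congruence. Qed.

Lemma is_derive_rho_u u v : 0 < rho u v -> is_derive (fun s => rho s v) u (u / rho u v).
Proof.
  intros H. unfold rho in *. eapply is_derive_eq.
  - apply (is_derive_sqrt (fun s => s ^ 2 + v ^ 2) u (2 * u)).
    + auto_derive; trivial; Rring.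
    + apply sqrt_lt_0_alt. now rewrite sqrt_0.
  - field. lra.
Qed.

Lemma is_derive_rho_v u v : 0 < rho u v -> is_derive (fun s => rho u s) v (v / rho u v).
Proof.
  intros H. unfold rho in *. eapply is_derive_eq.
  - apply (is_derive_sqrt (fun s => u ^ 2 + s ^ 2) v (2 * v)).
    + auto_derive; trivial; Rring.
    + apply sqrt_lt_0_alt. now rewrite sqrt_0.
  - field. lra.
Qed.

Lemma d_u_ext Y Z u v : locally_2d (fun x y => Y x y = Z x y) u v -> d_u Y u v = d_u Z u v.
Proof.
  intros H. apply locally_2d_1d_const_y in H. unfold d_u, vDerive.
  rewrite (Derive_ext_loc (fun s => x1 (Y s v)) (fun s => x1 (Z s v))),
    (Derive_ext_loc (fun s => x2 (Y s v)) (fun s => x2 (Z s v))),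
    (Derive_ext_loc (fun s => x3 (Y s v)) (fun s => x3 (Z s v))); trivial;
  (eapply filter_imp; [|exact H]; now intros ? ->).
Qed.

Lemma d_v_ext Y Z u v : locally_2d (fun x y => Y x y = Z x y) u v -> d_v Y u v = d_v Z u v.
Proof.
  intros H. apply locally_2d_1d_const_x in H. unfold d_v, vDerive.
  rewrite (Derive_ext_loc (fun s => x1 (Y u s)) (fun s => x1 (Z u s))),
    (Derive_ext_loc (fun s => x2 (Y u s)) (fun s => x2 (Z u s))),
    (Derive_ext_loc (fun s => x3 (Y u s)) (fun s => x3 (Z u s))); trivial;
  (eapply filter_imp; [|exact H]; now intros ? ->).
Qed.

Lemma d_u_Rot s e y zt x th y' z' :
  0 < x -> is_derive y x y' -> is_derive zt x z' ->
  d_u (Rot s e y zt) (x * cos th) (x * sin th) =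
  (s * (y' * cos th ^ 2 + y x / x * sin th ^ 2),
   e * (s * ((y' - y x / x) * cos th * sin th)), z' * cos th).
Proof.
  intros Hx Dy Dz. set (u := x * cos th). set (v := x * sin th).
  assert (Er : rho u v = x) by (apply rho_polar; lra).
  assert (Dr : is_derive (fun s => rho s v) u (u / x)).
  { rewrite <- Er. apply is_derive_rho_u. now rewrite Er. }
  pose proof (sin2_cos2 th) as E. unfold Rsqr in E.
  assert (E2 : cos th ^ 2 = 1 - sin th ^ 2) by lra.
  assert (Dyr : is_derive (fun s => y (rho s v)) u (u / x * y')).
  { apply (is_derive_comp y (fun s => rho s v)); [now rewrite Er|exact Dr]. }
  assert (Dzr : is_derive (fun s => zt (rho s v)) u (u / x * z')).
  { apply (is_derive_comp zt (fun s => rho s v)); [now rewrite Er|exact Dr]. }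
  unfold d_u, vDerive, Rot; apply vec_eq; unfold x1, x2, x3; simpl; apply is_derive_unique.
  - eapply is_derive_eq.
    + auto_derive; [|reflexivity]. rewrite Er. repeat split; try (eexists; eassumption); lra.
    + derive_rewrite Dr. rewrite Er. derive_rewrite Dy. unfold u. field [E2]. lra.
  - eapply is_derive_eq.
    + auto_derive; [|reflexivity]. rewrite Er. repeat split; try (eexists; eassumption); lra.
    + derive_rewrite Dr. rewrite Er. derive_rewrite Dy. unfold u, v. field [E2]. lra.
  - eapply is_derive_eq; [exact Dzr|]. unfold u; field; lra.
Qed.

Lemma d_v_Rot s e y zt x th y' z' :
  0 < x -> is_derive y x y' -> is_derive zt x z' ->
  d_v (Rot s e y zt) (x * cos th) (x * sin th) =
  (s * ((y' - y x / x) * cos th * sin th),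
   e * (s * (y' * sin th ^ 2 + y x / x * cos th ^ 2)), z' * sin th).
Proof.
  intros Hx Dy Dz. set (u := x * cos th). set (v := x * sin th).
  assert (Er : rho u v = x) by (apply rho_polar; lra).
  assert (Dr : is_derive (fun s => rho u s) v (v / x)).
  { rewrite <- Er. apply is_derive_rho_v. now rewrite Er. }
  pose proof (sin2_cos2 th) as E. unfold Rsqr in E.
  assert (E2 : cos th ^ 2 = 1 - sin th ^ 2) by lra.
  assert (Dyr : is_derive (fun s => y (rho u s)) v (v / x * y')).
  { apply (is_derive_comp y (fun s => rho u s)); [now rewrite Er|exact Dr]. }
  assert (Dzr : is_derive (fun s => zt (rho u s)) v (v / x * z')).
  { apply (is_derive_comp zt (fun s => rho u s)); [now rewrite Er|exact Dr]. }
  unfold d_v, vDerive, Rot; apply vec_eq; unfold x1, x2, x3; simpl; apply is_derive_unique.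
  - eapply is_derive_eq.
    + auto_derive; [|reflexivity]. rewrite Er. repeat split; try (eexists; eassumption); lra.
    + derive_rewrite Dr. rewrite Er. derive_rewrite Dy. unfold u, v. field [E2]. lra.
  - eapply is_derive_eq.
    + auto_derive; [|reflexivity]. rewrite Er. repeat split; try (eexists; eassumption); lra.
    + derive_rewrite Dr. rewrite Er. derive_rewrite Dy. unfold v. field [E2]. lra.
  - eapply is_derive_eq; [exact Dzr|]. unfold v; field; lra.
Qed.

Definition rotational (s e : R) (y zt : R -> R) (lo hi : R) (Y : R -> R -> R3) : Prop :=
  forall u v, lo < rho u v < hi -> Y u v = Rot s e y zt u v.

Lemma rotational_near s e y zt lo hi Y x th :
  rotational s e y zt lo hi Y -> 0 <= lo < x -> x < hi ->
  locally_2d (fun u v => Y u v = Rot s e y zt u v) (x * cos th) (x * sin th).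
Proof.
  intros H Hlo Hhi. eapply locally_2d_impl; [|apply (open_annulus lo hi)].
  - apply locally_2d_forall. exact H.
  - rewrite rho_polar; lra.
Qed.

Lemma polar_coordinates u v : exists th, u = rho u v * cos th /\ v = rho u v * sin th.
Proof.
  destruct (Req_dec (rho u v) 0) as [H0|H0].
  - exists 0. rewrite H0. apply sqrt_eq_0 in H0.
    + pose proof (pow2_ge_0 u). pose proof (pow2_ge_0 v). split; nra.
    + pose proof (pow2_ge_0 u). pose proof (pow2_ge_0 v). lra.
  - assert (Hs : rho u v ^ 2 = u ^ 2 + v ^ 2).
    { apply pow2_sqrt. pose proof (pow2_ge_0 u). pose proof (pow2_ge_0 v). lra. }
    assert (E : (u / rho u v) ^ 2 + (v / rho u v) ^ 2 = 1).
    { replace (_ + _) with ((u ^ 2 + v ^ 2) / rho u v ^ 2) by (field; trivial).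
      rewrite <- Hs. field; trivial. }
    assert (B : -1 <= u / rho u v <= 1).
    { pose proof (pow2_ge_0 (v / rho u v)). split; nra. }
    assert (Hc : forall a, a = acos (u / rho u v) \/ a = - acos (u / rho u v) ->
       u = rho u v * cos a).
    { intros a [->| ->]; rewrite ?cos_neg, cos_acos by lra; field; trivial. }
    destruct (Rle_lt_dec 0 (v / rho u v)) as [Hv|Hv].
    + exists (acos (u / rho u v)). split; [apply Hc; auto|].
      rewrite sin_acos by lra. replace (1 - (u / rho u v)²) with ((v / rho u v) ^ 2).
      * rewrite sqrt_pow2 by trivial. field; trivial.
      * unfold Rsqr. simpl in *. lra.
    + exists (- acos (u / rho u v)). split; [apply Hc; auto|].
      rewrite sin_neg, sin_acos by lra. replace (1 - (u / rho u v)²) with ((- (v / rho u v)) ^ 2).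
      * rewrite sqrt_pow2 by lra. field; trivial.
      * unfold Rsqr. simpl in *. lra.
Qed.

Lemma rotational_of_polar s e y zt lo Y :
  0 <= lo ->
  (forall x th, lo < x < 1 ->
    Y (x * cos th) (x * sin th) = (s * y x * cos th, e * (s * y x * sin th), zt x)) ->
  rotational s e y zt lo 1 Y.
Proof.
  intros Hlo Hsym u v Huv.
  destruct (polar_coordinates u v) as (th & Hu & Hv).
  assert (Hr : rho u v <> 0) by lra.
  transitivity (Y (rho u v * cos th) (rho u v * sin th)); [now rewrite <- Hu, <- Hv|].
  rewrite Hsym by lra. unfold Rot.
  replace (u / rho u v) with (cos th) by (rewrite Hu at 1; field; trivial).
  replace (v / rho u v) with (sin th) by (rewrite Hv at 1; field; trivial).
  apply vec_eq; unfold x1, x2, x3; simpl; ring.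
Qed.

Lemma rot_derivatives s e y zt lo hi Y x th :
  rotational s e y zt lo hi Y -> 0 <= lo < x -> x < hi ->
  forall y' z', is_derive y x y' -> is_derive zt x z' ->
  d_u Y (x * cos th) (x * sin th) =
  (s * (y' * cos th ^ 2 + y x / x * sin th ^ 2),
   e * (s * ((y' - y x / x) * cos th * sin th)), z' * cos th) /\
  d_v Y (x * cos th) (x * sin th) =
  (s * ((y' - y x / x) * cos th * sin th),
   e * (s * (y' * sin th ^ 2 + y x / x * cos th ^ 2)), z' * sin th).
Proof.
  intros H Hlo Hhi y' z' Dy Dz. pose proof (rotational_near _ _ _ _ _ _ _ x th H Hlo Hhi) as HL.
  rewrite (d_u_ext _ _ _ _ HL), (d_v_ext _ _ _ _ HL).
  split; [apply d_u_Rot|apply d_v_Rot]; trivial; lra.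
Qed.

Lemma rot_cross s e y zt lo hi Y x th y' z' :
  s ^ 2 = 1 -> rotational s e y zt lo hi Y -> 0 <= lo < x -> x < hi ->
  is_derive y x y' -> is_derive zt x z' ->
  cross (d_u Y (x * cos th) (x * sin th)) (d_v Y (x * cos th) (x * sin th)) =
  (- e * s * (y x / x) * z' * cos th, - s * (y x / x) * z' * sin th, e * (y x / x) * y').
Proof.
  intros Hs H Hlo Hhi Dy Dz.
  destruct (rot_derivatives _ _ _ _ _ _ _ x th H Hlo Hhi _ _ Dy Dz) as [-> ->].
  pose proof (sin2_cos2 th) as E. unfold Rsqr in E.
  assert (E2 : cos th ^ 2 = 1 - sin th ^ 2) by lra.
  assert (x <> 0) by lra.
  unfold cross; apply vec_eq; unfold x1, x2, x3; simpl; field [E2 Hs]; trivial.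
Qed.

Lemma rot_area_nu s e y zt lo hi Y x th :
  s ^ 2 = 1 -> e ^ 2 = 1 -> rotational s e y zt lo hi Y -> 0 <= lo < x -> x < hi ->
  regular y zt x ->
  area_density Y (x * cos th) (x * sin th) * x = y x * pspeed y zt x /\
  nu Y (x * cos th) (x * sin th) =
    (s * (- e * psin y zt x) * cos th, e * (s * (- e * psin y zt x) * sin th), e * pcos y zt x).
Proof.
  intros Hs He H Hlo Hhi HR.
  assert (Hy : 0 < y x) by apply HR. pose proof (pspeed_pos _ _ _ HR) as Hw.
  pose proof (pcos2_psin2 _ _ _ HR) as HCS.
  pose proof (rot_cross _ _ _ _ _ _ _ x th _ _ Hs H Hlo Hhi
    (is_derive_profile_r _ _ _ HR) (is_derive_profile_z _ _ _ HR)) as HC.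
  pose proof (sin2_cos2 th) as E. unfold Rsqr in E.
  assert (E2 : cos th ^ 2 = 1 - sin th ^ 2) by lra.
  assert (E3 : pcos y zt x ^ 2 = 1 - psin y zt x ^ 2) by lra.
  assert (HN : norm3 (cross (d_u Y (x * cos th) (x * sin th)) (d_v Y (x * cos th) (x * sin th)))
     = y x / x * pspeed y zt x).
  { rewrite HC. unfold norm3. rewrite <- (sqrt_pow2 (y x / x * pspeed y zt x)).
    - f_equal. unfold dot, x1, x2, x3; simpl. field [E2 E3 Hs He]. lra.
    - apply Rmult_le_pos; [|lra]. apply Rlt_le, Rdiv_lt_0_compat; lra. }
  split.
  - unfold area_density. rewrite HN. field. lra.
  - unfold nu, normalize. rewrite HN, HC. unfold vscale.
    apply vec_eq; unfold x1, x2, x3; simpl; field [Hs He]; lra.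
Qed.

(** The Gauss map is itself a map of revolution, so that the formulas for the
    partial derivatives of X also give those of nu. *)
Lemma rotational_nu s e y zt lo hi Y :
  s ^ 2 = 1 -> e ^ 2 = 1 -> rotational s e y zt lo hi Y -> 0 <= lo ->
  (forall x, lo < x < hi -> regular y zt x) ->
  rotational s e (fun x => - e * psin y zt x) (fun x => e * pcos y zt x) lo hi (nu Y).
Proof.
  intros Hs He H Hlo HR u v Huv. destruct (polar_coordinates u v) as (th & Hu & Hv).
  set (x := rho u v) in *.
  destruct (rot_area_nu s e y zt lo hi Y x th) as [_ HN]; trivial; try lra.
  { now apply HR. }
  rewrite <- Hu, <- Hv in HN. rewrite HN. unfold Rot. fold x. rewrite Hu, Hv.
  assert (x <> 0) by lra. apply vec_eq; unfold x1, x2, x3; simpl; field; trivial.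
Qed.

(** In the orthogonal frame of meridians and parallels both fundamental forms
    are diagonal; in the frame (d_u, d_v) they are rotated by the angle [th]. *)
Lemma rot_curvatures s e y zt lo hi Y x th :
  s ^ 2 = 1 -> e ^ 2 = 1 -> rotational s e y zt lo hi Y -> 0 <= lo < x -> x < hi ->
  (forall x, lo < x < hi -> regular y zt x) ->
  H Y (x * cos th) (x * sin th) = e * (pcurv y zt x + psin y zt x / y x) / 2 /\
  K Y (x * cos th) (x * sin th) = pcurv y zt x * psin y zt x / y x.
Proof.
  intros Hs He HY Hlo Hhi HR'. pose proof (HR' x ltac:(lra)) as HR.
  assert (Hy : 0 < y x) by apply HR. pose proof (pspeed_pos _ _ _ HR) as Hw.
  pose proof (pcos2_psin2 _ _ _ HR) as HCS.
  destruct (rot_derivatives _ _ _ _ _ _ _ x th HY Hlo Hhi _ _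
    (is_derive_profile_r _ _ _ HR) (is_derive_profile_z _ _ _ HR))
    as [HU HV].
  pose proof (rotational_nu _ _ _ _ _ _ _ Hs He HY (proj1 Hlo) HR') as HN.
  destruct (rot_derivatives _ _ _ _ _ _ _ x th HN Hlo Hhi
    (- e * (pspeed y zt x * pcurv y zt x * pcos y zt x)) (e * (- pspeed y zt x * pcurv y zt x * psin y zt x))) as [NU NV].
  { apply is_derive_scal. now apply is_derive_psin. }
  { apply is_derive_scal. now apply is_derive_pcos. }
  pose proof (sin2_cos2 th) as E. unfold Rsqr in E.
  assert (E2 : cos th ^ 2 = 1 - sin th ^ 2) by lra.
  assert (E3 : pcos y zt x ^ 2 = 1 - psin y zt x ^ 2) by lra.
  set (u := x * cos th) in *. set (v := x * sin th) in *.
  set (p := y x / x) in *. set (w := pspeed y zt x) in *. set (c := cos th) in *. set (n := sin th) in *.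
  (* The diagonal entries of II along the meridian and the parallel. *)
  set (A := e * w ^ 2 * pcurv y zt x). set (B := e * psin y zt x * p / x).
  assert (Hx : x <> 0) by lra.
  assert (I1 : I_uu Y u v = w ^ 2 * c ^ 2 + p ^ 2 * n ^ 2).
  { unfold I_uu. rewrite HU. unfold dot, x1, x2, x3; simpl. field [E2 E3 Hs He]. }
  assert (I2 : I_uv Y u v = (w ^ 2 - p ^ 2) * c * n).
  { unfold I_uv. rewrite HU, HV. unfold dot, x1, x2, x3; simpl. field [E2 E3 Hs He]. }
  assert (I3 : I_vv Y u v = w ^ 2 * n ^ 2 + p ^ 2 * c ^ 2).
  { unfold I_vv. rewrite HV. unfold dot, x1, x2, x3; simpl. field [E2 E3 Hs He]. }
  assert (I4 : det_I Y u v = w ^ 2 * p ^ 2).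
  { unfold det_I. rewrite I1, I2, I3. field [E2]. }
  assert (J1 : II_uu Y u v = A * c ^ 2 + B * n ^ 2).
  { unfold II_uu. rewrite HU, NU. unfold dot, x1, x2, x3, A, B; simpl. field [E2 E3 Hs He]. trivial. }
  assert (J2 : II_uv Y u v = (A - B) * c * n).
  { unfold II_uv. rewrite HV, NU. unfold dot, x1, x2, x3, A, B; simpl. field [E2 E3 Hs He]. trivial. }
  assert (J3 : II_vu Y u v = (A - B) * c * n).
  { unfold II_vu. rewrite HU, NV. unfold dot, x1, x2, x3, A, B; simpl. field [E2 E3 Hs He]. trivial. }
  assert (J4 : II_vv Y u v = A * n ^ 2 + B * c ^ 2).
  { unfold II_vv. rewrite HV, NV. unfold dot, x1, x2, x3, A, B; simpl. field [E2 E3 Hs He]. trivial. }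
  assert (Hp : p <> 0) by (unfold p; apply Rgt_not_eq, Rdiv_lt_0_compat; lra).
  assert (Hy' : y x = p * x) by (unfold p; field; trivial).
  assert (Hw0 : w <> 0) by lra.
  split.
  - unfold H. rewrite I1, I2, I3, I4, J1, J2, J3, J4. unfold A, B. rewrite Hy'.
    clear Hy'. clearbody p. field [E2 He]. auto.
  - unfold K. rewrite I4, J1, J2, J3, J4. unfold A, B. rewrite Hy'.
    clear Hy'. clearbody p. field [E2 He]. auto.
Qed.

(** * The profile of an axially symmetric immersion *)

Definition Cn3 (n : nat) (F : R -> R -> R3) (u v : R) : Prop :=
  Cn n (fun x y => x1 (F x y)) u v /\ Cn n (fun x y => x2 (F x y)) u v /\
  Cn n (fun x y => x3 (F x y)) u v.

Lemma C4_Cn3 D X u v : C4 D X -> Sigma D u v -> Cn3 4 X u v.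
Proof.
  intros HX HS. specialize (HX u v HS). unfold Cn3, Cn.
  split; [|split]; (eapply locally_2d_impl; [|exact HX]); apply locally_2d_forall; tauto.
Qed.

Lemma Cn3_d_u n X u v : Cn3 (S n) X u v -> Cn3 n (d_u X) u v.
Proof. intros (H1 & H2 & H3). apply Cn_Du in H1, H2, H3. exact (conj H1 (conj H2 H3)). Qed.

Lemma Cn3_d_v n X u v : Cn3 (S n) X u v -> Cn3 n (d_v X) u v.
Proof. intros (H1 & H2 & H3). apply Cn_Dv in H1, H2, H3. exact (conj H1 (conj H2 H3)). Qed.

Lemma Cn3_le m n X u v : (m <= n)%nat -> Cn3 n X u v -> Cn3 m X u v.
Proof. intros Hmn (H1 & H2 & H3). repeat split; now apply (Cn_le m n). Qed.

Lemma Cn_dot n F G u v : Cn3 n F u v -> Cn3 n G u v -> Cn n (fun x y => dot (F x y) (G x y)) u v.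
Proof.
  intros (A1 & A2 & A3) (B1 & B2 & B3). unfold dot.
  repeat apply Cn_plus; apply Cn_mult; assumption.
Qed.

Lemma Cn3_cross n F G u v : Cn3 n F u v -> Cn3 n G u v -> Cn3 n (fun x y => cross (F x y) (G x y)) u v.
Proof.
  intros (A1 & A2 & A3) (B1 & B2 & B3). unfold cross.
  split; [|split]; unfold x1, x2, x3 in *; simpl; apply Cn_minus; apply Cn_mult; assumption.
Qed.

Lemma dot_self_pos p : p <> (0, 0, 0) -> 0 < dot p p.
Proof.
  intros Hp. destruct p as [[a b] c]. unfold dot, x1, x2, x3; simpl.
  destruct (Req_dec a 0) as [->|Ha]; [destruct (Req_dec b 0) as [->|Hb];
    [destruct (Req_dec c 0) as [->|Hc]|]|]; [congruence|nra..].
Qed.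

Lemma Cn_area n X u v : Cn3 (S n) X u v -> cross (d_u X u v) (d_v X u v) <> (0, 0, 0) ->
  Cn n (area_density X) u v.
Proof.
  intros HX H0. unfold area_density, norm3.
  apply (Cn_sqrt n (fun x y => dot (cross (d_u X x y) (d_v X x y)) (cross (d_u X x y) (d_v X x y)))).
  - pose proof (Cn3_cross n _ _ u v (Cn3_d_u n X u v HX) (Cn3_d_v n X u v HX)) as HC.
    exact (Cn_dot n _ _ u v HC HC).
  - now apply dot_self_pos.
Qed.

Lemma area_pos X u v : cross (d_u X u v) (d_v X u v) <> (0, 0, 0) -> 0 < area_density X u v.
Proof. intros H0. apply sqrt_lt_R0. now apply dot_self_pos. Qed.

(** With [Cn_H_K], this gives the continuity up to the boundary and across the
    axis that extends identities from the punctured interior to all of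
    [Sigma]. *)
Lemma Cn3_nu n X u v : Cn3 (S n) X u v -> cross (d_u X u v) (d_v X u v) <> (0, 0, 0) ->
  Cn3 n (nu X) u v.
Proof.
  intros HX H0.
  assert (HA : Cn n (fun x y => / area_density X x y) u v).
  { apply Cn_inv; [now apply Cn_area|]. now apply Rgt_not_eq, area_pos. }
  assert (HC : Cn3 n (fun x y => cross (d_u X x y) (d_v X x y)) u v).
  { exact (Cn3_cross n _ _ u v (Cn3_d_u n X u v HX) (Cn3_d_v n X u v HX)). }
  destruct HC as (C1 & C2 & C3).
  split; [|split]; apply Cn_mult; assumption.
Qed.

Lemma det_I_area X u v : det_I X u v = area_density X u v ^ 2.
Proof.
  unfold area_density, norm3. rewrite pow2_sqrt.
  - unfold det_I, I_uu, I_uv, I_vv, cross, dot, x1, x2, x3; simpl. ring.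
  - unfold dot. nra.
Qed.

Lemma Cn_H_K X u v : Cn3 4 X u v -> cross (d_u X u v) (d_v X u v) <> (0, 0, 0) ->
  Cn 2 (H X) u v /\ Cn 2 (K X) u v.
Proof.
  intros HX H0.
  pose proof (Cn3_d_u _ _ _ _ (Cn3_nu _ _ _ _ HX H0)) as HNu.
  pose proof (Cn3_d_v _ _ _ _ (Cn3_nu _ _ _ _ HX H0)) as HNv.
  assert (HU : Cn3 2 (d_u X) u v) by (apply Cn3_d_u; apply (Cn3_le 3 4); auto).
  assert (HV : Cn3 2 (d_v X) u v) by (apply Cn3_d_v; apply (Cn3_le 3 4); auto).
  pose proof (Cn_dot _ _ _ _ _ HU HU) as I1. pose proof (Cn_dot _ _ _ _ _ HU HV) as I2.
  pose proof (Cn_dot _ _ _ _ _ HV HV) as I3.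
  pose proof (Cn_opp _ _ _ _ (Cn_dot _ _ _ _ _ HNu HU)) as J1.
  pose proof (Cn_opp _ _ _ _ (Cn_dot _ _ _ _ _ HNu HV)) as J2.
  pose proof (Cn_opp _ _ _ _ (Cn_dot _ _ _ _ _ HNv HU)) as J3.
  pose proof (Cn_opp _ _ _ _ (Cn_dot _ _ _ _ _ HNv HV)) as J4.
  change (Cn 2 (I_uu X) u v) in I1. change (Cn 2 (I_uv X) u v) in I2.
  change (Cn 2 (I_vv X) u v) in I3. change (Cn 2 (II_uu X) u v) in J1.
  change (Cn 2 (II_uv X) u v) in J2. change (Cn 2 (II_vu X) u v) in J3.
  change (Cn 2 (II_vv X) u v) in J4.
  assert (HD : det_I X u v <> 0).
  { rewrite det_I_area. apply Rgt_not_eq, pow_lt, area_pos, H0. }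
  assert (ID : Cn 2 (det_I X) u v).
  { unfold det_I. apply Cn_minus; [now apply Cn_mult|now apply Cn_pow]. }
  split.
  - unfold H. apply (Cn_div 2 (fun u v => I_vv X u v * II_uu X u v - I_uv X u v * (II_uv X u v + II_vu X u v)
   + I_uu X u v * II_vv X u v) (fun u v => 2 * det_I X u v)).
    + apply Cn_plus; [apply Cn_minus|]; apply Cn_mult; trivial. now apply Cn_plus.
    + apply Cn_mult; [apply Cn_const|trivial].
    + lra.
  - unfold K. apply (Cn_div 2 (fun u v => II_uu X u v * II_vv X u v - II_uv X u v * II_vu X u v) (det_I X)); trivial.
    apply Cn_minus; now apply Cn_mult.
Qed.

Definition has_profile (D : model) (X : R -> R -> R3) (s e : R) (r z : R -> R) : Prop :=
  (forall x th, inner_radius D <= x <= 1 ->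
    X (x * cos th) (x * sin th) = (s * r x * cos th, e * (s * r x * sin th), z x)) /\
  (forall x, inner_radius D <= x <= 1 -> 0 < x -> regular r z x).

Lemma inner_radius_bounds D : 0 <= inner_radius D < 1.
Proof. destruct D; simpl; lra. Qed.

Lemma Sigma_polar D x th : inner_radius D <= x <= 1 -> Sigma D (x * cos th) (x * sin th).
Proof.
  intros Hx. pose proof (inner_radius_bounds D). unfold Sigma.
  change (inner_radius D <= rho (x * cos th) (x * sin th) <= 1). rewrite rho_polar; lra.
Qed.

Lemma Sigma_axis D x : inner_radius D <= x <= 1 -> Sigma D x 0.
Proof.
  intros Hx. pose proof (Sigma_polar D x 0 Hx) as HS.
  now rewrite cos_0, sin_0, Rmult_1_r, Rmult_0_r in HS.
Qed.

Lemma off_axis D x : inner_radius D <= x <= 1 -> 0 < x ->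
  exists lo, inner_radius D <= lo /\ 0 < lo < 1 /\ lo <= x.
Proof.
  intros Hx H0. pose proof (inner_radius_bounds D) as Hb.
  destruct D; simpl in *; [exists (x / 2)|exists (/ 2)]; lra.
Qed.

(** On the outer circle the line along which [d_v] differentiates leaves
    [Sigma], and the symmetry determines the derivative only as a limit of
    values inside. *)
Lemma axis_derivatives D X x e (xf zf : R -> R) :
  immersion D X ->
  (forall y th, inner_radius D <= y <= 1 ->
      X (y * cos th) (y * sin th) = (xf y * cos th, e * (xf y * sin th), zf y)) ->
  xf = (fun y => x1 (X y 0)) -> zf = (fun y => x3 (X y 0)) ->
  inner_radius D <= x <= 1 -> 0 < x ->
  d_u X x 0 = (Derive xf x, 0, Derive zf x) /\ d_v X x 0 = (0, e * (xf x / x), 0).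
Proof.
  intros [HX _] Hsym Ex Ez Hx Hx0. pose proof (inner_radius_bounds D) as Hb.
  assert (HR : rotational 1 e xf zf (inner_radius D) 1 X).
  { apply rotational_of_polar; [lra|]. intros y th Hy. rewrite Hsym by lra.
    apply vec_eq; unfold x1, x2, x3; simpl; ring. }
  assert (HC : forall y, inner_radius D <= y <= 1 -> Cn3 4 X y 0).
  { intros y Hy. apply (C4_Cn3 D); trivial. now apply Sigma_axis. }
  assert (Hcu : forall y, inner_radius D <= y <= 1 -> Cn3 3 (d_u X) y 0)
    by (intros; apply Cn3_d_u; auto).
  assert (Hcv : forall y, inner_radius D <= y <= 1 -> Cn3 3 (d_v X) y 0)
    by (intros; apply Cn3_d_v; auto).
  assert (HI : forall y, inner_radius D < y < 1 ->
     d_u X y 0 = (Derive xf y, 0, Derive zf y) /\ d_v X y 0 = (0, e * (xf y / y), 0)).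
  { intros y Hy. destruct (HC y) as (D1 & _ & D3); [lra|].
    destruct (rot_derivatives _ _ _ _ _ _ _ y 0 HR ltac:(lra) ltac:(lra) (Derive xf y) (Derive zf y)) as [U V].
    - rewrite Ex. apply Derive_correct. apply (Cn_ex_derive_u 3 _ _ _ D1).
    - rewrite Ez. apply Derive_correct. apply (Cn_ex_derive_u 3 _ _ _ D3).
    - rewrite cos_0, sin_0, Rmult_1_r, Rmult_0_r in U, V. rewrite U, V.
      split; apply vec_eq; unfold x1, x2, x3; simpl; ring. }
  destruct (off_axis D x Hx Hx0) as (lo & L1 & L2 & L3).
  assert (Hslice : forall (G : R -> R -> R3) (pr : R3 -> R),
     (forall y, inner_radius D <= y <= 1 -> Cn 3 (fun u v => pr (G u v)) y 0) ->
     forall y, lo <= y <= 1 -> continuous (fun y => pr (G y 0)) y).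
  { intros G pr HG y Hy. apply (continuous_slice_u (fun u v => pr (G u v))).
    apply (Cn_continuity 3), HG. lra. }
  split.
  - apply vec_eq.
    + change (x1 (d_u X x 0) = Derive xf x). rewrite Ex. reflexivity.
    + change (x2 (d_u X x 0) = 0).
      apply (eq_closed_interval (fun y => x2 (d_u X y 0)) (fun _ => 0) lo 1); try lra.
      * apply Hslice. intros y Hy. exact (proj1 (proj2 (Hcu y Hy))).
      * intros; apply continuous_const.
      * intros y Hy. rewrite (proj1 (HI y ltac:(lra))). reflexivity.
    + change (x3 (d_u X x 0) = Derive zf x). rewrite Ez. reflexivity.
  - apply vec_eq.
    + change (x1 (d_v X x 0) = 0).
      apply (eq_closed_interval (fun y => x1 (d_v X y 0)) (fun _ => 0) lo 1); try lra.
      * apply Hslice. intros y Hy. exact (proj1 (Hcv y Hy)).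
      * intros; apply continuous_const.
      * intros y Hy. rewrite (proj2 (HI y ltac:(lra))). reflexivity.
    + change (x2 (d_v X x 0) = e * (xf x / x)).
      apply (eq_closed_interval (fun y => x2 (d_v X y 0)) (fun y => e * (xf y / y)) lo 1); try lra.
      * apply Hslice. intros y Hy. exact (proj1 (proj2 (Hcv y Hy))).
      * intros y Hy. apply (Cn_1d_continuous 4 (fun y => e * (xf y / y))).
        apply (Cn_mult 4 (fun _ _ => e)); [apply Cn_const|].
        apply (Cn_div 4 (fun _ => xf) (fun _ y => y)); [|apply Cn_snd|lra].
        rewrite Ex. exact (Cn_axis_slice 4 (fun u v => x1 (X u v)) y 0 0 (proj1 (HC y ltac:(lra)))).
      * intros y Hy. rewrite (proj2 (HI y ltac:(lra))). reflexivity.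
    + change (x3 (d_v X x 0) = 0).
      apply (eq_closed_interval (fun y => x3 (d_v X y 0)) (fun _ => 0) lo 1); try lra.
      * apply Hslice. intros y Hy. exact (proj2 (proj2 (Hcv y Hy))).
      * intros; apply continuous_const.
      * intros y Hy. rewrite (proj2 (HI y ltac:(lra))). reflexivity.
Qed.

(** On the half-line v = 0 the cross product of the partial derivatives is
    (x / rho) (- e z', 0, e x'), for the profile (x, z) of the symmetry
    hypothesis: immersivity says that x does not vanish off the axis and that
    the profile is regular.  By the intermediate value theorem x has a constant
    sign s. *)
Lemma profile_exists D X : immersion D X -> axially_symmetric D X ->
  exists s e r z, (s = 1 \/ s = -1) /\ (e = 1 \/ e = - 1) /\ has_profile D X s e r z.
Proof.
  intros HX (x & z & e & He & Hsym). pose proof (inner_radius_bounds D) as Hb.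
  set (xf := fun y => x1 (X y 0)). set (zf := fun y => x3 (X y 0)).
  assert (Hsym' : forall y th, inner_radius D <= y <= 1 ->
      X (y * cos th) (y * sin th) = (xf y * cos th, e * (xf y * sin th), zf y)).
  { intros y th Hy. assert (E := Hsym y 0 Hy). rewrite cos_0, sin_0, !Rmult_1_r, !Rmult_0_r in E.
    unfold xf, zf. rewrite E, Hsym by trivial. reflexivity. }
  assert (HA : forall y, inner_radius D <= y <= 1 -> 0 < y ->
      Cn_1d 4 xf y /\ Cn_1d 4 zf y /\ xf y <> 0 /\ 0 < Derive xf y ^ 2 + Derive zf y ^ 2).
  { intros y Hy Hy0. pose proof HX as [HX4 HX0].
    destruct (C4_Cn3 D X y 0 HX4 (Sigma_axis D y Hy)) as (C1 & _ & C3).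
    split; [exact (Cn_axis_slice 4 _ y 0 0 C1)|]. split; [exact (Cn_axis_slice 4 _ y 0 0 C3)|].
    specialize (HX0 y 0 (Sigma_axis D y Hy)).
    destruct (axis_derivatives D X y e xf zf HX Hsym' eq_refl eq_refl Hy Hy0) as [U V].
    rewrite U, V in HX0. split.
    - intros E. apply HX0. rewrite E. unfold cross; apply vec_eq; unfold x1, x2, x3; simpl; field; lra.
    - destruct (Req_dec (Derive xf y) 0) as [E1|E1]; [destruct (Req_dec (Derive zf y) 0) as [E2|E2]|].
      + exfalso. apply HX0. rewrite E1, E2. unfold cross; apply vec_eq; unfold x1, x2, x3; simpl; ring.
      + nra.
      + nra. }
  assert (Hs : exists s, (s = 1 \/ s = -1) /\ 0 < s * xf 1).
  { destruct (HA 1) as (_ & _ & H1 & _); [lra|lra|].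
    destruct (Rlt_dec 0 (xf 1)); [exists 1|exists (-1)]; split; auto; lra. }
  destruct Hs as (s & Hs & Hs1).
  assert (Hpos : forall y, inner_radius D <= y <= 1 -> 0 < y -> 0 < s * xf y).
  { intros y Hy Hy0. destruct (Rtotal_order 0 (s * xf y)) as [|[E|N]]; trivial; exfalso.
    - destruct (HA y Hy Hy0) as (_ & _ & H1 & _). symmetry in E.
      apply Rmult_integral in E. destruct E; [destruct Hs; lra|tauto].
    - destruct (Rle_lt_or_eq_dec y 1 (proj2 Hy)) as [Hy1| ->]; [|lra].
      destruct (IVT_interv (fun y => s * xf y) y 1) as (t & Ht & E); trivial.
      + intros t Ht. apply continuity_pt_filterlim.
        apply (continuous_mult (fun _ => s) xf); [apply continuous_const|].
        exact (Cn_1d_continuous 4 xf t (proj1 (HA t ltac:(lra) ltac:(lra)))).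
      + destruct (HA t) as (_ & _ & H1 & _); [lra|lra|].
        apply Rmult_integral in E. destruct E; [destruct Hs; lra|tauto]. }
  exists s, e, (fun y => s * xf y), zf. split; [exact Hs|]. split; [exact He|]. split.
  - intros y th Hy. rewrite Hsym' by trivial.
    apply vec_eq; unfold x1, x2, x3; simpl; destruct Hs as [->| ->]; ring.
  - intros y Hy Hy0. destruct (HA y Hy Hy0) as (C1 & C3 & _ & Hw). split; [|split; [|split]].
    + apply (Cn_mult 4 (fun _ _ => s)); [apply Cn_const|exact C1].
    + exact C3.
    + now apply Hpos.
    + rewrite Derive_scal. destruct Hs as [->| ->]; nra.
Qed.

Lemma has_profile_rotational D X s e r z :
  has_profile D X s e r z -> rotational s e r z (inner_radius D) 1 X.
Proof.
  intros [Hsym _]. pose proof (inner_radius_bounds D).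
  apply rotational_of_polar; [lra|]. intros x th Hx. apply Hsym; lra.
Qed.

Lemma sign_sqr s : s = 1 \/ s = - 1 -> s ^ 2 = 1.
Proof. intros [->| ->]; ring. Qed.

(** Inside the surface this is [rot_area_nu] and [rot_curvatures]; both sides
    are continuous up to the boundary. *)
Lemma closed_geometry D X s e r z x th :
  immersion D X -> (s = 1 \/ s = - 1) -> (e = 1 \/ e = - 1) -> has_profile D X s e r z ->
  inner_radius D <= x <= 1 -> 0 < x ->
  nu X (x * cos th) (x * sin th) =
    (s * (- e * psin r z x) * cos th, e * (s * (- e * psin r z x) * sin th), e * pcos r z x) /\
  H X (x * cos th) (x * sin th) = e * (pcurv r z x + psin r z x / r x) / 2 /\
  K X (x * cos th) (x * sin th) = pcurv r z x * psin r z x / r x.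
Proof.
  intros [HX HI] Hs He HP Hx Hx0. pose proof (inner_radius_bounds D) as Hb.
  apply sign_sqr in Hs, He.
  pose proof (has_profile_rotational _ _ _ _ _ _ HP) as HR. destruct HP as [_ HP].
  destruct (off_axis D x Hx Hx0) as (lo & L1 & L2 & L3).
  assert (HS : forall y, lo <= y <= 1 -> Sigma D (y * cos th) (y * sin th))
    by (intros; apply Sigma_polar; lra).
  assert (HRg : forall y, lo <= y <= 1 -> regular r z y) by (intros; apply HP; lra).
  assert (HRo : forall y, inner_radius D < y < 1 -> regular r z y) by (intros; apply HP; lra).
  assert (HN : forall y, lo <= y <= 1 -> Cn3 3 (nu X) (y * cos th) (y * sin th)).
  { intros y Hy. apply Cn3_nu; [now apply (C4_Cn3 D), HS|now apply HI, HS]. }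
  assert (HHK : forall y, lo <= y <= 1 -> Cn 2 (H X) (y * cos th) (y * sin th) /\ Cn 2 (K X) (y * cos th) (y * sin th)).
  { intros y Hy. apply Cn_H_K; [now apply (C4_Cn3 D), HS|now apply HI, HS]. }
  assert (CS : forall y a, lo <= y <= 1 -> continuous (fun y => a * psin r z y) y).
  { intros y a Hy. apply (continuous_mult (fun _ => a) (psin r z)); [apply continuous_const|].
    apply (Cn_1d_continuous 3), Cn_1d_psin; auto. }
  assert (HAN : forall y, lo < y < 1 -> nu X (y * cos th) (y * sin th) =
    (s * (- e * psin r z y) * cos th, e * (s * (- e * psin r z y) * sin th), e * pcos r z y)).
  { intros y Hy. apply (rot_area_nu s e r z (inner_radius D) 1 X y th Hs He HR); try lra.
    apply HRo; lra. }
  assert (HCK : forall y, lo < y < 1 ->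
     H X (y * cos th) (y * sin th) = e * (pcurv r z y + psin r z y / r y) / 2 /\
     K X (y * cos th) (y * sin th) = pcurv r z y * psin r z y / r y).
  { intros y Hy. apply (rot_curvatures s e r z (inner_radius D) 1 X y th Hs He HR); try lra.
    exact HRo. }
  split; [|split].
  - apply vec_eq.
    + change (x1 (nu X (x * cos th) (x * sin th)) = s * (- e * psin r z x) * cos th).
      apply (eq_closed_interval (fun y => x1 (nu X (y * cos th) (y * sin th)))
        (fun y => s * (- e * psin r z y) * cos th) lo 1); try lra.
      * intros y Hy. exact (continuous_ray 3 (fun u v => x1 (nu X u v)) y th (proj1 (HN y Hy))).
      * intros y Hy. apply (continuous_ext (fun y => (s * - e * cos th) * psin r z y)); [intros; Rring|auto].
      * intros y Hy. now rewrite HAN.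
    + change (x2 (nu X (x * cos th) (x * sin th)) = e * (s * (- e * psin r z x) * sin th)).
      apply (eq_closed_interval (fun y => x2 (nu X (y * cos th) (y * sin th)))
        (fun y => e * (s * (- e * psin r z y) * sin th)) lo 1); try lra.
      * intros y Hy. exact (continuous_ray 3 (fun u v => x2 (nu X u v)) y th (proj1 (proj2 (HN y Hy)))).
      * intros y Hy. apply (continuous_ext (fun y => (e * s * - e * sin th) * psin r z y)); [intros; Rring|auto].
      * intros y Hy. now rewrite HAN.
    + change (x3 (nu X (x * cos th) (x * sin th)) = e * pcos r z x).
      apply (eq_closed_interval (fun y => x3 (nu X (y * cos th) (y * sin th)))
        (fun y => e * pcos r z y) lo 1); try lra.
      * intros y Hy. exact (continuous_ray 3 (fun u v => x3 (nu X u v)) y th (proj2 (proj2 (HN y Hy)))).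
      * intros y Hy. apply (continuous_mult (fun _ => e) (pcos r z)); [apply continuous_const|].
        apply (Cn_1d_continuous 3), Cn_1d_pcos; auto.
      * intros y Hy. now rewrite HAN.
  - apply (eq_closed_interval (fun y => H X (y * cos th) (y * sin th))
        (fun y => e * (pcurv r z y + psin r z y / r y) / 2) lo 1); try lra.
    + intros y Hy. apply (continuous_ray 2 (H X)), HHK; lra.
    + intros y Hy. apply (continuous_ext (shiftedH 0 e r z)); [intros; unfold shiftedH; Rring|].
      apply (Cn_1d_continuous 2), Cn_1d_shiftedH; auto.
    + intros y Hy. apply (HCK y Hy).
  - apply (eq_closed_interval (fun y => K X (y * cos th) (y * sin th))
        (fun y => pcurv r z y * psin r z y / r y) lo 1); try lra.
    + intros y Hy. apply (continuous_ray 2 (K X)), HHK; lra.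
    + intros y Hy. specialize (HRg y Hy). apply (Cn_1d_continuous 2).
      apply (Cn_div 2 (fun _ y => pcurv r z y * psin r z y) (fun _ => r)).
      * apply (Cn_mult 2 (fun _ => pcurv r z) (fun _ => psin r z)); [now apply Cn_1d_pcurv|].
        now apply Cn_pred, Cn_1d_psin.
      * apply Cn_pred, Cn_pred, HRg.
      * apply Rgt_not_eq, HRg.
    + intros y Hy. apply (HCK y Hy).
Qed.

(** * Boundary circles *)

Definition circle_bdry (s e d z : R) (Y : R -> R -> R3) (c : component) : Prop :=
  forall th, on_bdry Y c th = (s * d * cos th, e * (s * d * sin th), z).

Lemma orient_sqr c : orient c * orient c = 1.
Proof. destruct c; simpl; ring. Qed.

Lemma vDerive_is c t a1 a2 a3 :
  is_derive (fun s => x1 (c s)) t a1 -> is_derive (fun s => x2 (c s)) t a2 ->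
  is_derive (fun s => x3 (c s)) t a3 -> vDerive c t = (a1, a2, a3).
Proof.
  intros H1 H2 H3. unfold vDerive.
  apply vec_eq; apply is_derive_unique; assumption.
Qed.

Lemma vDerive_ext (c d : R -> R3) t : (forall s, c s = d s) -> vDerive c t = vDerive d t.
Proof.
  intros H. unfold vDerive.
  rewrite (Derive_ext _ (fun s => x1 (d s))), (Derive_ext (fun s => x2 (c s)) (fun s => x2 (d s))),
    (Derive_ext (fun s => x3 (c s)) (fun s => x3 (d s))); trivial; intros; now rewrite H.
Qed.

Lemma circle_velocity s e d z Y c th : circle_bdry s e d z Y c ->
  vDerive (on_bdry Y c) th = (- s * d * sin th, e * (s * d * cos th), 0).
Proof.
  intros H. rewrite (vDerive_ext _ _ th H).
  apply vDerive_is; unfold x1, x2, x3; simpl; auto_derive; trivial; Rring.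
Qed.

Lemma circle_speed s e d z Y c th : s ^ 2 = 1 -> e ^ 2 = 1 -> 0 < d ->
  circle_bdry s e d z Y c -> speed Y c th = d.
Proof.
  intros Hs He HR H. unfold speed. rewrite (circle_velocity _ _ _ _ _ _ _ H).
  unfold norm3. transitivity (sqrt (d ^ 2)); [f_equal|apply sqrt_pow2; lra].
  pose proof (sin2_cos2 th) as E. unfold Rsqr in E.
  assert (E2 : cos th ^ 2 = 1 - sin th ^ 2) by lra.
  unfold dot, x1, x2, x3; simpl. ring [E2 Hs He].
Qed.

Lemma circle_tangent s e d z Y c th : s ^ 2 = 1 -> e ^ 2 = 1 -> 0 < d ->
  circle_bdry s e d z Y c ->
  tangent Y c th = (- (orient c * s * sin th), orient c * e * s * cos th, 0).
Proof.
  intros Hs He HR H. unfold tangent, d_s.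
  rewrite (circle_speed _ _ _ _ _ _ _ Hs He HR H), (circle_velocity _ _ _ _ _ _ _ H).
  unfold vscale. apply vec_eq; unfold x1, x2, x3; simpl; field; lra.
Qed.

Lemma circle_dtangent s e d z Y c th : s ^ 2 = 1 -> e ^ 2 = 1 -> 0 < d ->
  circle_bdry s e d z Y c ->
  dtangent Y c th = (- s * cos th / d, - e * s * sin th / d, 0).
Proof.
  intros Hs He HR H. unfold dtangent, d_s.
  rewrite (circle_speed _ _ _ _ _ _ _ Hs He HR H).
  rewrite (vDerive_ext _ _ th (fun t => circle_tangent _ _ _ _ _ _ t Hs He HR H)).
  rewrite (vDerive_is _ th (- (orient c * s * cos th)) (- (orient c * e * s * sin th)) 0).
  - pose proof (orient_sqr c) as Ho. assert (Ho2 : orient c ^ 2 = 1) by (simpl; lra).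
    unfold vscale. apply vec_eq; unfold x1, x2, x3; simpl; field [Ho2]; lra.
  - unfold x1; simpl; auto_derive; trivial; Rring.
  - unfold x2; simpl; auto_derive; trivial; Rring.
  - unfold x3; simpl; apply @is_derive_const.
Qed.

Lemma circle_kappa s e d z Y c th : s ^ 2 = 1 -> e ^ 2 = 1 -> 0 < d ->
  circle_bdry s e d z Y c -> kappa Y c th = / d.
Proof.
  intros Hs He HR H. unfold kappa. rewrite (circle_dtangent _ _ _ _ _ _ _ Hs He HR H).
  unfold norm3. transitivity (sqrt ((/ d) ^ 2)); [f_equal|apply sqrt_pow2; left; now apply Rinv_0_lt_compat].
  pose proof (sin2_cos2 th) as E. unfold Rsqr in E.
  assert (E2 : cos th ^ 2 = 1 - sin th ^ 2) by lra.
  unfold dot, x1, x2, x3; simpl. field [E2 Hs He]. lra.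
Qed.

Lemma circle_int_bdry alpha beta s e d z Y c : s ^ 2 = 1 -> e ^ 2 = 1 -> 0 < d ->
  circle_bdry s e d z Y c ->
  int_bdry Y c (fun th => alpha * kappa Y c th ^ 2 + beta) = 2 * PI * (alpha / d + beta * d).
Proof.
  intros Hs He HR H. unfold int_bdry.
  rewrite (RInt_ext _ (fun _ => (alpha * (/ d) ^ 2 + beta) * d)).
  - rewrite RInt_const. unfold scal; simpl; unfold mult; simpl. field. lra.
  - intros th _. now rewrite (circle_speed _ _ _ _ _ _ _ Hs He HR H), (circle_kappa _ _ _ _ _ _ _ Hs He HR H).
Qed.

(** T' points to the axis and has norm 1 / d, and when (C, S) is the unit
    tangent of the profile, the conormal is its rotation, up to the sign
    [orient c]. *)
Lemma circle_kappa_n_g s e d z Y c th S C : s ^ 2 = 1 -> e ^ 2 = 1 -> 0 < d ->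
  circle_bdry s e d z Y c ->
  on_bdry (nu Y) c th = (s * (- e * S) * cos th, e * (s * (- e * S) * sin th), e * C) ->
  kappa_n Y c th = e * S / d /\ kappa_g Y c th = - orient c * C / d.
Proof.
  intros Hs He HR H HN.
  pose proof (sin2_cos2 th) as E. unfold Rsqr in E.
  assert (E2 : cos th ^ 2 = 1 - sin th ^ 2) by lra.
  unfold kappa_n, kappa_g, conormal.
  rewrite (circle_dtangent _ _ _ _ _ _ _ Hs He HR H), (circle_tangent _ _ _ _ _ _ _ Hs He HR H), HN.
  unfold cross, dot, x1, x2, x3; simpl. split; field [E2 Hs He]; lra.
Qed.

(** * The energy of a rotational variation *)

Definition rot_field (s e : R) (f g : R -> R) (u v : R) : R3 :=
  (s * (u * f (u ^ 2 + v ^ 2)), e * (s * (v * f (u ^ 2 + v ^ 2))), g (u ^ 2 + v ^ 2)).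

Lemma C4_rot_field D s e f g : is_bump f -> is_bump g -> C4 D (rot_field s e f g).
Proof.
  intros (l1 & l2 & m1 & m2 & P1 & Q1 & ->) (l3 & l4 & m3 & m4 & P2 & Q2 & ->) u v _.
  assert (Hq : Cn 4 (fun x y => x ^ 2 + y ^ 2) u v).
  { apply Cn_plus; apply Cn_pow; [apply Cn_fst|apply Cn_snd]. }
  pose proof (Cn_bump l1 l2 m1 m2 P1 Q1 _ u v Hq) as Hf.
  pose proof (Cn_bump l3 l4 m3 m4 P2 Q2 _ u v Hq) as Hg.
  pose proof (Cn_mult 4 _ _ u v (Cn_fst 4 u v) Hf) as Hu.
  pose proof (Cn_mult 4 _ _ u v (Cn_snd 4 u v) Hf) as Hv.
  pose proof (Cn_mult 4 _ _ u v (Cn_const 4 s u v) Hu) as H1.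
  pose proof (Cn_mult 4 _ _ u v (Cn_const 4 e u v) (Cn_mult 4 _ _ u v (Cn_const 4 s u v) Hv)) as H2.
  apply locally_2d_and; [exact H1|]. apply locally_2d_and; [exact H2|exact Hg].
Qed.

Definition along (r xi : R -> R) (t x : R) : R := r x + t * xi x.

Lemma variation_polar D X s e r z f g t x th :
  has_profile D X s e r z -> inner_radius D <= x <= 1 ->
  vadd (X (x * cos th) (x * sin th)) (vscale t (rot_field s e f g (x * cos th) (x * sin th))) =
  (s * along r (radial_test f) t x * cos th, e * (s * along r (radial_test f) t x * sin th),
   along z (vertical_test g) t x).
Proof.
  intros [HP _] Hx. rewrite HP by trivial.
  pose proof (sin2_cos2 th) as E. unfold Rsqr in E.
  unfold rot_field. replace ((x * cos th) ^ 2 + (x * sin th) ^ 2) with (x ^ 2).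
  - unfold along, radial_test, vertical_test, vadd, vscale. apply vec_eq; unfold x1, x2, x3; simpl; ring.
  - replace ((x * cos th) ^ 2 + (x * sin th) ^ 2) with (x ^ 2 * (sin th * sin th + cos th * cos th)) by ring.
    rewrite E; ring.
Qed.

Lemma Cn_1d_along n r xi t x : Cn_1d n r x -> Cn_1d n xi x -> Cn_1d n (along r xi t) x.
Proof.
  intros Hr Hxi. apply (Cn_plus n (fun _ => r)); [exact Hr|].
  apply (Cn_mult n (fun _ _ => t)); [apply Cn_const|exact Hxi].
Qed.

Lemma Derive_along n r xi t x : Cn_1d (S n) r x -> Cn_1d (S n) xi x ->
  Derive (along r xi t) x = along (Derive r) (Derive xi) t x.
Proof.
  intros Hr Hxi. unfold along. rewrite Derive_plus, Derive_scal; trivial.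
  - now apply (Cn_1d_ex_derive n).
  - apply ex_derive_scal. now apply (Cn_1d_ex_derive n).
Qed.

Lemma Derive2_along r xi t x : Cn_1d 4 r x -> Cn_1d 4 xi x ->
  Derive (Derive (along r xi t)) x = along (Derive (Derive r)) (Derive (Derive xi)) t x.
Proof.
  intros Hr Hxi.
  rewrite (Derive_ext_loc _ (along (Derive r) (Derive xi) t)).
  - apply (Derive_along 2); now apply Cn_1d_Derive.
  - generalize (filter_and _ _ (Cn_1d_locally _ _ _ Hr) (Cn_1d_locally _ _ _ Hxi)).
    apply filter_imp. intros y [H1 H2]. now apply (Derive_along 3).
Qed.

Lemma regular_along r z xi eta t x :
  regular r z x -> Cn_1d 4 xi x -> Cn_1d 4 eta x -> nondegenerate_along r z xi eta t x ->
  regular (along r xi t) (along z eta t) x.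
Proof.
  intros (Hr & Hz & _ & _) Hxi Heta (A1 & A2).
  split; [now apply Cn_1d_along|]. split; [now apply Cn_1d_along|]. split; [exact A1|].
  rewrite !(Derive_along 3) by trivial. exact A2.
Qed.

Definition energy_density a b c e r z x : R :=
  (a * shiftedH c e r z x ^ 2 + b * (pcurv r z x * psin r z x / r x)) * (r x * pspeed r z x).

Lemma energy_density_along a b c e r z xi eta t x :
  Cn_1d 4 r x -> Cn_1d 4 z x -> Cn_1d 4 xi x -> Cn_1d 4 eta x ->
  energy_density a b c e (along r xi t) (along z eta t) x = density_along a b c e r z xi eta t x.
Proof.
  intros Hr Hz Hxi Heta. unfold energy_density, shiftedH, pcurv, psin, pspeed.
  rewrite !(Derive_along 3), !Derive2_along by trivial. reflexivity.
Qed.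

(** The integrand does not depend on the angle, and area_density x = r w. *)
Lemma rotational_integrand a b c s e y zt lo Y x :
  s ^ 2 = 1 -> e ^ 2 = 1 -> rotational s e y zt lo 1 Y -> 0 <= lo < x -> x < 1 ->
  (forall x, lo < x < 1 -> regular y zt x) ->
  RInt (fun th => (a * (H Y (x * cos th) (x * sin th) + c) ^ 2 + b * K Y (x * cos th) (x * sin th))
        * area_density Y (x * cos th) (x * sin th) * x) 0 (2 * PI)
  = 2 * PI * energy_density a b c e y zt x.
Proof.
  intros Hs He HY Hlo Hx HR.
  rewrite (RInt_ext _ (fun _ => energy_density a b c e y zt x)).
  - rewrite RInt_const. unfold scal; simpl; unfold mult; simpl. ring.
  - intros th _. destruct (rot_curvatures _ _ _ _ _ _ Y x th Hs He HY Hlo Hx HR) as [-> ->].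
    destruct (rot_area_nu _ _ _ _ _ _ Y x th Hs He HY Hlo Hx (HR x ltac:(lra))) as [HA _].
    unfold energy_density, shiftedH. rewrite <- HA. Rring.
Qed.

Lemma radius_bounds D c : In c (boundary D) -> inner_radius D <= radius c <= 1 /\ 0 < radius c.
Proof. destruct D; simpl; intros HI; [destruct HI as [<-|[]]|destruct HI as [<-|[<-|[]]]]; simpl; lra. Qed.

Lemma energy_rotational a b c alpha beta D Y s e y zt :
  s ^ 2 = 1 -> e ^ 2 = 1 ->
  (forall x th, inner_radius D <= x <= 1 ->
    Y (x * cos th) (x * sin th) = (s * y x * cos th, e * (s * y x * sin th), zt x)) ->
  (forall x, inner_radius D < x < 1 -> regular y zt x) ->
  (forall c, In c (boundary D) -> 0 < y (radius c)) ->
  ex_RInt (energy_density a b c e y zt) (inner_radius D) 1 ->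
  energy a c b alpha beta D Y =
  2 * PI * RInt (energy_density a b c e y zt) (inner_radius D) 1
  + fold_right Rplus 0 (map (fun k => 2 * PI * (alpha / y (radius k) + beta * y (radius k))) (boundary D)).
Proof.
  intros Hs He HY HR Hb HI. pose proof (inner_radius_bounds D) as Hin.
  assert (Hrot : rotational s e y zt (inner_radius D) 1 Y).
  { apply rotational_of_polar; [lra|]. intros x th Hx. apply HY; lra. }
  unfold energy. f_equal.
  - unfold int_Sigma.
    rewrite (RInt_ext _ (fun x => 2 * PI * energy_density a b c e y zt x)).
    + now apply (RInt_scal (V := R_CompleteNormedModule)).
    + rewrite Rmin_left, Rmax_right by lra. intros x Hx.
      apply (rotational_integrand a b c s e y zt (inner_radius D)); trivial; lra.
  - f_equal. apply map_ext_in. intros k Hk. destruct (radius_bounds D k Hk) as [H1 H2].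
    apply (circle_int_bdry alpha beta s e _ (zt (radius k))); auto.
    intros th. unfold on_bdry. now apply HY.
Qed.

(** * Criticality for rotational variations *)

(** The derivative of alpha / d + beta d, which is 1 / (2 pi) times the energy
    of a circle of radius d. *)
Definition tension (alpha beta d : R) : R := beta - alpha / d ^ 2.

Lemma is_derive_circle_energy alpha beta d xi : 0 < d ->
  is_derive (fun t => 2 * PI * (alpha / (d + t * xi) + beta * (d + t * xi))) 0
    (2 * PI * (tension alpha beta d * xi)).
Proof.
  intros Hd. eapply is_derive_eq.
  - auto_derive; [|reflexivity]. rewrite Rmult_0_l, Rplus_0_r. lra.
  - rewrite Rmult_0_l, Rplus_0_r. unfold tension. field. lra.
Qed.

(** The expression of the density in terms of the profile is singular on the
    axis; its integrability comes from the continuity of H, K and the area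
    density of the surface there. *)
Lemma ex_RInt_near_axis a b c D X s e r z lo :
  immersion D X -> (s = 1 \/ s = - 1) -> (e = 1 \/ e = - 1) -> has_profile D X s e r z ->
  inner_radius D <= lo <= 1 ->
  ex_RInt (energy_density a b c e r z) (inner_radius D) lo.
Proof.
  intros HX Hs He HP Hlo. pose proof (inner_radius_bounds D) as Hb.
  apply (ex_RInt_ext (fun x => (a * (H X x 0 + c) ^ 2 + b * K X x 0) * (area_density X x 0 * x))).
  - rewrite Rmin_left, Rmax_right by lra. intros x Hx.
    destruct (closed_geometry D X s e r z x 0 HX Hs He HP) as (_ & E1 & E2); try lra.
    assert (HA : area_density X (x * cos 0) (x * sin 0) * x = r x * pspeed r z x).
    { apply (rot_area_nu s e r z (inner_radius D) 1 X x 0); try lra.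
      - now apply sign_sqr.
      - now apply sign_sqr.
      - eapply has_profile_rotational; eassumption.
      - apply HP; lra. }
    rewrite cos_0, sin_0, Rmult_1_r, Rmult_0_r in E1, E2, HA.
    rewrite E1, E2, HA. unfold energy_density, shiftedH. Rring.
  - apply ex_RInt_of_continuous; [lra|]. intros x Hx.
    assert (HS : Sigma D x 0) by (apply Sigma_axis; lra).
    destruct HX as [HX HI]. pose proof (C4_Cn3 D X x 0 HX HS) as H4. specialize (HI x 0 HS).
    destruct (Cn_H_K X x 0 H4 HI) as [HH HK].
    pose proof (Cn_area 3 X x 0 H4 HI) as HA.
    apply (continuous_slice_u (fun x v => (a * (H X x v + c) ^ 2 + b * K X x v) * (area_density X x v * x))).
    apply (Cn_continuity 2). apply Cn_le with (n := 3%nat) (m := 2%nat) in HA; [|auto].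
    apply (Cn_mult 2 (fun x v => a * (H X x v + c) ^ 2 + b * K X x v) (fun x v => area_density X x v * x)).
    + apply (Cn_plus 2 (fun x v => a * (H X x v + c) ^ 2) (fun x v => b * K X x v)).
      * apply (Cn_mult 2 (fun _ _ => a)); [apply Cn_const|].
        apply (Cn_pow 2 2 (fun x v => H X x v + c)).
        apply (Cn_plus 2 (H X) (fun _ _ => c)); [exact HH|apply Cn_const].
      * apply (Cn_mult 2 (fun _ _ => b)); [apply Cn_const|exact HK].
    + apply (Cn_mult 2 (area_density X) (fun x _ => x)); [exact HA|apply Cn_fst].
Qed.

Definition inner_tension (alpha beta : R) (D : model) (r : R -> R) : R :=
  match D with Disc => 0 | Annulus => tension alpha beta (r (/ 2)) end.

(** On a disc the variations vanish near the axis, so that all the profiles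
    agree below [lo] and the one-dimensional theory is applied from [lo] to 1. *)
Definition supported (D : model) (lo : R) (f g : R -> R) : Prop :=
  match D with
  | Disc => 0 < lo /\ exists m, lo ^ 2 < m /\ zero_below f m /\ zero_below g m
  | Annulus => lo = / 2
  end.

Lemma supported_inner D lo f g : supported D lo f g -> inner_radius D <= lo.
Proof. destruct D; simpl; [lra|intros ->; lra]. Qed.

Lemma density_along_frozen D lo f g a b c e r z t x :
  supported D lo f g -> inner_radius D <= x < lo ->
  density_along a b c e r z (radial_test f) (vertical_test g) t x =
    density_along a b c e r z (radial_test f) (vertical_test g) 0 x /\
  radial_test f x = 0 /\ Derive (radial_test f) x = 0 /\ Derive (vertical_test g) x = 0.
Proof.
  destruct D; simpl; [|intros ->; lra].
  intros (H0 & m & Hm & Hf & Hg) Hx.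
  assert (Hxm : locally x (fun y => y ^ 2 < m)).
  { apply (sqr_near (fun q => q < m)).
    exists (mkposreal (m - x ^ 2) ltac:(nra)). intros y Hy.
    apply Rabs_lt_between in Hy. unfold minus, plus, opp in Hy; simpl in *. lra. }
  assert (HD : locally x (fun y => Derive (radial_test f) y = 0 /\ Derive (vertical_test g) y = 0)).
  { eapply filter_imp; [|exact Hxm]. intros y Hy.
    destruct (zero_below_jets f m y Hf Hy) as (_ & A1 & _ & _).
    destruct (zero_below_jets g m y Hg Hy) as (_ & _ & _ & A2). now split. }
  pose proof (locally_singleton _ _ Hxm) as Hx0. cbv beta in Hx0.
  destruct (zero_below_jets f m x Hf Hx0) as (A1 & A2 & _ & _).
  destruct (zero_below_jets g m x Hg Hx0) as (_ & _ & A3 & A4).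
  assert (A5 : Derive (Derive (radial_test f)) x = 0).
  { rewrite (Derive_ext_loc _ (fun _ => 0)); [apply Derive_const|].
    eapply filter_imp; [|exact HD]. tauto. }
  assert (A6 : Derive (Derive (vertical_test g)) x = 0).
  { rewrite (Derive_ext_loc _ (fun _ => 0)); [apply Derive_const|].
    eapply filter_imp; [|exact HD]. tauto. }
  split; [|now split].
  unfold density_along. rewrite A1, A2, A4, A5, A6. now rewrite !Rmult_0_r.
Qed.

(** For t near 0 the energy of X + t V is 2 pi times the sum of a constant,
    the integral of the density from [lo] to 1, and the energies of the
    boundary circles. *)
Lemma critical_variational_eq a b c alpha beta D X s e r z lo f g :
  immersion D X -> (s = 1 \/ s = - 1) -> (e = 1 \/ e = - 1) -> has_profile D X s e r z ->
  critical a c b alpha beta D X ->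
  is_bump f -> is_bump g -> supported D lo f g -> lo < 1 ->
  variational_eq a b c e r z lo 1 (inner_tension alpha beta D r) (tension alpha beta (r 1)) f g.
Proof.
  intros HX Hs He HP Hcrit Hf Hg Hsup Hlo1.
  pose proof (inner_radius_bounds D) as Hb. pose proof (supported_inner _ _ _ _ Hsup) as Hlo.
  assert (Hlo0 : 0 < lo) by (destruct D; simpl in Hsup; [apply Hsup|lra]).
  pose proof (sign_sqr _ Hs) as Hs2. pose proof (sign_sqr _ He) as He2.
  set (xi := radial_test f). set (eta := vertical_test g).
  assert (Hxi : forall x, Cn_1d 4 xi x) by (intros; now apply is_bump_radial_test).
  assert (Heta : forall x, Cn_1d 4 eta x) by (intros; now apply is_bump_vertical_test).
  assert (HR : forall x, lo <= x <= 1 -> regular r z x) by (intros; apply HP; lra).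
  set (I0 := RInt (energy_density a b c e r z) (inner_radius D) lo).
  set (bd := fun t => fold_right Rplus 0 (map (fun k => 2 * PI * (alpha / along r xi t (radius k)
      + beta * along r xi t (radius k))) (boundary D))).
  assert (HE : locally 0 (fun t =>
    2 * PI * (I0 + RInt (density_along a b c e r z xi eta t) lo 1) + bd t =
    energy a c b alpha beta D (fun u v => vadd (X u v) (vscale t (rot_field s e f g u v))))).
  { generalize (filter_and _ _ (nondegenerate_near r z xi eta lo 1 HR Hxi Heta)
       (ex_RInt_density_along a b c e r z xi eta lo 1 ltac:(lra) HR Hxi Heta)).
    apply filter_imp. intros t [Hadm HexL].
    assert (HRt : forall x, inner_radius D <= x <= 1 -> 0 < x -> regular (along r xi t) (along z eta t) x).
    { intros x Hx Hx0. apply regular_along; auto; [apply HP; lra|].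
      destruct (Rle_lt_dec lo x) as [Hlx|Hlx]; [apply Hadm; lra|].
      destruct (density_along_frozen D lo f g a b c e r z t x Hsup) as (_ & Z1 & Z2 & Z3); [lra|].
      unfold nondegenerate_along, xi, eta. rewrite Z1, Z2, Z3, !Rmult_0_r, !Rplus_0_r.
      destruct HP as [_ HP]. split; apply (HP x); lra. }
    assert (HED : forall x, inner_radius D <= x <= 1 -> 0 < x ->
       energy_density a b c e (along r xi t) (along z eta t) x = density_along a b c e r z xi eta t x).
    { intros x Hx Hx0. destruct HP as [_ HP].
      apply energy_density_along; trivial; apply (HP x); lra. }
    (* Below lo nothing depends on t. *)
    assert (Hin : forall x, inner_radius D < x < lo ->
       energy_density a b c e r z x = energy_density a b c e (along r xi t) (along z eta t) x).
    { intros x Hx. rewrite HED by lra. unfold xi, eta.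
      destruct (density_along_frozen D lo f g a b c e r z t x Hsup) as (-> & _); [lra|].
      unfold energy_density, density_along, shiftedH, pcurv, psin, pspeed. rewrite !Rmult_0_l, !Rplus_0_r. reflexivity. }
    assert (X1 : ex_RInt (energy_density a b c e r z) (inner_radius D) lo).
    { apply (ex_RInt_near_axis a b c D X s e); trivial. lra. }
    assert (X1' : ex_RInt (energy_density a b c e (along r xi t) (along z eta t)) (inner_radius D) lo).
    { eapply ex_RInt_ext; [|exact X1]. rewrite Rmin_left, Rmax_right by lra. exact Hin. }
    assert (X2 : ex_RInt (energy_density a b c e (along r xi t) (along z eta t)) lo 1).
    { eapply ex_RInt_ext; [|exact HexL]. rewrite Rmin_left, Rmax_right by lra.
      intros x Hx. symmetry. apply HED; lra. }
    rewrite (energy_rotational a b c alpha beta D _ s e (along r xi t) (along z eta t)); trivial.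
    - f_equal. f_equal. pose proof (RInt_Chasles _ _ _ _ X1' X2) as HC.
      unfold plus in HC; simpl in HC. rewrite <- HC. unfold I0. f_equal.
      + apply RInt_ext. rewrite Rmin_left, Rmax_right by lra. exact Hin.
      + apply RInt_ext. rewrite Rmin_left, Rmax_right by lra. intros x Hx. symmetry. apply HED; lra.
    - intros x th Hx. now apply (variation_polar D X s e r z f g t x th HP).
    - intros x Hx. apply HRt; lra.
    - intros k Hk. destruct (radius_bounds D k Hk). apply (HRt (radius k)); trivial.
    - exact (ex_RInt_Chasles _ _ _ _ X1' X2). }
  assert (HB : is_derive bd 0 (2 * PI * (tension alpha beta (r 1) * xi 1 + inner_tension alpha beta D r * xi lo))).
  { assert (R1 : 0 < r 1) by (apply HR; lra).
    pose proof (is_derive_circle_energy alpha beta (r 1) (xi 1) R1) as D1.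
    unfold bd. destruct D; simpl.
    - eapply is_derive_eq.
      + apply @is_derive_plus; [exact D1|apply @is_derive_const].
      + unfold plus, zero; simpl. ring.
    - simpl in Hsup. assert (R2 : 0 < r (/ 2)) by (apply HR; lra).
      pose proof (is_derive_circle_energy alpha beta (r (/ 2)) (xi (/ 2)) R2) as D2.
      eapply is_derive_eq.
      + apply @is_derive_plus; [exact D1|]. apply @is_derive_plus; [exact D2|apply @is_derive_const].
      + unfold plus, zero; simpl. rewrite Hsup. ring. }
  pose proof (is_derive_RInt_density_along a b c e r z xi eta lo 1 Hlo1 He2 HR Hxi Heta) as HL.
  specialize (Hcrit _ (C4_rot_field D s e f g Hf Hg)).
  assert (HT : is_derive (fun t => 2 * PI * (I0 + RInt (density_along a b c e r z xi eta t) lo 1) + bd t) 0 0).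
  { eapply is_derive_ext_loc; [|exact Hcrit].
    eapply filter_imp; [|exact HE]. intros t Ht. now symmetry. }
  apply is_derive_unique in HT.
  match type of HL with is_derive _ _ ?l => set (L := l) in HL end.
  assert (HT2 : is_derive (fun t => 2 * PI * (I0 + RInt (density_along a b c e r z xi eta t) lo 1) + bd t) 0
     (2 * PI * L + 2 * PI * (tension alpha beta (r 1) * xi 1 + inner_tension alpha beta D r * xi lo))).
  { apply @is_derive_plus; [|exact HB].
    apply (is_derive_scal (fun t => I0 + RInt (density_along a b c e r z xi eta t) lo 1)).
    eapply is_derive_eq.
    - apply @is_derive_plus; [apply @is_derive_const|exact HL].
    - unfold plus, zero; simpl. ring. }
  apply is_derive_unique in HT2. rewrite HT in HT2.
  unfold variational_eq, test_flux. fold xi. fold eta.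
  assert (HPI : 2 * PI <> 0) by (pose proof PI_RGT_0; lra).
  apply (Rmult_eq_reg_l (2 * PI)); trivial. rewrite Rmult_0_r, HT2. unfold L. ring.
Qed.

(** * Consequences of criticality on the surface *)

Lemma critical_variational_eq_inside D X a b c alpha beta s e r z lo :
  immersion D X -> (s = 1 \/ s = - 1) -> (e = 1 \/ e = - 1) -> has_profile D X s e r z ->
  critical a c b alpha beta D X -> inner_radius D <= lo -> (D = Annulus -> lo = / 2) -> 0 < lo < 1 ->
  forall f g m, is_bump f -> is_bump g -> lo ^ 2 < m -> zero_below f m -> zero_below g m ->
     variational_eq a b c e r z lo 1 (inner_tension alpha beta D r) (tension alpha beta (r 1)) f g.
Proof.
  intros HX Hs He HP Hc Hlo HA Hlo0 f g m Hf Hg Hm Zf Zg.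
  apply (critical_variational_eq a b c alpha beta D X s); trivial; [|lra].
  destruct D; simpl.
  - split; [lra|]. now exists m.
  - now apply HA.
Qed.

Lemma euler_lagrange D X a b c alpha beta s e r z :
  a <> 0 ->
  immersion D X -> (s = 1 \/ s = - 1) -> (e = 1 \/ e = - 1) -> has_profile D X s e r z ->
  critical a c b alpha beta D X ->
  forall x, inner_radius D <= x <= 1 -> 0 < x -> EL_op c e r z x = 0.
Proof.
  intros Ha HX Hs He HP Hc x Hx Hx0.
  assert (exists lo, inner_radius D <= lo /\ (D = Annulus -> lo = / 2) /\ 0 < lo < 1 /\ lo <= x)
    as (lo & L1 & L2 & L3 & L4).
  { destruct D; simpl in *; [exists (x / 2)|exists (/ 2)]; repeat split; try lra; discriminate. }
  apply (EL_op_zero a b c e r z lo 1 (inner_tension alpha beta D r) (tension alpha beta (r 1))); trivial; try lra.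
  - now apply sign_sqr.
  - intros y Hy. apply HP; lra.
  - now apply (critical_variational_eq_inside D X a b c alpha beta s).
Qed.

Lemma boundary_conditions D X a b c alpha beta s e r z k :
  a <> 0 ->
  immersion D X -> (s = 1 \/ s = - 1) -> (e = 1 \/ e = - 1) -> has_profile D X s e r z ->
  critical a c b alpha beta D X -> In k (boundary D) ->
  let x := radius k in
  a * e * r x * shiftedH c e r z x + b * psin r z x = 0 /\
  orient k * r x * (a * shiftedH c e r z x ^ 2 + b * (pcurv r z x * psin r z x / r x))
    + tension alpha beta (r x) * pcos r z x = 0 /\
  a * r x * (shiftedH c e r z x * (shiftedH c e r z x * psin r z x - e * pcurv r z x * psin r z x)
     - Derive (shiftedH c e r z) x / pspeed r z x * (e * pcos r z x)) = 0.
Proof.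
  intros Ha HX Hs He HP Hc Hk x. destruct (radius_bounds D k Hk) as [Hx Hx0]. fold x in Hx, Hx0.
  pose proof (sign_sqr _ He) as He2. pose proof (inner_radius_bounds D) as Hb.
  assert (HR : forall y, / 2 <= y <= 1 -> regular r z y).
  { intros y Hy. apply HP; [|lra]. destruct D; simpl; lra. }
  apply (natural_conditions a b c e r z x (orient k) (tension alpha beta (r x))); trivial.
  - destruct k; simpl; lra.
  - apply HP; trivial.
  - destruct k; simpl in x; unfold x; intros v0 v1 w0 w1; simpl.
    + rewrite Rmult_1_l.
      apply (natural_hi a b c e r z (/ 2) 1 (inner_tension alpha beta D r) (tension alpha beta (r 1)));
        trivial; try lra.
      apply (critical_variational_eq_inside D X a b c alpha beta s); trivial; try lra.
      destruct D; simpl; lra.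
    + destruct D; [destruct Hk as [E|[]]; discriminate|].
      replace (- 1 * natural_flux a b c e r z (/ 2) v0 v1 w0 w1) with (- natural_flux a b c e r z (/ 2) v0 v1 w0 w1) by ring.
      apply (natural_lo a b c e r z (/ 2) 1 (tension alpha beta (r (/ 2))) (tension alpha beta (r 1)));
        trivial; try lra.
      intros f g Hf Hg.
      apply (critical_variational_eq a b c alpha beta Annulus X s); trivial; simpl; lra.
Qed.

(** On a disc the center is reached by continuity along the half-line v = 0. *)
Lemma extend_to_axis D (F : R -> R -> R) :
  (forall u v, Sigma D u v -> continuity_2d_pt F u v) ->
  (forall x th, inner_radius D <= x <= 1 -> 0 < x -> F (x * cos th) (x * sin th) = 0) ->
  forall u v, Sigma D u v -> F u v = 0.
Proof.
  intros HC HF u v HS. destruct (polar_coordinates u v) as (th & Hu & Hv).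
  unfold Sigma in HS. change (inner_radius D <= rho u v <= 1) in HS.
  pose proof (inner_radius_bounds D) as Hb.
  destruct (Req_dec (rho u v) 0) as [H0|H0].
  - rewrite H0, Rmult_0_l in Hu, Hv. subst u v.
    apply (eq_closed_interval (fun x => F x 0) (fun _ => 0) 0 1); try lra.
    + intros x Hx. apply continuous_slice_u, HC, Sigma_axis. lra.
    + intros; apply continuous_const.
    + intros x Hx. pose proof (HF x 0 ltac:(lra) ltac:(lra)) as E.
      now rewrite cos_0, sin_0, Rmult_1_r, Rmult_0_r in E.
  - pose proof (HF (rho u v) th HS ltac:(lra)) as E. now rewrite <- Hu, <- Hv in E.
Qed.

Lemma circle_bdry_image s e d z Y k : (s = 1 \/ s = - 1) -> (e = 1 \/ e = - 1) -> 0 < d ->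
  circle_bdry s e d z Y k -> bdry_circle Y k d z.
Proof.
  intros Hs He Hd H. split; trivial. intros p.
  assert (Hshift : forall th, cos (th + PI) = - cos th /\ sin (th + PI) = - sin th).
  { intros th. split; [apply neg_cos|apply neg_sin]. }
  assert (HE : exists q, forall th, s * d * cos th = d * cos (e * th + q) /\
     e * (s * d * sin th) = d * sin (e * th + q)).
  { destruct Hs as [->| ->]; [exists 0|exists PI]; intros th; destruct He as [->| ->].
    - replace (1 * th + 0) with th by ring. split; ring.
    - replace (- 1 * th + 0) with (- th) by ring. rewrite cos_neg, sin_neg. split; ring.
    - replace (1 * th + PI) with (th + PI) by ring. destruct (Hshift th) as [-> ->]. split; ring.
    - replace (- 1 * th + PI) with (- th + PI) by ring. destruct (Hshift (- th)) as [-> ->].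
      rewrite cos_neg, sin_neg. split; ring. }
  destruct HE as [q Hq].
  assert (He2 : e * e = 1) by (destruct He as [->| ->]; ring).
  split.
  - intros [th ->]. exists (e * th + q). rewrite H. destruct (Hq th) as [-> ->]. reflexivity.
  - intros [ph ->]. exists (e * (ph - q)). rewrite H. destruct (Hq (e * (ph - q))) as [-> ->].
    replace (e * (e * (ph - q)) + q) with ph; [reflexivity|].
    rewrite <- Rmult_assoc, He2. ring.
Qed.

(** The square of the distance to the axis is constant on the image. *)
Lemma circle_radius_unique s e d z Y k d' h : (s = 1 \/ s = - 1) -> 0 < d ->
  circle_bdry s e d z Y k -> bdry_circle Y k d' h -> d' = d.
Proof.
  intros Hs Hd H [Hd' HI]. destruct (proj1 (HI (on_bdry Y k 0))) as [ph E]; [now exists 0|].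
  rewrite H, cos_0, sin_0 in E.
  assert (E1 : s * d = d' * cos ph) by (injection E; intros; lra).
  assert (E2 : d' * sin ph = 0) by (injection E; intros; lra).
  pose proof (sin2_cos2 ph) as T. unfold Rsqr in T.
  assert (E3 : d' * d' = d * d).
  { replace (d' * d') with (d' * d' * (sin ph * sin ph + cos ph * cos ph)) by (rewrite T; ring).
    replace (d * d) with ((s * d) * (s * d)) by (destruct Hs as [->| ->]; ring).
    rewrite E1. replace (d' * d' * _) with ((d' * sin ph) * (d' * sin ph) + d' * cos ph * (d' * cos ph)) by ring.
    rewrite E2. ring. }
  nra.
Qed.

Lemma tension_zero alpha beta d : 0 < alpha -> 0 < beta -> 0 < d ->
  tension alpha beta d = 0 <-> d = sqrt (alpha / beta).
Proof.
  intros Ha Hb Hd. unfold tension.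
  assert (Hq : 0 < alpha / beta) by now apply Rdiv_lt_0_compat.
  split; intros E.
  - rewrite <- (sqrt_pow2 d) by lra. f_equal.
    apply (Rmult_eq_reg_r beta); [|lra]. replace (alpha / beta * beta) with alpha by (field; lra).
    apply Rminus_diag_uniq in E. rewrite E. field; lra.
  - rewrite E, pow2_sqrt by lra. field; lra.
Qed.

(** * Vertical translations *)

Lemma Derive_shift (f : R -> R) k x : Derive (fun s => f s + k) x = Derive f x.
Proof.
  unfold Derive. f_equal. apply Lim_ext. intros y. f_equal. ring.
Qed.

Lemma d_u_translate t X u v : d_u (translate t X) u v = d_u X u v.
Proof.
  unfold d_u, vDerive, translate, vadd, vscale. unfold x1, x2, x3; simpl.
  now rewrite !Derive_shift.
Qed.

Lemma d_v_translate t X u v : d_v (translate t X) u v = d_v X u v.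
Proof.
  unfold d_v, vDerive, translate, vadd, vscale. unfold x1, x2, x3; simpl.
  now rewrite !Derive_shift.
Qed.

Lemma nu_translate t X u v : nu (translate t X) u v = nu X u v.
Proof. unfold nu. now rewrite d_u_translate, d_v_translate. Qed.

Lemma H_K_translate t X u v :
  H (translate t X) u v = H X u v /\ K (translate t X) u v = K X u v.
Proof.
  assert (E1 : d_u (nu (translate t X)) u v = d_u (nu X) u v).
  { apply d_u_ext, locally_2d_forall. intros; apply nu_translate. }
  assert (E2 : d_v (nu (translate t X)) u v = d_v (nu X) u v).
  { apply d_v_ext, locally_2d_forall. intros; apply nu_translate. }
  unfold H, K, det_I, I_uu, I_uv, I_vv, II_uu, II_uv, II_vu, II_vv.
  now rewrite E1, E2, d_u_translate, d_v_translate.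
Qed.

Lemma profile_circle D X s e r z k t : has_profile D X s e r z -> In k (boundary D) ->
  circle_bdry s e (r (radius k)) (z (radius k) + t) (translate t X) k.
Proof.
  intros [HP _] Hk th. destruct (radius_bounds D k Hk) as [Hx _].
  unfold on_bdry, translate. rewrite HP by trivial.
  unfold vadd, vscale. apply vec_eq; unfold x1, x2, x3; simpl; ring.
Qed.

(** The condition a h + b kappa_n = 0 gives S = 0, hence C is not 0, and the
    second boundary condition reduces to tension C = 0. *)
Lemma delaunay_case D X a b c alpha beta s e r z :
  0 < a -> 0 < alpha -> 0 < beta -> b <> 0 ->
  immersion D X -> (s = 1 \/ s = - 1) -> (e = 1 \/ e = - 1) -> has_profile D X s e r z ->
  axially_symmetric D X -> critical a c b alpha beta D X ->
  (forall x, inner_radius D <= x <= 1 -> 0 < x -> shiftedH c e r z x = 0) ->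
  Delaunay D X /\ forall k, In k (boundary D) -> exists h, bdry_circle X k (sqrt (alpha / beta)) h.
Proof.
  intros Ha Hal Hbe Hb HX Hs He HP Hsym Hc Hh. split; [split; trivial|].
  - exists (- c). intros u v HS. apply Rplus_eq_reg_r with c. rewrite Rplus_opp_l. revert u v HS.
    apply (extend_to_axis D (fun u v => H X u v + c)).
    + intros u v HS. apply (Cn_continuity 2).
      apply (Cn_plus 2 (H X) (fun _ _ => c)); [|apply Cn_const].
      destruct HX as [HX HI]. apply Cn_H_K; [now apply (C4_Cn3 D)|now apply HI].
    + intros x th Hx Hx0. rewrite <- (Hh x Hx Hx0).
      destruct (closed_geometry D X s e r z x th HX Hs He HP Hx Hx0) as (_ & -> & _). reflexivity.
  - intros k Hk. exists (z (radius k)). destruct (radius_bounds D k Hk) as [Hx Hx0].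
    assert (HR : regular r z (radius k)) by now apply HP.
    assert (Hr : 0 < r (radius k)) by apply HR.
    destruct (boundary_conditions D X a b c alpha beta s e r z k) as (B1 & B2 & _); trivial; [lra|].
    rewrite (Hh _ Hx Hx0) in B1, B2.
    assert (HS : psin r z (radius k) = 0).
    { apply (Rmult_eq_reg_l b); trivial. lra. }
    pose proof (pcos2_psin2 _ _ _ HR) as HCS. rewrite HS in *.
    assert (HC : pcos r z (radius k) <> 0) by (intros E; rewrite E in HCS; lra).
    assert (HT : tension alpha beta (r (radius k)) = 0).
    { apply (Rmult_eq_reg_r (pcos r z (radius k))); trivial. rewrite Rmult_0_l, <- B2.
      field. lra. }
    apply tension_zero in HT; trivial. rewrite <- HT.
    apply (circle_bdry_image s e); trivial. intros th. unfold on_bdry.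
    now apply HP.
Qed.

(** A boundary circle is geodesic exactly when C = 0, that is nu_3 = 0 along it.
    As C^2 + S^2 = 1 and a h = - b kappa_n, then h is not 0 there and
    the circle is at height 0.  Otherwise (iii) is the combination of
    h z = - nu_3 and a h = - b kappa_n, with the sign orient k e. *)
Lemma reduced_case D X a b c alpha beta s e r z t :
  0 < a -> 0 < alpha -> 0 < beta -> b <> 0 ->
  immersion D X -> (s = 1 \/ s = - 1) -> (e = 1 \/ e = - 1) -> has_profile D X s e r z ->
  critical a c b alpha beta D X ->
  (forall x, inner_radius D <= x <= 1 -> 0 < x -> shiftedH c e r z x * (z x + t) = - (e * pcos r z x)) ->
  let Y := translate t X in
  (forall u v, Sigma D u v -> (H Y u v + c) * x3 (Y u v) = - x3 (nu Y u v)) /\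
  (forall k, In k (boundary D) ->
        (type_i Y k \/ type_ii alpha beta Y k \/ type_iii a b alpha beta Y k) /\
        (type_i Y k \/ type_ii alpha beta Y k ->
         forall th, a * (on_bdry (H Y) k th + c) ^ 2 + b * on_bdry (K Y) k th = 0)).
Proof.
  intros Ha Hal Hbe Hb HX Hs He HP Hc Hh Y. pose proof (inner_radius_bounds D) as Hin.
  pose proof (sign_sqr _ Hs) as Hs2. pose proof (sign_sqr _ He) as He2.
  split.
  - intros u v HS. unfold Y. rewrite (proj1 (H_K_translate t X u v)), nu_translate.
    replace (x3 (translate t X u v)) with (x3 (X u v) + t)
      by (unfold translate, vadd, vscale, x3; simpl; ring).
    apply Rplus_opp_r_uniq. rewrite Rplus_comm. revert u v HS.
    apply (extend_to_axis D (fun u v => (H X u v + c) * (x3 (X u v) + t) + x3 (nu X u v))).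
    + intros u v HS. destruct HX as [HX HI]. pose proof (C4_Cn3 D X u v HX HS) as H4.
      specialize (HI u v HS). apply (Cn_continuity 2).
      apply (Cn_plus 2 (fun u v => (H X u v + c) * (x3 (X u v) + t)) (fun u v => x3 (nu X u v))).
      * apply (Cn_mult 2 (fun u v => H X u v + c) (fun u v => x3 (X u v) + t)).
        -- apply (Cn_plus 2 (H X) (fun _ _ => c)); [now apply Cn_H_K|apply Cn_const].
        -- apply (Cn_plus 2 (fun u v => x3 (X u v)) (fun _ _ => t)); [|apply Cn_const].
           exact (Cn_pred _ _ _ _ (Cn_pred _ _ _ _ (proj2 (proj2 H4)))).
      * exact (Cn_pred _ _ _ _ (proj2 (proj2 (Cn3_nu 3 X u v H4 HI)))).
    + intros x th Hx Hx0. specialize (Hh x Hx Hx0).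
      destruct (closed_geometry D X s e r z x th HX Hs He HP Hx Hx0) as (-> & -> & _).
      destruct HP as [HP _]. rewrite HP by trivial. unfold x3; simpl.
      change (shiftedH c e r z x * (z x + t) + e * pcos r z x = 0). rewrite Hh. ring.
  - intros k Hk. destruct (radius_bounds D k Hk) as [Hx Hx0].
    assert (HR : regular r z (radius k)) by now apply HP.
    assert (Hr : 0 < r (radius k)) by apply HR.
    destruct (boundary_conditions D X a b c alpha beta s e r z k) as (B1 & B2 & _); trivial; [lra|].
    specialize (Hh _ Hx Hx0). pose proof (pcos2_psin2 _ _ _ HR) as HCS.
    pose proof (profile_circle D X s e r z k t HP Hk) as HCi. fold Y in HCi.
    pose proof (circle_bdry_image s e _ _ Y k Hs He Hr HCi) as Him.
    assert (Hgeo : forall th,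
       on_bdry (nu Y) k th = (s * (- e * psin r z (radius k)) * cos th,
           e * (s * (- e * psin r z (radius k)) * sin th), e * pcos r z (radius k)) /\
       on_bdry (H Y) k th + c = shiftedH c e r z (radius k) /\
       on_bdry (K Y) k th = pcurv r z (radius k) * psin r z (radius k) / r (radius k)).
    { intros th. unfold on_bdry, Y. rewrite nu_translate.
      destruct (H_K_translate t X (radius k * cos th) (radius k * sin th)) as [-> ->].
      destruct (closed_geometry D X s e r z (radius k) th HX Hs He HP Hx Hx0) as (-> & -> & ->).
      repeat split. }
    assert (Hkap : forall th, kappa_n Y k th = e * psin r z (radius k) / r (radius k) /\
       kappa_g Y k th = - orient k * pcos r z (radius k) / r (radius k)).
    { intros th. apply (circle_kappa_n_g s e _ (z (radius k) + t)); trivial. apply Hgeo. }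
    set (S := psin r z (radius k)) in *. set (C := pcos r z (radius k)) in *.
    set (d := r (radius k)) in *. set (h := shiftedH c e r z (radius k)) in *.
    set (kk := pcurv r z (radius k)) in *. set (h3 := z (radius k) + t) in *.
    assert (Ho : orient k = 1 \/ orient k = - 1) by (destruct k; simpl; auto).
    assert (Ho0 : orient k <> 0) by (destruct Ho; lra).
    assert (Hgd : geodesic Y k <-> C = 0).
    { split.
      - intros Hg. specialize (Hg 0). rewrite (proj2 (Hkap 0)) in Hg.
        apply (Rmult_eq_reg_l (- orient k / d)).
        + rewrite Rmult_0_r, <- Hg. field. lra.
        + apply Rmult_integral_contrapositive_currified; [lra|]. apply Rinv_neq_0_compat; lra.
      - intros E th. rewrite (proj2 (Hkap th)), E. field. lra. }
    split.
    + destruct (Req_dec C 0) as [HC0|HC0].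
      * left. split; [now apply Hgd|]. exists d. replace 0 with h3; [exact Him|].
        assert (Hh0 : h <> 0).
        { intros E. rewrite E in B1. assert (S = 0) by (apply (Rmult_eq_reg_l b); trivial; lra).
          rewrite HC0 in HCS. nra. }
        rewrite HC0 in Hh. apply (Rmult_eq_reg_l h); trivial. lra.
      * right. destruct (Req_dec d (sqrt (alpha / beta))) as [Hd|Hd].
        -- left. split; [now rewrite Hgd|]. exists h3. now rewrite <- Hd.
        -- right. split; [now rewrite Hgd|]. exists d, h3. split; [trivial|]. split; [trivial|].
           assert (HbS : b * (e * S / d) * h3 = a * e * C).
           { replace (b * (e * S / d)) with (- (a * h)).
             - replace (- (a * h) * h3) with (- a * (h * h3)) by ring. rewrite Hh. ring.
             - replace (b * (e * S / d)) with (e * (b * S) / d) by (field; lra).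
               replace (b * S) with (- (a * e * d * h)) by lra.
               replace (e * - (a * e * d * h) / d) with (- (a * h) * (e ^ 2)) by (field; lra).
               rewrite He2. ring. }
           assert (HX3 : forall th, x3 (on_bdry Y k th) = h3) by (intros th; now rewrite HCi).
           assert (HKg : forall th, a * kappa_g Y k th * d = - (a * orient k * C)).
           { intros th. rewrite (proj2 (Hkap th)). field. lra. }
           destruct Ho as [Ho|Ho], He as [He|He].
           ++ left. intros th. rewrite HKg, HX3, (proj1 (Hkap th)), HbS, Ho, He. ring.
           ++ right. intros th. rewrite HKg, HX3, (proj1 (Hkap th)), HbS, Ho, He. ring.
           ++ right. intros th. rewrite HKg, HX3, (proj1 (Hkap th)), HbS, Ho, He. ring.
           ++ left. intros th. rewrite HKg, HX3, (proj1 (Hkap th)), HbS, Ho, He. ring.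
    + intros HT th. destruct (Hgeo th) as (_ & -> & ->).
      assert (HTC : tension alpha beta d * C = 0).
      { destruct HT as [[Hg _]|[_ [h' Hci]]].
        - apply Hgd in Hg. rewrite Hg. ring.
        - pose proof (circle_radius_unique s e d h3 Y k _ _ Hs Hr HCi Hci) as E.
          symmetry in E. apply tension_zero in E; trivial. rewrite E. ring. }
      rewrite HTC, Rplus_0_r in B2.
      apply (Rmult_eq_reg_l (orient k * d)).
      * rewrite Rmult_0_r. exact B2.
      * apply Rmult_integral_contrapositive_currified; lra.
Qed.

Theorem theorem4p3
  (a c_o b alpha beta : R)
  (ha : 0 < a) (halpha : 0 < alpha) (hbeta : 0 < beta) (hb : b <> 0)
  (D : model) (X : R -> R -> R3)
  (hX : immersion D X)
  (hsym : axially_symmetric D X)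
  (hcrit : critical a c_o b alpha beta D X) :
  (Delaunay D X /\
   forall c, In c (boundary D) ->
     exists h, bdry_circle X c (sqrt (alpha / beta)) h)
  \/
  (exists t : R, let Y := translate t X in
     (forall u v, Sigma D u v ->
        (H Y u v + c_o) * x3 (Y u v) = - x3 (nu Y u v)) /\
     (forall c, In c (boundary D) ->
        (type_i Y c \/ type_ii alpha beta Y c \/ type_iii a b alpha beta Y c) /\
        (type_i Y c \/ type_ii alpha beta Y c ->
         forall th, a * (on_bdry (H Y) c th + c_o) ^ 2
                    + b * on_bdry (K Y) c th = 0))).
Proof.
  destruct (profile_exists D X hX hsym) as (s & e & r & z & Hs & He & HP).
  pose proof (inner_radius_bounds D) as Hin.
  assert (Hreg : forall x, inner_radius D <= x <= 1 -> 0 < x -> regular r z x) by apply HP.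
  assert (HEL : forall x, inner_radius D <= x <= 1 -> 0 < x -> EL_op c_o e r z x = 0).
  { apply (euler_lagrange D X a b c_o alpha beta s); trivial. lra. }
  assert (Hout : In Outer (boundary D)) by (destruct D; left; reflexivity).
  destruct (boundary_conditions D X a b c_o alpha beta s e r z Outer) as (_ & _ & B3); trivial; [lra|].
  simpl in B3.
  destruct (shiftedH_height_combo_dependent a c_o e r z 1) as [[H0 G0]|(t & HU & HV)]; trivial; try lra.
  { apply Hreg; lra. }
  - left. apply (delaunay_case D X a b c_o alpha beta s e r z); trivial.
    intros x Hx Hx0. apply (shiftedH_vanishes c_o e r z x 1); trivial; try lra.
    + intros y Hy. apply Hreg; lra.
    + intros y Hy. apply HEL; lra.
  - right. exists (- t). apply (reduced_case D X a b c_o alpha beta s e r z); trivial.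
    intros x Hx Hx0.
    assert (E : height_combo c_o e r z x = t * shiftedH c_o e r z x).
    { apply (height_proportional c_o e r z x 1); trivial; try lra.
      - now apply sign_sqr.
      - intros y Hy. apply Hreg; lra.
      - intros y Hy. apply HEL; lra. }
    unfold height_combo in E. lra.
Qed.
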